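(* Let $A=\mathbb F_q[T]$, $K=\mathbb F_q(T)$, let $v$ be a finite place of $K$ (not the pole of $T$), let $L_v/K_v$ be a finite extension of the completion $K_v$, let $\mathbb C_v$ be the completion of an algebraic closure of $L_v$, and let $\phi/L_v$ be a Drinfeld $A$-module of rank $r$ with potentially stable reduction of rank $r-s$. Then there exist nonzero $a_1,\dots,a_s\in A$, of degree bounded in terms of $s$ and $-v(j_\phi)$, such that $$\phi^{\mathrm{FJ}}(L_v)/\phi^0(L_v)\cong\bigoplus_{i=1}^sA/a_iA,$$ and $$\phi^{\mathrm{FJ}}(\mathbb C_v)/\phi^0(\mathbb C_v)\cong (K/A)^s,$$ as $A$-modules. In particular, both modules are trivial if $\phi$ has potentially good reduction.
   Context: Drinfeld modules. $q$ is a prime power. For a field $F\supseteq K$, a Drinfeld $A$-module over $F$ is a ring homomorphism $\phi:A\to \mathrm{End}_F(\mathbb G_a)$, $a\mapsto\phi_a$, with $\phi_a(x)=ax+O(x^q)\in F[x]$ for all $a$ and $\phi_a(x)\ne ax$ for some $a$; its rank $r$ satisfies $\deg\phi_a(x)=q^{r\deg a}$ for all nonzero $a$. Thus $\phi_T(x)=Tx+b_1x^q+\cdots+b_rx^{q^r}$, $b_r\ne0$. $\phi(F)$ is $F$ with the $A$-module structure $a\cdot x=\phi_a(x)$. $\phi$ and $\psi$ are isomorphic over $F'$ if $\phi_a(\alpha x)=\alpha\psi_a(x)$ for all $a$ for some $\alpha\in F'^*$. Reduction. $\phi$ has stable reduction of rank $r_1$ if all $\phi_a$ have integral coefficients and reduction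 modulo the maximal ideal gives a Drinfeld module of rank $r_1$ over the residue field (equivalently $\phi_T$ has integral coefficients, $b_{r_1}$ is a unit, with $r_1\geq 1$, and $b_j$ is a non-unit for $j>r_1$). Potentially stable reduction of rank $r_1$: this holds after a finite extension of the field and replacing $\phi$ by an isomorphic Drinfeld module. (Potentially) good reduction is (potentially) stable reduction of rank $r$. Filled Julia set. $\mathbb A^1_{\mathrm{Berk}}$ is the Berkovich affine line over $\mathbb C_v$ (multiplicative seminorms on $\mathbb C_v[x]$ extending the absolute value), with $\mathbb C_v\subseteq\mathbb A^1_{\mathrm{Berk}}$; $A$ acts by $\|f\|_{a\cdot\zeta}=\|f\circ\phi_a\|_\zeta$. $\phi^{\mathrm{FJ}}_{\mathrm{Berk}}$ is the set of points with bounded $A$-orbit ($\|x\|$ bounded on the orbit), and $\phi^0_{\mathrm{Berk}}$ its connected component containing $0$ in the Berkovich topology. For a subfield $F\subseteq\mathbb C_v$, $\phi^{\mathrm{FJ}}(F)=\phi^{\mathrm{FJ}}_{\mathrm{Berk}}\cap F$ and $\phi^0(F)=\phi^0_{\mathrm{Berk}}\cap F$. So $\phi^{\mathrm{FJ}}(\mathbb C_v)=\{x\in\mathbb C_v:\{\phi_a(x)\}_{a\in A}\text{ is bounded}\}$. For $F=L_v$ or $\mathbb C_v$ these are $A$-submodules of $\phi(F)$. Here $-v(j_\phi)$ denotes the nonnegative number $$\max_{1\le j\le r}\Big\{\frac{-v(b_j)}{q^j-1}\Big\}+\frac{v(b_r)}{q^r-1},$$ where $v$ is the valuation on $L_v$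 normalized so that $v(L_v^* )=\mathbb Z$. *)

(* Defs.v *)
From HB Require Import structures.
From mathcomp Require Import all_boot all_order all_algebra all_field.
From mathcomp Require Import generic_quotient ring_quotient.
From mathcomp Require Import mathcomp_extra boolp classical_sets functions reals.
From mathcomp Require Import topology normedtype.

Set Implicit Arguments.
Unset Strict Implicit.
Unset Printing Implicit Defensive.

Import Order.TTheory GRing.Theory Num.Theory.
Import numFieldNormedType.Exports.
Local Open Scope classical_set_scope.
Local Open Scope ring_scope.
Local Open Scope quotient_scope.

Section SubModule.
Variables (A : nzRingType) (V : lmodType A) (M : submodClosed V).

Record submod : Type := Submod { submod_val : V; _ : submod_val \in M }.

HB.instance Definition _ := [isSub for submod_val].
HB.instance Definition _ := [Choice of submod by <:].
HB.instance Definition _ := [SubChoice_isSubLmodule of submod by <:].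

End SubModule.

Section QuotientModule.
Variables (A : nzRingType) (V : lmodType A) (N : submodClosed V).

(* [submodClosed] does not extend [zmodClosed], which [Quotient.quot] expects. *)
Definition submod_pred : {pred V} := N.

Fact submod_predP : submod_closed submod_pred.
Proof.
split=> [|a u v uN vN]; first exact: (rpred0 N).
by apply: (@rpredD V N); [apply: (@rpredZ A V N)|].
Qed.

HB.instance Definition _ := GRing.isSubmodClosed.Build A V submod_pred
  (GRing.submod_closed_semi submod_predP).

Definition quotmod : Type := {ideal_quot submod_pred}.

HB.instance Definition _ := GRing.Zmodule.on quotmod.

Definition quotmod_pi (x : V) : quotmod := \pi_({ideal_quot submod_pred}) x.

Lemma quotmod_piE x y : quotmod_pi x = quotmod_pi y <-> x - y \in N.
Proof.
rewrite -[x - y \in N]/(x - y \in submod_pred) Quotient.idealrBE.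
by split=> /eqP.
Qed.

Lemma quotmod_pi_surj (z : quotmod) : exists x, quotmod_pi x = z.
Proof. by exists (repr z); exact: reprK. Qed.

Lemma quotmod_piD x y : quotmod_pi (x + y) = quotmod_pi x + quotmod_pi y.
Proof. exact: (raddfD \pi_({ideal_quot submod_pred})). Qed.

Definition quotmod_scale (a : A) (z : quotmod) : quotmod :=
  quotmod_pi (a *: (repr z : V)).

Lemma quotmod_piZ a x : quotmod_scale a (quotmod_pi x) = quotmod_pi (a *: x).
Proof.
apply/quotmod_piE; rewrite -scalerBr rpredZ //.
by apply/quotmod_piE; exact: reprK.
Qed.

Fact quotmod_scalerA a b z :
  quotmod_scale a (quotmod_scale b z) = quotmod_scale (a * b) z.
Proof.
by have [x <-] := quotmod_pi_surj z; rewrite !quotmod_piZ scalerA.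
Qed.

Fact quotmod_scale1r : left_id 1 quotmod_scale.
Proof.
by move=> z; have [x <-] := quotmod_pi_surj z; rewrite quotmod_piZ scale1r.
Qed.

Fact quotmod_scalerDr : right_distributive quotmod_scale +%R.
Proof.
move=> a z w; have [x <-] := quotmod_pi_surj z.
have [y <-] := quotmod_pi_surj w.
by rewrite -quotmod_piD !quotmod_piZ scalerDr quotmod_piD.
Qed.

Fact quotmod_scalerDl z : {morph quotmod_scale^~ z : a b / a + b}.
Proof.
move=> a b /=; have [x <-] := quotmod_pi_surj z.
by rewrite !quotmod_piZ scalerDl quotmod_piD.
Qed.

HB.instance Definition _ := GRing.Zmodule_isLmodule.Build A quotmod
  quotmod_scalerA quotmod_scale1r quotmod_scalerDr quotmod_scalerDl.

End QuotientModule.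

Section SubQuotient.
Variables (A : nzRingType) (V : lmodType A) (M N : submodClosed V).

Definition submod_in : {pred submod M} := [pred x | submod_val x \in N].

Fact submod_inP : submod_closed submod_in.
Proof.
split=> [|a u v]; rewrite !inE; first exact: (rpred0 N).
by move=> uN vN; apply: (@rpredD V N); [apply: (@rpredZ A V N)|].
Qed.

HB.instance Definition _ := GRing.isSubmodClosed.Build A (submod M) submod_in
  (GRing.submod_closed_semi submod_inP).

(* M / (M :&: N), that is M / N when N is contained in M *)
Definition subquot : lmodType A := quotmod submod_in.

End SubQuotient.

Section DirectSum.
Variables (A : nzRingType) (I : finType) (M : I -> lmodType A).

Definition dsum : Type := forall i, M i.

HB.instance Definition _ := gen_eqMixin dsum.
HB.instance Definition _ := gen_choiceMixin dsum.

Definition dsum_zero : dsum := fun=> 0.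
Definition dsum_opp (x : dsum) : dsum := fun i => - x i.
Definition dsum_add (x y : dsum) : dsum := fun i => x i + y i.
Definition dsum_scale (a : A) (x : dsum) : dsum := fun i => a *: x i.

Fact dsum_addA : associative dsum_add.
Proof. by move=> x y z; apply: functional_extensionality_dep => i; exact: addrA. Qed.
Fact dsum_addC : commutative dsum_add.
Proof. by move=> x y; apply: functional_extensionality_dep => i; exact: addrC. Qed.
Fact dsum_add0 : left_id dsum_zero dsum_add.
Proof. by move=> x; apply: functional_extensionality_dep => i; exact: add0r. Qed.
Fact dsum_addN : left_inverse dsum_zero dsum_opp dsum_add.
Proof. by move=> x; apply: functional_extensionality_dep => i; exact: addNr. Qed.

HB.instance Definition _ :=
  GRing.isZmodule.Build dsum dsum_addA dsum_addC dsum_add0 dsum_addN.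

Fact dsum_scalerA a b x : dsum_scale a (dsum_scale b x) = dsum_scale (a * b) x.
Proof. by apply: functional_extensionality_dep => i; exact: scalerA. Qed.
Fact dsum_scale1r : left_id 1 dsum_scale.
Proof. by move=> x; apply: functional_extensionality_dep => i; exact: scale1r. Qed.
Fact dsum_scalerDr : right_distributive dsum_scale +%R.
Proof. by move=> a x y; apply: functional_extensionality_dep => i; exact: scalerDr. Qed.
Fact dsum_scalerDl x : {morph dsum_scale^~ x : a b / a + b}.
Proof. by move=> a b; apply: functional_extensionality_dep => i; exact: scalerDl. Qed.

HB.instance Definition _ := GRing.Zmodule_isLmodule.Build A dsum
  dsum_scalerA dsum_scale1r dsum_scalerDr dsum_scalerDl.

End DirectSum.

Definition lmod_iso (A : nzRingType) (U V : lmodType A) : Prop :=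
  exists f : {linear U -> V}, bijective f.

Section PolyModules.
Variable k : finFieldType.
Local Notation A := {poly k}.

Section Mod.
Variable a : A.

Definition principal : {pred A^o} := [pred x : A | a %| x].

Fact principalP : submod_closed principal.
Proof.
split=> [|c u v]; rewrite !inE; first exact: dvdp0.
by move=> au av; rewrite dvdp_add ?dvdp_mull.
Qed.

HB.instance Definition _ := GRing.isSubmodClosed.Build A A^o principal
  (GRing.submod_closed_semi principalP).

Definition polymod : lmodType A := quotmod principal.

End Mod.

Definition ratfun : Type := {fraction A}.
HB.instance Definition _ := GRing.Field.on ratfun.

Definition ratfun_scale (a : A) (x : ratfun) : ratfun := tofrac a * x.

Fact ratfun_scalerA a b x :
  ratfun_scale a (ratfun_scale b x) = ratfun_scale (a * b) x.
Proof. by rewrite /ratfun_scale rmorphM mulrA. Qed.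
Fact ratfun_scale1r : left_id 1 ratfun_scale.
Proof. by move=> x; rewrite /ratfun_scale rmorph1 mul1r. Qed.
Fact ratfun_scalerDr : right_distributive ratfun_scale +%R.
Proof. by move=> a x y; rewrite /ratfun_scale mulrDr. Qed.
Fact ratfun_scalerDl x : {morph ratfun_scale^~ x : a b / a + b}.
Proof. by move=> a b; rewrite /ratfun_scale rmorphD mulrDl. Qed.

HB.instance Definition _ := GRing.Zmodule_isLmodule.Build A ratfun
  ratfun_scalerA ratfun_scale1r ratfun_scalerDr ratfun_scalerDl.

Definition ratfun_int : {pred ratfun} :=
  [pred x | `[< exists a : A, x = tofrac a >]].

Fact ratfun_intP : submod_closed ratfun_int.
Proof.
split=> [|c u v]; rewrite !inE.
  by exists 0; rewrite rmorph0.
move=> [a ->] [b ->]; exists (c * a + b).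
by rewrite rmorphD rmorphM.
Qed.

HB.instance Definition _ := GRing.isSubmodClosed.Build A ratfun ratfun_int
  (GRing.submod_closed_semi ratfun_intP).

Definition KmodA : lmodType A := quotmod ratfun_int.

End PolyModules.

Record absval (R : realType) (F : fieldType) := Absval {
  absval_fun :> F -> R;
  absval_ge0 : forall x, 0 <= absval_fun x;
  absval_eq0 : forall x, absval_fun x = 0 <-> x = 0;
  absvalM : {morph absval_fun : x y / x * y};
  absvalD : forall x y,
    absval_fun (x + y) <= Num.max (absval_fun x) (absval_fun y)
}.

Section AbsoluteValues.
Variable R : realType.

Definition absval_extends (F E : fieldType) (j : {rmorphism F -> E})
  (NF : absval R F) (NE : absval R E) : Prop := forall x, NE (j x) = NF x.

Definition absval_complete (F : fieldType) (N : absval R F) : Prop :=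
  forall u : nat -> F,
    (forall e : R, 0 < e ->
       exists n0, forall m n, (n0 <= m)%N -> (n0 <= n)%N -> N (u m - u n) < e) ->
  exists l : F, forall e : R, 0 < e ->
    exists n0, forall n, (n0 <= n)%N -> N (u n - l) < e.

Definition is_completion (F E : fieldType) (j : {rmorphism F -> E})
  (NF : absval R F) (NE : absval R E) : Prop :=
  [/\ absval_extends j NF NE,
      absval_complete NE
    & forall (x : E) (e : R), 0 < e -> exists y : F, NE (x - j y) < e].

Definition is_algebraic_closure (F E : fieldType) (j : {rmorphism F -> E})
  : Prop :=
  GRing.closed_field_axiom E /\ forall x : E, algebraicOver j x.

(* An absolute value in the class of a place of k(T) other than the pole
   of T. *)
Definition is_finite_place (k : finFieldType)
  (N : absval R {fraction {poly k}}) : Prop :=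
  (exists x, x != 0 /\ N x != 1) /\ N (tofrac 'X) <= 1.

(* The valuation of N normalized to have value group Z; its value at 0 is
   irrelevant. *)
Definition is_normalized_valuation (F : fieldType) (N : absval R F)
  (v : F -> int) : Prop :=
  (exists c : R, [/\ 0 < c, c < 1 & forall x, x != 0 -> N x = c ^ v x]) /\
  (forall n : int, exists x, x != 0 /\ v x = n).

(* red is reduction modulo the maximal ideal; its values outside the valuation
   ring are irrelevant. *)
Definition is_residue_map (F : fieldType) (N : absval R F) (kappa : fieldType)
  (red : F -> kappa) : Prop :=
  [/\ red 1 = 1,
      forall x y, N x <= 1 -> N y <= 1 ->
        red (x + y) = red x + red y /\ red (x * y) = red x * red y,
      forall x, N x <= 1 -> (red x = 0 <-> N x < 1)
    & forall z, exists x, N x <= 1 /\ red x = z].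

End AbsoluteValues.

(* P is an endomorphism of the additive group: P(Y + X) = P(Y) + P(X) in
   F[X][Y]. *)
Definition additive_poly (F : fieldType) (P : {poly F}) : Prop :=
  map_poly polyC P \Po ('X + 'X%:P) = map_poly polyC P + P%:P.

(* gam is the structure map of F as an A-algebra. It is not assumed injective,
   so that reductions are covered. That gam is a ring morphism follows from the
   axioms, by comparing coefficients of 'X. *)
Record drinfeld (k : finFieldType) (F : fieldType) (gam : {poly k} -> F) :=
  Drinfeld {
    drinfeld_fun :> {poly k} -> {poly F};
    drinfeld_additive : forall a, additive_poly (drinfeld_fun a);
    drinfeld1 : drinfeld_fun 1 = 'X;
    drinfeldD : {morph drinfeld_fun : a b / a + b};
    drinfeldM : forall a b,
      drinfeld_fun (a * b) = drinfeld_fun a \Po drinfeld_fun b;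
    drinfeld_lin : forall a i, (i < #|k|)%N ->
      (drinfeld_fun a)`_i = (if i == 1%N then gam a else 0);
    drinfeld_nontrivial : exists a, drinfeld_fun a <> gam a *: 'X
  }.

Definition drinfeld_rank (k : finFieldType) (F : fieldType)
  (gam : {poly k} -> F) (phi : drinfeld gam) (r : nat) : Prop :=
  forall a, a != 0 -> size (phi a) = (#|k| ^ (r * (size a).-1)).+1.

Section BaseChange.
Variables (k : finFieldType) (F E : fieldType) (gam : {poly k} -> F).
Variables (j : {rmorphism F -> E}) (phi : drinfeld gam).

Definition base_change_fun (a : {poly k}) : {poly E} := map_poly j (phi a).

Fact base_change_additive a : additive_poly (base_change_fun a).
Proof.
rewrite /additive_poly /base_change_fun.
have /(congr1 (map_poly (map_poly j))) := drinfeld_additive phi a.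
rewrite map_comp_poly !rmorphD /= map_polyX !map_polyC /= map_polyX.
have -> : map_poly (map_poly j) (map_poly polyC (phi a)) =
          map_poly polyC (map_poly j (phi a)); last by [].
rewrite -!map_poly_comp; apply: eq_map_poly => x /=.
by rewrite map_polyC.
Qed.

Fact base_change1 : base_change_fun 1 = 'X.
Proof. by rewrite /base_change_fun drinfeld1 map_polyX. Qed.
Fact base_changeD : {morph base_change_fun : a b / a + b}.
Proof. by move=> a b; rewrite /base_change_fun drinfeldD rmorphD. Qed.
Fact base_changeM a b :
  base_change_fun (a * b) = base_change_fun a \Po base_change_fun b.
Proof. by rewrite /base_change_fun drinfeldM map_comp_poly. Qed.
Fact base_change_lin a i : (i < #|k|)%N ->
  (base_change_fun a)`_i = (if i == 1%N then (j \o gam) a else 0).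
Proof.
by move=> ik; rewrite coef_map /= drinfeld_lin //; case: ifP; rewrite ?rmorph0.
Qed.
Fact base_change_nontrivial :
  exists a, base_change_fun a <> (j \o gam) a *: 'X.
Proof.
have [a ha] := drinfeld_nontrivial phi; exists a => h; apply: ha.
by apply: (map_poly_inj j); rewrite map_polyZ map_polyX.
Qed.

Definition base_change : drinfeld (j \o gam) :=
  Drinfeld base_change_additive base_change1 base_changeD base_changeM
    base_change_lin base_change_nontrivial.

End BaseChange.

Definition drinfeld_iso (k : finFieldType) (F : fieldType)
  (gam : {poly k} -> F) (phi psi : drinfeld gam) : Prop :=
  exists2 alpha : F, alpha != 0 &
    forall a, phi a \Po (alpha *: 'X) = alpha *: psi a.

Section Reduction.
Variables (R : realType) (k : finFieldType).

Definition stable_reduction (F : fieldType) (N : absval R F)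
  (gam : {poly k} -> F) (phi : drinfeld gam) (r1 : nat) : Prop :=
  (forall a i, N (phi a)`_i <= 1) /\
  exists (kappa : fieldType) (red : F -> kappa),
    is_residue_map N red /\
    exists phibar : drinfeld (red \o gam),
      (forall a, phibar a = map_poly red (phi a)) /\ drinfeld_rank phibar r1.

Definition potentially_stable_reduction (F : fieldType) (N : absval R F)
  (gam : {poly k} -> F) (phi : drinfeld gam) (r1 : nat) : Prop :=
  exists (F' : fieldExtType F) (N' : absval R F'),
    absval_extends (in_alg F') N N' /\
    exists psi : drinfeld (in_alg F' \o gam),
      drinfeld_iso (base_change (in_alg F') phi) psi /\
      stable_reduction N' psi r1.

Definition potentially_good_reduction (F : fieldType) (N : absval R F)
  (gam : {poly k} -> F) (phi : drinfeld gam) : Prop :=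
  exists r, drinfeld_rank phi r /\ potentially_stable_reduction N phi r.

End Reduction.

Section JInvariant.
Variables (k : finFieldType) (F : fieldType) (gam : {poly k} -> F).
Variables (v : F -> int) (phi : drinfeld gam) (r : nat).

Definition drinfeld_coef (j : nat) : F := (phi 'X)`_(#|k| ^ j).

Definition vj_term (j : nat) : rat :=
  (- v (drinfeld_coef j))%:~R / ((#|k| ^ j)%:R - 1).

(* This is -v(j_phi). The indices j with b_j = 0 contribute -oo, and j = r is
   one of the indices, so [vj_term r] is a harmless default value. *)
Definition minus_vj : rat :=
  \big[Num.max/vj_term r]_(1 <= j < r.+1 | drinfeld_coef j != 0) vj_term j
  + (v (drinfeld_coef r))%:~R / ((#|k| ^ r)%:R - 1).

End JInvariant.

Section DrinfeldModule.
Variables (k : finFieldType) (F : fieldType) (gam : {poly k} -> F).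

Lemma additive_poly_shift (P : {poly F}) y :
  additive_poly P -> P \Po ('X + y%:P) = P + P.[y]%:P.
Proof.
move=> /(congr1 (horner^~ y%:P)); rewrite horner_comp !hornerE.
by rewrite horner_map /= addrC [_ + P]addrC.
Qed.

Lemma additive_polyD (P : {poly F}) x y :
  additive_poly P -> P.[x + y] = P.[x] + P.[y].
Proof.
move=> /(additive_poly_shift y)/(congr1 (horner^~ x)).
by rewrite horner_comp !hornerE.
Qed.

(* phi(F): the field F with A acting through phi *)
Definition dmod (phi : drinfeld gam) : Type := F.

Variable phi : drinfeld gam.
Local Notation D := (dmod phi).

HB.instance Definition _ := GRing.Zmodule.copy D F.

Definition dmod_scale (a : {poly k}) (x : D) : D := (phi a).[x : F].

Fact dmod_scalerA a b x : dmod_scale a (dmod_scale b x) = dmod_scale (a * b) x.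
Proof. by rewrite /dmod_scale drinfeldM horner_comp. Qed.
Fact dmod_scale1r : left_id 1 dmod_scale.
Proof. by move=> x; rewrite /dmod_scale drinfeld1 hornerX. Qed.
Fact dmod_scalerDr : right_distributive dmod_scale +%R.
Proof. by move=> a x y; apply: additive_polyD; exact: drinfeld_additive. Qed.
Fact dmod_scalerDl x : {morph dmod_scale^~ x : a b / a + b}.
Proof. by move=> a b; rewrite /dmod_scale drinfeldD hornerD. Qed.

HB.instance Definition _ := GRing.Zmodule_isLmodule.Build {poly k} D
  dmod_scalerA dmod_scale1r dmod_scalerDr dmod_scalerDl.

End DrinfeldModule.

Record berk (R : realType) (C : fieldType) (N : absval R C) := Berk {
  berk_fun :> {poly C} -> R;
  berk_ge0 : forall f, 0 <= berk_fun f;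
  berkD : forall f g, berk_fun (f + g) <= berk_fun f + berk_fun g;
  berkM : {morph berk_fun : f g / f * g};
  berkC : forall c, berk_fun c%:P = N c
}.

Section Berkovich.
Variables (R : realType) (C : fieldType) (N : absval R C).

HB.instance Definition _ := gen_eqMixin (berk N).
HB.instance Definition _ := gen_choiceMixin (berk N).

Definition berk_eval (zeta : berk N) : {ptws {poly C} -> R} := berk_fun zeta.

(* The Berkovich topology: the coarsest one for which zeta |-> zeta f is
   continuous for all f. *)
HB.instance Definition _ :=
  Topological.copy (berk N) (initial_topology berk_eval).

Section Pullback.
Variables (u : {poly C}) (zeta : berk N).

Definition pullback_fun (f : {poly C}) : R := zeta (f \Po u).

Fact pullback_ge0 f : 0 <= pullback_fun f.
Proof. exact: berk_ge0. Qed.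
Fact pullbackD f g : pullback_fun (f + g) <= pullback_fun f + pullback_fun g.
Proof. by rewrite /pullback_fun comp_polyD; exact: berkD. Qed.
Fact pullbackM : {morph pullback_fun : f g / f * g}.
Proof. by move=> f g; rewrite /pullback_fun comp_polyM berkM. Qed.
Fact pullbackC c : pullback_fun c%:P = N c.
Proof. by rewrite /pullback_fun comp_polyC berkC. Qed.

Definition pullback : berk N :=
  Berk pullback_ge0 pullbackD pullbackM pullbackC.

End Pullback.

Section TypeI.
Variable x : C.

Definition typeI_fun (f : {poly C}) : R := N f.[x].

Fact typeI_ge0 f : 0 <= typeI_fun f.
Proof. exact: absval_ge0. Qed.
Fact typeID f g : typeI_fun (f + g) <= typeI_fun f + typeI_fun g.
Proof.
rewrite /typeI_fun hornerD; apply: le_trans (absvalD _ _ _) _.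
by rewrite ge_max lerDl lerDr !absval_ge0.
Qed.
Fact typeIM : {morph typeI_fun : f g / f * g}.
Proof. by move=> f g; rewrite /typeI_fun hornerM absvalM. Qed.
Fact typeIC c : typeI_fun c%:P = N c.
Proof. by rewrite /typeI_fun hornerC. Qed.

Definition typeI : berk N := Berk typeI_ge0 typeID typeIM typeIC.

End TypeI.

Lemma berk_eq (z w : berk N) : berk_fun z = berk_fun w -> z = w.
Proof.
case: z w => f f0 fD fM fC [g g0 gD gM gC] /= fg; rewrite {}fg in f0 fD fM fC *.
by congr Berk; exact: Prop_irrelevance.
Qed.

Lemma pullback_typeI u x : pullback u (typeI x) = typeI u.[x].
Proof.
by apply: berk_eq; apply/funext => f; rewrite /= /pullback_fun /= /typeI_fun
  horner_comp.
Qed.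

Lemma berk_eval_continuous f : continuous (fun zeta : berk N => zeta f).
Proof.
move=> zeta.
apply: (@continuous_comp _ _ _ berk_eval (@proj _ (fun=> R) f)).
  exact: initial_continuous.
exact: proj_continuous.
Qed.

Lemma pullback_continuous u : continuous (pullback u).
Proof.
apply: (@continuous_comp_initial _ _ _ berk_eval) => zeta.
have FF : Filter ((berk_eval \o pullback u) @ zeta).
  exact: (@fmap_filter (berk N) _ _ _ (@nbhs_filter (berk N) zeta)).
apply/cvg_sup => f.
have : continuous (berk_eval \o pullback u
    : berk N -> initial_topology (fun g : {poly C} -> R => g f)).
  by apply: continuous_comp_initial; exact: berk_eval_continuous.
exact.
Qed.

Lemma pullback_component (S : set (berk N)) u x y :
    (forall zeta, S zeta -> S (pullback u zeta)) ->
  connected_component S x y ->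
  connected_component S (pullback u x) (pullback u y).
Proof.
move=> uS [B [Bx BS cB] By].
exists (pullback u @` B); last by exists y.
split; first by exists x.
- by move=> _ [z Bz <-]; apply: uS; exact: BS.
- apply: connected_continuous_connected => //.
  by apply: continuous_subspaceT; exact: pullback_continuous.
Qed.

End Berkovich.

Section FilledJuliaSet.
Variables (R : realType) (k : finFieldType) (C : fieldType) (N : absval R C).
Variables (gam : {poly k} -> C) (psi : drinfeld gam).

Definition berk_act (a : {poly k}) (zeta : berk N) : berk N :=
  pullback (psi a) zeta.

Definition FJ_berk : set (berk N) :=
  [set zeta | exists B : R, forall a, berk_act a zeta 'X <= B].

Definition FJ0_berk : set (berk N) := connected_component FJ_berk (typeI N 0).

Lemma drinfeld_horner0 a : (psi a).[0] = 0.
Proof.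
apply: (addrI (psi a).[0]); rewrite -additive_polyD ?addr0 //.
exact: drinfeld_additive.
Qed.

Lemma FJ_berk_act a zeta : FJ_berk zeta -> FJ_berk (berk_act a zeta).
Proof.
move=> [B hB]; exists B => b; rewrite /= /pullback_fun /= /pullback_fun.
by have := hB (b * a); rewrite /= /pullback_fun drinfeldM !comp_polyX.
Qed.

Lemma FJ_typeI0 : FJ_berk (typeI N 0).
Proof.
exists 0 => a; rewrite /= /pullback_fun comp_polyX /= /typeI_fun.
by rewrite drinfeld_horner0 (absval_eq0 N 0).2.
Qed.

Lemma FJ_berk_shift x zeta : FJ_berk (typeI N x) -> FJ_berk zeta ->
  FJ_berk (pullback ('X + x%:P) zeta).
Proof.
move=> [B hB] [B' hB']; exists (B' + B) => a.
rewrite /= /pullback_fun comp_polyX /= /pullback_fun.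
rewrite additive_poly_shift; last exact: drinfeld_additive.
apply: le_trans (berkD _ _ _) _; apply: lerD.
  by have := hB' a; rewrite /= /pullback_fun comp_polyX.
by rewrite berkC; have := hB a; rewrite /= /pullback_fun comp_polyX.
Qed.

Lemma FJ_closed a u v : FJ_berk (typeI N u) -> FJ_berk (typeI N v) ->
  FJ_berk (typeI N ((psi a).[u] + v)).
Proof.
move=> hu hv; have := FJ_berk_shift hv (FJ_berk_act a hu).
by rewrite /berk_act !pullback_typeI !hornerE.
Qed.

Lemma FJ0_closed a u v : FJ0_berk (typeI N u) -> FJ0_berk (typeI N v) ->
  FJ0_berk (typeI N ((psi a).[u] + v)).
Proof.
move=> hu hv; have FJv := connected_component_sub hv.
apply: (connected_component_trans hv).
have h1 := pullback_component (@FJ_berk_act a) hu.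
have := pullback_component (fun z => @FJ_berk_shift v z FJv) h1.
by rewrite /berk_act !pullback_typeI !hornerE drinfeld_horner0 add0r.
Qed.

End FilledJuliaSet.

Section FilledJuliaSubmodules.
Variables (R : realType) (k : finFieldType) (F C : fieldType).
Variables (N : absval R C) (j : {rmorphism F -> C}).
Variables (gam : {poly k} -> F) (phi : drinfeld gam).
Local Notation psi := (base_change j phi).

Definition FJ : {pred dmod phi} :=
  [pred x | `[< FJ_berk psi (typeI N (j x)) >]].

Definition FJ0 : {pred dmod phi} :=
  [pred x | `[< FJ0_berk psi (typeI N (j x)) >]].

Lemma base_change_horner a x : (psi a).[j x] = j (phi a).[x].
Proof. by rewrite /= /base_change_fun horner_map. Qed.

Fact FJ_submod : submod_closed FJ.
Proof.
split=> [|a u v]; rewrite !inE.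
  by rewrite rmorph0; exact: FJ_typeI0.
move=> hu hv.
by have := FJ_closed a hu hv; rewrite base_change_horner -rmorphD.
Qed.

Fact FJ0_submod : submod_closed FJ0.
Proof.
split=> [|a u v]; rewrite !inE.
  rewrite rmorph0; apply: connected_component_refl.
  exact: FJ_typeI0.
move=> hu hv.
by have := FJ0_closed a hu hv; rewrite base_change_horner -rmorphD.
Qed.

HB.instance Definition _ := GRing.isSubmodClosed.Build {poly k} (dmod phi) FJ
  (GRing.submod_closed_semi FJ_submod).
HB.instance Definition _ := GRing.isSubmodClosed.Build {poly k} (dmod phi) FJ0
  (GRing.submod_closed_semi FJ0_submod).

(* phi^FJ(F) / phi^0(F), for F embedded in C by j *)
Definition FJquot : lmodType {poly k} := subquot FJ FJ0.

End FilledJuliaSubmodules.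

(* Main.v *)
(* The quotient M = phi^FJ(C_v) / phi^0(C_v) is determined by counting, without
   the Tate uniformization. Stable reduction says that, at a suitable radius
   rho, the Newton polygon of each phi_a has its last dominant term in degree
   q^((r - s) deg a). Hence phi^0 is the disc D(0, rho): a point x with
   |x| > rho is separated from 0 by some annulus ||X|| = t with t < |x| which
   misses the filled Julia set. Every class in M is represented in the
   algebraic closure of L_v, and there M is divisible, because each phi_a is
   surjective and maps D(0, rho) onto itself; phi_a has q^(r deg a) simple
   roots, q^((r - s) deg a) of them in D(0, rho), so M[a] has q^(s deg a)
   elements; and M is torsion, because orbits stay in bounded subsets of
   finite-dimensional K_v-spaces, which are totally bounded. A divisible torsion
   module with these counts is (K / A)^s.
   The module V = phi^FJ(L_v) / phi^0(L_v) embeds in M. Put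
   m = 2 |numerator of -v(j_phi)| + 1. The values of L_v outside D(0, rho) are
   so far from rho that any z in M is T^m w with w smaller than all of them. So,
   for u in V killed by b, the elements a u + w with T^m w in M[b] and
   deg a <= s m, all in M[b T^m], cannot be distinct, and some nonzero a with
   deg a <= s m kills u. The structure theorem for submodules of (K / A)^s then
   gives the first isomorphism. *)

From HB Require Import structures.
Require Import Defs.
From mathcomp Require Import all_boot all_order all_algebra all_field.
From mathcomp Require Import generic_quotient.
From mathcomp Require Import mathcomp_extra boolp classical_sets functions reals.
From mathcomp Require Import topology normedtype.
From mathcomp Require Import zify lra ring.

Set Implicit Arguments.
Unset Strict Implicit.
Unset Printing Implicit Defensive.

Import Order.TTheory GRing.Theory Num.Theory.
Import numFieldNormedType.Exports.
Local Open Scope ring_scope.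

(** * Modules over polynomial rings *)

(** Stable reduction enters through one real number. If phi(alpha X) = alpha psi(X) with psi stable,
    put rho = |alpha|: at radius rho the monomials of phi_a have size at most rho, with equality for
    the last time in degree q^(d deg a), d = r - s. The extension containing alpha can then be
    forgotten. The degree bound must be uniform in q, r and phi, although the filled Julia set may
    reach far beyond rho. Write tau = |x| / rho, and let u be the absolute value of the leading
    coefficient of phi_T rescaled by rho. Bounded orbits satisfy u^2 tau^(q^r) <= 1. With c > 1
    generating the value group of L_v and J = -v(j_phi), one has u = c^(-J (q^r - 1)), because the
    maximum defining J is attained at j = d. A suitable preimage under T^m lowers tau to at most its
    q^(d m)-th root, while elements of L_v outside the disc have tau^(q^d - 1) >= c. So the preimage
    is smaller than all of them as soon as q^(d m) > 2 J (q^d - 1). The choice of m ensures this for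
    every q and d, since J is at most the absolute value of its numerator. *)

Lemma irreducible_divisor (k : fieldType) (b : {poly k}) :
  (1 < size b)%N -> exists pi, irreducible_poly pi /\ pi %| b.
Proof.
elim/ltn_ind: (size b) {-2}b (erefl (size b)) => n IH {}b bn b1.
have [irr|nirr] := pselect (irreducible_poly b); first by exists b.
have [c [c1 [cb cNb]]] : exists c : {poly k}, size c != 1%N /\ c %| b /\ ~ c %= b.
  apply: contrapT => H; apply: nirr; split; first by [].
  move=> c c1 cb; apply: contrapT => cNb; apply: H; exists c.
  by split => //; split.
have b0 : b != 0 by rewrite -size_poly_gt0 (ltn_trans _ b1).
have c0 : c != 0 by apply: contraNneq b0 => c0; rewrite c0 dvd0p in cb.
have cgt1 : (1 < size c)%N by rewrite ltn_neqAle eq_sym c1 size_poly_gt0.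
have clt : (size c < n)%N.
  rewrite -bn ltn_neqAle (dvdp_leq b0 cb) andbT.
  by rewrite (dvdp_size_eqp cb); apply/negP.
have [pi [irr picb]] := IH _ clt c (erefl _) cgt1.
by exists pi; split=> //; exact: dvdp_trans cb.
Qed.

Lemma irreducible_Bezout (k : fieldType) (pi x : {poly k}) :
  irreducible_poly pi -> ~~ (pi %| x) -> exists u w, u * x + w * pi = 1.
Proof.
move=> irr px; have /Bezout_eq1_coprimepP [[u w] /= e] : coprimep x pi.
  by rewrite coprimep_sym irreducible_poly_coprime.
by exists u, w.
Qed.

Section LinearCombinations.
Variables (k : finFieldType) (s : nat).
Local Notation A := {poly k}.
Variable V : lmodType A.
Implicit Types (e f g : 'I_s -> V) (x y : 'I_s -> A).

Definition lcomb e x : V := \sum_i x i *: e i.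

Lemma lcombD e x y : lcomb e x + lcomb e y = lcomb e (fun i => x i + y i).
Proof. by rewrite -big_split; apply: eq_bigr => i _; rewrite scalerDl. Qed.

Lemma lcombZ c e x : c *: lcomb e x = lcomb e (fun i => c * x i).
Proof. by rewrite scaler_sumr; apply: eq_bigr => i _; rewrite scalerA. Qed.

Lemma lcombB e x y : lcomb e x - lcomb e y = lcomb e (fun i => x i - y i).
Proof. by rewrite -sumrB; apply: eq_bigr => i _; rewrite scalerBl. Qed.

Lemma lcomb_scale c e x :
  lcomb (fun i => c *: e i) x = lcomb e (fun i => x i * c).
Proof. by apply: eq_bigr => i _; rewrite scalerA. Qed.

Lemma lcomb_comp e (a : 'I_s -> A) x :
  lcomb (fun i => a i *: e i) x = lcomb e (fun i => x i * a i).
Proof. by apply: eq_bigr => i _; rewrite scalerA. Qed.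

Lemma eq_lcomb e f x y : e =1 f -> x =1 y -> lcomb e x = lcomb f y.
Proof. by move=> ef xy; apply: eq_bigr => i _; rewrite ef xy. Qed.

Lemma lcomb0 e x : (forall i, x i *: e i = 0) -> lcomb e x = 0.
Proof. by move=> h; apply: big1. Qed.

Definition unitv (i : 'I_s) : 'I_s -> A := fun j => (j == i)%:R.

Lemma lcomb_unitv e i : lcomb e (unitv i) = e i.
Proof.
rewrite /lcomb (bigD1 i) //= /unitv eqxx scale1r big1 ?addr0 //.
by move=> j /negPf ->; rewrite scale0r.
Qed.

(** Submodules are plain predicates here, so that pi N and torsion submodules can be formed inside
    an induction. *)
Definition submod_prop (N : V -> Prop) :=
  N 0 /\ forall a u v, N u -> N v -> N (a *: u + v).

Lemma submod_prop_lcomb N e x :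
  submod_prop N -> (forall i, N (e i)) -> N (lcomb e x).
Proof.
move=> [N0 NZD] Ne; rewrite /lcomb.
apply: (@big_ind _ N) => //; last by move=> i _; rewrite -[_ *: _]addr0; apply: NZD.
by move=> u v Nu Nv; rewrite -[u]scale1r; exact: NZD.
Qed.

(** Families keep the fixed length s: J marks the slots in use, and the others will hold 0, whose
    coefficients are unconstrained. *)
Definition free_on (J : {set 'I_s}) (pi : A) f :=
  forall x, lcomb f x = 0 -> forall i, i \in J -> pi %| x i.

(* The pi-torsion of V has dimension at most s over A / pi. *)
Definition torsion_rank_le (pi : A) :=
  forall f, (forall i, pi *: f i = 0) -> free_on [set: 'I_s]%SET pi f ->
    forall z, pi *: z = 0 -> exists x, z = lcomb f x.

Lemma extend_free (pi : A) (N : V -> Prop) (J : {set 'I_s}) f :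
    irreducible_poly pi -> torsion_rank_le pi ->
    (forall i, N (f i) /\ pi *: f i = 0) -> (forall i, i \notin J -> f i = 0) ->
    free_on J pi f ->
  exists (J' : {set 'I_s}) f', [/\ J \subset J', {in J, f' =1 f},
    forall i, N (f' i) /\ pi *: f' i = 0,
    (forall i, i \notin J' -> f' i = 0) /\ free_on J' pi f'
    & forall z, N z -> pi *: z = 0 -> exists x, z = lcomb f' x].
Proof.
move=> irr rk; elim: {J}_.+1 {-2}J (ltnSn #|~: J|) f => // n IH J Jn f Nf f0 fJ.
have [spans|] := pselect (forall z, N z -> pi *: z = 0 -> exists x, z = lcomb f x).
  by exists J, f.
move=> /existsNP [y /not_implyP [Ny /not_implyP [piy ynot]]].
have [i0 i0J] : exists i0, i0 \notin J.
  apply: contrapT => /forallNP JT; apply: ynot.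
  apply: rk => // [i|x fx i _]; first by have [] := Nf i.
  by apply: fJ => //; apply: contrapT => /negP /JT.
pose f' i := if i == i0 then y else f i.
have f'E x : lcomb f' x = x i0 *: y + lcomb f x.
  rewrite /lcomb (bigD1 i0) //= [in RHS](bigD1 i0) //= (f0 i0) // scaler0 add0r.
  rewrite /f' eqxx; congr +%R; apply: eq_bigr => i /negPf ii0.
  by rewrite ii0.
have := IH (i0 |: J) _ f'; case.
- have -> : ~: (i0 |: J) = (~: J) :\ i0 by apply/setP => i; rewrite !inE negb_or.
  by move: Jn; rewrite (cardsD1 i0) inE i0J.
- by move=> i; rewrite /f'; case: ifP.
- by move=> i; rewrite !inE negb_or /f' => /andP [/negPf -> /f0].
(* If pi did not divide the coefficient of y, that coefficient would be invertible modulo pi, and y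
   would lie in the span of f. *)
- move=> x; rewrite f'E => e.
  have px : pi %| x i0.
    apply: contrapT => /negP /(irreducible_Bezout irr) [u [w uw]]; apply: ynot.
    exists (fun i => - u * x i); rewrite -lcombZ.
    have -> : lcomb f x = - (x i0 *: y).
      by apply/eqP; rewrite -addr_eq0 addrC; apply/eqP.
    rewrite scalerN scaleNr opprK scalerA.
    by rewrite -[LHS]scale1r -uw scalerDl -[(w * pi) *: y]scalerA piy scaler0 addr0.
  move=> i; rewrite !inE => /orP [/eqP -> //|]; apply: fJ.
  move: e; case/dvdpP: px => c ->.
  by rewrite -scalerA piy scaler0 add0r.
- move=> J' [f'' [JJ' f'f'' Nf'' f''0 spans]].
  exists J', f''; split => //;
    first exact: fintype.subset_trans (finset.subsetUr _ _) JJ'.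
  move=> i iJ; rewrite f'f'' ?inE ?iJ ?orbT // /f'.
  by case: eqP iJ i0J => // -> ->.
Qed.

(* Structure of a module N, from that of pi N: lifting a generator e_i of pi N
   of order a_i to g_i in N, the element a_i g_i is pi-torsion, and can be
   corrected to be 0 or part of a basis of N[pi], unless pi divides a_i, in
   which case it already is. *)
Lemma lift_generators (pi : A) (N : V -> Prop) e (a : 'I_s -> A) :
    irreducible_poly pi -> torsion_rank_le pi -> submod_prop N ->
    (forall i, exists g : V, N g /\ pi *: g = e i) ->
    (forall z, N z -> exists x, pi *: z = lcomb e x) ->
    (forall i, a i != 0 /\ a i *: e i = 0) ->
    (forall x, lcomb e x = 0 -> forall i, a i %| x i) ->
  exists g (a' : 'I_s -> A), [/\ forall i, N (g i) /\ pi *: g i = e i,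
    forall z, N z -> exists x, z = lcomb g x,
    forall i, a' i != 0 /\ a' i *: g i = 0 &
    forall x, lcomb g x = 0 -> forall i, a' i %| x i].
Proof.
move=> irr rk sN /choice [g0 g0P] egen ae arel.
have pi0 : pi != 0 by exact: irredp_neq0.
have g0N i : N (g0 i) by case: (g0P i).
have g0e i : pi *: g0 i = e i by case: (g0P i).
have NZ c z : N z -> N (c *: z) by move=> Nz; rewrite -[_ *: _]addr0;
  apply: sN.2 => //; exact: sN.1.
have ND u v : N u -> N v -> N (u + v) by move=> Nu Nv; rewrite -[u]scale1r;
  exact: sN.2.
pose J := [set i | pi %| a i].
pose f0 i := if i \in J then a i *: g0 i else 0.
have [||| J' [f [JJ' f0f Nf [fJ' ffree] fspan]]] :=
    @extend_free pi N J f0 irr rk.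
- move=> i; rewrite /f0; case: ifP => _; last by rewrite scaler0; split=> //;
    exact: sN.1.
  split; first exact: NZ.
  by rewrite scalerA mulrC -scalerA g0e (ae i).2.
- by move=> i /negPf h; rewrite /f0 h.
- move=> x fx i; rewrite inE => pia.
  (* For j in J, a_j g0_j = (a_j / pi) e_j, so a relation between the f0_j is a relation between the
     e_j. *)
  pose b j := if j \in J then a j %/ pi else 0.
  have /arel/(_ i) : lcomb e (fun j => x j * b j) = 0.
    rewrite -fx; apply: eq_bigr => j _; rewrite /f0 /b.
    case: ifP; last by rewrite mulr0 scale0r scaler0.
    by rewrite inE => pij; rewrite -{1}g0e scalerA scalerA -mulrA divpK.
  rewrite /b inE pia -{1}(divpK pia) mulrC.
  rewrite dvdp_mul2r //; apply: contraNneq (ae i).1 => d0.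
  by rewrite -(divpK pia) d0 mul0r.
have bez i : exists uw : A * A, i \notin J -> uw.1 * a i + uw.2 * pi = 1.
  case: (boolP (i \in J)) => [iJ|]; first by exists (0, 0).
  by rewrite inE => /(irreducible_Bezout irr) [u [w e']]; exists (u, w).
case/choice: bez => uw uwE.
(* For i outside J, a_i is invertible modulo pi, so a pi-torsion correction of g0_i achieves a_i g_i
   = f_i without changing pi g_i. *)
pose h i := if i \in J then 0 else (uw i).1 *: (f i - a i *: g0 i).
have pih i : pi *: h i = 0.
  rewrite /h; case: ifP => _; first exact: scaler0.
  rewrite scalerA mulrC -scalerA scalerBr (Nf i).2 scalerA [_ * a i]mulrC.
  by rewrite -scalerA g0e (ae i).2 subr0 scaler0.
pose g i := g0 i + h i.
have Ng i : N (g i).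
  apply: (ND) => //; rewrite /h; case: ifP => _; first exact: sN.1.
  apply: (NZ); apply: ND; first by case: (Nf i).
  by rewrite -scaleNr; apply: NZ.
have ag i : a i *: g i = f i.
  rewrite /g /h; case: ifP => iJ.
    by rewrite addr0 f0f // /f0 iJ.
  rewrite scalerDr scalerA mulrC.
  have := uwE i; rewrite iJ => /(_ isT) /eqP.
  rewrite eq_sym -subr_eq => /eqP <-; rewrite scalerBl scale1r.
  rewrite -scalerA scalerBr (Nf i).2 sub0r scalerA [pi * _]mulrC -scalerA g0e.
  by rewrite (ae i).2 oppr0 scaler0 subr0 addrC subrK.
have pig i : pi *: g i = e i by rewrite /g scalerDr g0e pih addr0.
(* The order gains a factor pi exactly when a_i g_i = f_i is a basis vector of the pi-torsion;
   otherwise f_i = 0 and the order stays a_i. *)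
pose a' i := if i \in J' then a i * pi else a i.
exists g, a'; split=> //.
- move=> z Nz; have [x ex] := egen z Nz.
  have [||y ey] := fspan (z - lcomb g x).
  + rewrite addrC -scaleN1r; apply: sN.2 => //; exact: submod_prop_lcomb.
  + rewrite scalerBr ex lcombZ -[X in _ - X]/(lcomb g _).
    rewrite -(@eq_lcomb (fun i => pi *: g i) e x x) // lcomb_scale lcombB.
    by apply: lcomb0 => i; rewrite mulrC subrr scale0r.
  exists (fun i => x i + y i * a i); rewrite -lcombD -lcomb_comp.
  by rewrite (@eq_lcomb (fun i => a i *: g i) f y y) // -ey addrC subrK.
- move=> i; rewrite /a'; case: ifP => iJ'.
    by rewrite mulf_neq0 ?(ae i).1 //; split=> //;
      rewrite mulrC -scalerA ag (Nf i).2.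
  by rewrite ag fJ' ?iJ' //; case: (ae i).
- move=> x gx.
  have ax i : a i %| x i.
    apply: arel; rewrite -(@eq_lcomb (fun i => pi *: g i) e x x) //.
    have := congr1 (fun z => pi *: z) gx; rewrite scaler0 => <-.
    rewrite lcomb_scale lcombZ; apply: eq_lcomb => // j; exact: mulrC.
  move=> i; rewrite /a'; case: ifP => iJ' //.
  rewrite -(divpK (ax i)) mulrC dvdp_mul2r ?(ae i).1 //.
  apply: (ffree (fun i => x i %/ a i)) => //.
  rewrite -gx -(@eq_lcomb (fun i => a i *: g i) f _ _ _ (frefl _)) // lcomb_comp.
  by apply: eq_lcomb => // j; rewrite divpK.
Qed.

(** Induction on the degree of b: for an irreducible factor pi of b, the module pi N is killed by b
    / pi, and [lift_generators] goes back from pi N to N. Some of the a_i may be constant, which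
    accounts for trivial summands. *)
Lemma torsion_structure (b : A) (N : V -> Prop) :
    (forall pi, irreducible_poly pi -> torsion_rank_le pi) ->
    b != 0 -> submod_prop N -> (forall z, N z -> b *: z = 0) ->
  exists g (a : 'I_s -> A), [/\ forall i, N (g i),
    forall z, N z -> exists x, z = lcomb g x,
    forall i, a i != 0 /\ a i *: g i = 0 &
    forall x, lcomb g x = 0 -> forall i, a i %| x i].
Proof.
move=> rk; elim/ltn_ind: (size b) {-2}b (erefl (size b)) N =>
  n IH {}b bn N b0 sN bN.
have [b1|] := leqP (size b) 1.
  have N0 z : N z -> z = 0.
    move=> Nz; have /size_poly1P [c c0 bc] : size b == 1%N.
      by rewrite eqn_leq b1 size_poly_gt0.
    have -> : z = (c^-1%:P * b) *: z by rewrite bc -polyCM mulVf // scale1r.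
    by rewrite -scalerA bN // scaler0.
  exists (fun=> 0), (fun=> 1); split.
  - by move=> i; exact: sN.1.
  - by move=> z /N0 ->; exists (fun=> 0); rewrite lcomb0 // => i; rewrite scaler0.
  - by move=> i; rewrite oner_neq0 scaler0.
  - by move=> x _ i; exact: dvd1p.
move=> /irreducible_divisor [pi [irr pib]].
pose N' z := exists2 w, N w & z = pi *: w.
have pi0 := irredp_neq0 irr.
have bE := divpK pib.
have b'0 : b %/ pi != 0 by apply: contraNneq b0 => h; rewrite -bE h mul0r.
have blt : (size (b %/ pi)%R < n)%N.
  rewrite -bn size_divp // ltn_subrL size_poly_gt0 b0 andbT -subn1 subn_gt0.
  by case: irr.
have [||e [a [Ne egen ae arel]]] := IH _ blt _ (erefl _) N' b'0.
- split; first by exists 0; [exact: sN.1|rewrite scaler0].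
  move=> c _ _ [u Nu ->] [w Nw ->]; exists (c *: u + w); first exact: sN.2.
  by rewrite scalerDr !scalerA mulrC.
- by move=> _ [w Nw ->]; rewrite scalerA bE bN.
have [||g [a' [Ng ggen ag grel]]] := lift_generators irr (rk _ irr) sN _ _ ae arel.
- by move=> i; have [w Nw ->] := Ne i; exists w; split.
- by move=> z Nz; apply: egen; exists z.
by exists g, a'; split=> // i; case: (Ng i).
Qed.

End LinearCombinations.

(** A linear relation that is total on both sides is the graph of an isomorphism once 0 is related
    only to 0. This suits maps described through non-unique coordinates, where well-definedness and
    injectivity become the two conditions at 0. *)
Lemma lmod_iso_rel (A : nzRingType) (U V : lmodType A) (Q : U -> V -> Prop) :
    (forall a u u' v v', Q u v -> Q u' v' -> Q (a *: u + u') (a *: v + v')) ->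
    (forall u, exists v, Q u v) -> (forall v, exists u, Q u v) ->
    (forall v, Q 0 v -> v = 0) -> (forall u, Q u 0 -> u = 0) ->
  lmod_iso U V.
Proof.
move=> Qlin /choice [f Qf] /choice [g Qg] Q0l Q0r.
have QB u u' v v' : Q u v -> Q u' v' -> Q (u - u') (v - v').
  by move=> h h'; rewrite ![_ - _]addrC -!scaleN1r; exact: Qlin.
have funl u v v' : Q u v -> Q u v' -> v = v'.
  by move=> /QB h /h; rewrite subrr => /Q0l /eqP; rewrite subr_eq0 => /eqP.
have funr u u' v : Q u v -> Q u' v -> u = u'.
  by move=> /QB h /h; rewrite subrr => /Q0r /eqP; rewrite subr_eq0 => /eqP.
have flin : linear f by move=> a u u'; apply: funl (Qf _) _; exact: Qlin.
pose F : {linear U -> V} := HB.pack f (GRing.isLinear.Build A U V *:%R f flin).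
exists F; exists g => [u|v].
- exact: funr (Qg (f u)) (Qf u).
- exact: funl (Qf (g v)) (Qg v).
Qed.

Lemma quotmod_pi_eq0 (A : nzRingType) (V : lmodType A) (N : submodClosed V) x :
  quotmod_pi N x = 0 <-> x \in N.
Proof.
have -> : 0 = quotmod_pi N 0.
  by apply: (addrI (quotmod_pi N 0)); rewrite -quotmod_piD !addr0.
by rewrite quotmod_piE subr0.
Qed.

(** * Torsion submodules and their cardinality *)

Section TorsionModules.
Variables (k : finFieldType) (s : nat).
Local Notation A := {poly k}.
Variable V : lmodType A.

Lemma iso_dsum_polymod (g : 'I_s -> V) (a : 'I_s -> A) :
    (forall z, exists x, z = lcomb g x) -> (forall i, a i *: g i = 0) ->
    (forall x, lcomb g x = 0 -> forall i, a i %| x i) ->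
  lmod_iso V (dsum (fun i => polymod (a i))).
Proof.
move=> gen ag rel.
pose pi i (x : A) : polymod (a i) := quotmod_pi (principal (a i)) x.
have piP i x : a i %| x <-> pi i x = 0.
  by rewrite /pi quotmod_pi_eq0.
have piZ i c (x : A) : c *: pi i x = pi i (c * x) by exact: quotmod_piZ.
have piD i (x y : A) : pi i x + pi i y = pi i (x + y).
  by rewrite /pi quotmod_piD.
apply: (@lmod_iso_rel A V (dsum (fun i => polymod (a i)))
  (fun z w => exists x, z = lcomb g x /\ forall i, w i = pi i (x i))).
- move=> c u u' v v' [x [-> vx]] [x' [-> vx']].
  exists (fun i => c * x i + x' i); split; first by rewrite lcombZ lcombD.
  by move=> i; rewrite -piD -piZ -vx -vx'.
- by move=> u; have [x ux] := gen u; exists (fun i => pi i (x i)), x.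
- move=> v; have /choice [x vx] : forall i, exists x : A, pi i x = v i.
    by move=> i; have [x <-] := @quotmod_pi_surj A A^o (principal (a i)) (v i);
      exists x.
  by exists (lcomb g x), x; split=> // i; rewrite vx.
- move=> v [x [/esym /rel ax vx]]; apply: functional_extensionality_dep => i.
  by rewrite vx; apply/piP.
- move=> u [x [-> vx]]; apply: lcomb0 => i.
  have /piP /dvdpP [c ->] : pi i (x i) = 0 by rewrite -vx.
  by rewrite -scalerA ag scaler0.
Qed.

Definition torsion_card (a : A) :=
  exists l : seq V, [/\ uniq l, forall z, (z \in l) = (a *: z == 0) &
    size l = (#|k| ^ (s * (size a).-1))%N].

Definition combs (f : 'I_s -> V) n : seq V :=
  [seq lcomb f (fun i => rVpoly (row i y)) | y : 'M[k]_(s, n)].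

Lemma size_combs f n : size (combs f n) = (#|k| ^ (s * n))%N.
Proof. by rewrite size_map -cardE card_mx. Qed.

Implicit Types (f : 'I_s -> V) (x : 'I_s -> A).

Lemma lcomb_modp f a x : (forall i, a *: f i = 0) ->
  lcomb f x = lcomb f (fun i => x i %% a).
Proof.
move=> af; apply: eq_bigr => i _.
by rewrite {1}(divp_eq (x i) a) scalerDl -scalerA af scaler0 add0r.
Qed.

Lemma mem_combs f a x : a != 0 -> (forall i, a *: f i = 0) ->
  lcomb f x \in combs f (size a).-1.
Proof.
move=> a0 af; rewrite (lcomb_modp x af).
apply/fintype.imageP; exists (\matrix_(i, j) (x i %% a)`_j) => //.
apply: eq_lcomb => // i.
have -> : row i (\matrix_(i, j) (x i %% a)`_j) =
  poly_rV (x i %% a) :> 'rV[k]_(size a).-1.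
  by apply/rowP => j; rewrite !mxE.
by rewrite poly_rV_K // -ltnS prednK ?size_poly_gt0 // ltn_modp.
Qed.

(** Freeness makes the combinations with coefficients of degree less than deg a pairwise distinct,
    and they are as many as the a-torsion elements among which they lie. *)
Lemma free_spans a f : a != 0 -> torsion_card a ->
    (forall i, a *: f i = 0) -> (forall x, lcomb f x = 0 -> forall i, a %| x i) ->
  forall z, a *: z = 0 -> exists x, z = lcomb f x.
Proof.
move=> a0 [l [ul la sl]] af free z /eqP; rewrite -la.
have sub : {subset combs f (size a).-1 <= l}.
  move=> _ /fintype.imageP [y _ ->]; rewrite la lcombZ; apply/eqP;
    apply: lcomb0 => i.
  by rewrite mulrC -scalerA af scaler0.
have uc : uniq (combs f (size a).-1).
  rewrite map_inj_uniq ?enum_uniq // => y y' /eqP.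
  rewrite -subr_eq0 lcombB => /eqP /free h; apply/row_matrixP => i.
  apply/eqP; rewrite -subr_eq0 -(inj_eq (can_inj (@rVpolyK _ _))) raddfB /= raddf0.
  apply/eqP; have := h i; apply: contraTeq => ne.
  apply/negP => /(dvdp_leq ne); rewrite leqNgt => /negP; apply.
  rewrite -[X in (_ < X)%N](@prednK (size a)) ?size_poly_gt0 // ltnS.
  rewrite -raddfB; exact: size_poly.
have [_ <-] := uniq_min_size uc sub (eq_leq (etrans sl (esym (size_combs _ _)))).
by move=> /fintype.imageP [y _ ->]; eexists.
Qed.

(** The converse count: a list that covers the a-torsion and has the same length has no repetition,
    so only zero remainders modulo a can give the sum 0. *)
Lemma spans_free a f : a != 0 -> torsion_card a -> (forall i, a *: f i = 0) ->
    (forall z, a *: z = 0 -> exists x, z = lcomb f x) ->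
  forall x, lcomb f x = 0 -> forall i, a %| x i.
Proof.
move=> a0 [l [ul la sl]] af spans x fx i.
have sub : {subset l <= combs f (size a).-1}.
  by move=> z; rewrite la => /eqP /spans [y ->]; exact: mem_combs.
have := leq_size_uniq ul sub (eq_leq (etrans (size_combs _ _) (esym sl))).
move=> uc; pose n := (size a).-1.
have inj : injective (fun y : 'M[k]_(s, n) => lcomb f (fun i => rVpoly (row i y))).
  by apply/injectiveP.
have /inj /matrixP E : lcomb f (fun i => rVpoly (row i (\matrix_(i < s,
  j < n) (x i %% a)`_j))) =
   lcomb f (fun i => rVpoly (row i (0 : 'M[k]_(s, n)))).
  rewrite [RHS]lcomb0 => [|j]; last by rewrite row0 raddf0 scale0r.
  rewrite -fx (lcomb_modp x af); apply: eq_lcomb => // j.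
  have -> : row j (\matrix_(i, j) (x i %% a)`_j) = poly_rV (x j %% a) :> 'rV[k]_n.
    by apply/rowP => j'; rewrite !mxE.
  by rewrite poly_rV_K // -ltnS prednK ?size_poly_gt0 // ltn_modp.
rewrite /dvdp; apply/eqP/polyP => j; rewrite coef0.
have [jn|jn] := ltnP j n; first by have := E i (Ordinal jn); rewrite !mxE.
apply: nth_default; apply: leq_trans jn.
by rewrite -ltnS prednK ?size_poly_gt0 // ltn_modp.
Qed.

End TorsionModules.

Lemma ratfunP (k : finFieldType) (f : {fraction {poly k}}) :
  exists u v : {poly k}, v != 0 /\ f = tofrac u / tofrac v.
Proof.
elim/quotW: f => x; exists (\n_x)%R, (\d_x)%R; split; first exact: denom_ratioP.
apply: (canRL (mulfK _)); first by rewrite tofrac_eq0 denom_ratioP.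
rewrite -[LHS]/(FracField.mul _ _) !piE /FracField.mulf.
apply/eqmodP; rewrite /= FracField.equivfE.
by rewrite !numden_Ratio ?(oner_eq0, mulf_neq0, denom_ratioP) // !mulr1 mulrC.
Qed.

(** * Divisible torsion modules as sums of copies of K / A *)

Section DivisibleTorsion.
Variables (k : finFieldType) (s : nat).
Local Notation A := {poly k}.
Variable V : lmodType A.
Hypothesis Vtors : forall z : V, exists2 a : A, a != 0 & a *: z = 0.
Hypothesis Vdiv : forall (a : A) (z : V), a != 0 -> exists w : V, a *: w = z.
Hypothesis Vcard : forall a : A, a != 0 -> torsion_card s V a.
Implicit Types (e g : 'I_s -> V) (b c : A).

Lemma torsion_rank_le_card pi : irreducible_poly pi -> torsion_rank_le s V pi.
Proof.
move=> irr f fpi free; have pi0 := irredp_neq0 irr.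
by apply: free_spans => //; [exact: Vcard|move=> x fx i; apply: free => //;
  rewrite inE].
Qed.

Definition torsion_basis b e :=
  [/\ forall i, b *: e i = 0, forall z, b *: z = 0 -> exists x, z = lcomb e x &
    forall x, lcomb e x = 0 -> forall i, b %| x i].

(** Let N be the (b pi)-torsion. By divisibility pi N is the b-torsion, where all generators have
    order b. Lifting gives generators of N, and the count, rather than the orders of the lifts,
    makes them free modulo b pi. *)
Lemma torsion_basis_lift_irr b pi e : b != 0 -> irreducible_poly pi ->
  torsion_basis b e ->
  exists g, torsion_basis (b * pi) g /\ forall i, pi *: g i = e i.
Proof.
move=> b0 irr [be egen erel]; have pi0 := irredp_neq0 irr.
have bpi0 : b * pi != 0 by rewrite mulf_neq0.
pose N z := (b * pi) *: z = 0 :> V.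
have sN : submod_prop N.
  rewrite /N; split=> [|a u v hu hv]; first exact: scaler0.
  by rewrite scalerDr hv scalerA mulrC -scalerA hu scaler0 addr0.
have [||i|g [a [Ng ggen _ _]]]
  := lift_generators irr (torsion_rank_le_card irr) sN _ _ _ erel.
- move=> i; have [w piw] := Vdiv (e i) pi0; exists w; split=> //.
  by rewrite /N -scalerA piw be.
- by move=> z Nz; apply: egen; rewrite scalerA.
- by [].
have bg i : (b * pi) *: g i = 0 by case: (Ng i).
exists g; split=> [|i]; last by case: (Ng i).
split=> //; apply: (spans_free bpi0) => //; exact: Vcard.
Qed.

Lemma torsion_basis_lift c b e : b != 0 -> c != 0 -> torsion_basis b e ->
  exists g, torsion_basis (b * c) g /\ forall i, c *: g i = e i.
Proof.
elim/ltn_ind: (size c) {-2}c (erefl (size c)) b e => n IH {}c cn b e b0 c0 eb.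
have [c1|] := leqP (size c) 1.
  have /size_poly1P [c' c'0 cE] : size c == 1%N.
    by rewrite eqn_leq c1 size_poly_gt0.
  have cV : c * c'^-1%:P = 1 by rewrite cE -polyCM mulfV.
  case: eb => [be egen erel].
  exists (fun i => c'^-1%:P *: e i); split=> [|i];
    last by rewrite scalerA cV scale1r.
  split.
  - by move=> i; rewrite scalerA -mulrA cV mulr1.
  - move=> z; rewrite mulrC -scalerA => h.
    have /egen [x ->] : b *: z = 0.
      by rewrite -[_ *: z]scale1r -cV mulrC -scalerA h scaler0.
    exists (fun i => x i * c); rewrite lcomb_scale; apply: eq_lcomb => // i.
    by rewrite -mulrA cV mulr1.
  - move=> x; rewrite lcomb_scale => /erel h i.
    have -> : x i = x i * c'^-1%:P * c by rewrite -mulrA [_ * c]mulrC cV mulr1.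
    by rewrite dvdp_mul2r.
move=> /irreducible_divisor [pi [irr /dvdpP [c' cE]]].
have pi0 := irredp_neq0 irr.
have c'0 : c' != 0 by apply: contraNneq c0 => h; rewrite cE h mul0r.
have clt : (size c' < n)%N.
  rewrite -cn cE size_mul // -subn1 -addnBA ?size_poly_gt0 // -[X in (X <
    _)%N]addn0.
  by rewrite ltn_add2l subn_gt0; case: irr.
have [e' [be' e'e]] := torsion_basis_lift_irr b0 irr eb.
have [g [bg ge']] := IH _ clt _ (erefl _) _ _ (mulf_neq0 b0 pi0) c'0 be'.
exists g; split; first by rewrite cE [c' * _]mulrC mulrA.
by move=> i; rewrite cE mulrC -scalerA ge' e'e.
Qed.

(** An enumeration of the nonzero polynomials with 1 as filler; the partial products are cofinal for
    divisibility. *)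
Let c_ n : A := if unpickle n is Some a then if a == 0 then 1 else a else 1.

(** Compatibility along the chain is what glues the bases of the b_n-torsion into a single
    isomorphism. *)
Lemma torsion_basis_chain : exists (b : nat -> A) (e : nat -> 'I_s -> V),
  [/\ forall n, b n != 0 /\ torsion_basis (b n) (e n),
     forall a, a != 0 -> exists n, a %| b n &
     forall n m, (n <= m)%N ->
       exists d, b m = b n * d /\ forall i, d *: e m i = e n i].
Proof.
have c0 n : c_ n != 0.
  rewrite /c_; case: unpickle => [a|]; last by rewrite oner_eq0.
  by case: (eqVneq a 0) => [_|h]; rewrite ?oner_eq0 // h.
(* The hypotheses are moved behind the choice of g, so that the recursion below computes with a
   total function and carries no proofs. *)
have /choice [F FP] : forall bec : A * ('I_s -> V) * A, exists g,
    bec.1.1 != 0 -> bec.2 != 0 -> torsion_basis bec.1.1 bec.1.2 ->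
    torsion_basis (bec.1.1 * bec.2) g /\ forall i, bec.2 *: g i = bec.1.2 i.
  move=> [[b e] c] /=.
  have [h|h] := pselect (b != 0 /\ c != 0 /\ torsion_basis b e).
    by have [g gP] := torsion_basis_lift h.1 h.2.1 h.2.2; exists g.
  by exists e => *; case: h.
pose fix E n : A * ('I_s -> V) :=
  if n is m.+1 then ((E m).1 * c_ m, F (E m, c_ m)) else (1, fun=> 0).
have EP n : (E n).1 != 0 /\ torsion_basis (E n).1 (E n).2.
  elim: n => [|n [b0 IH]] /=.
    split; first exact: oner_neq0.
    split=> [i|z|x _ i]; rewrite ?scaler0 ?dvd1p //.
    by rewrite scale1r => ->; exists (fun=> 0); rewrite lcomb0 // => i;
      rewrite scaler0.
  split; first by rewrite mulf_neq0.
  by have [] := FP (E n, c_ n) b0 (c0 n) IH.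
exists (fun n => (E n).1), (fun n => (E n).2); split=> //.
- move=> a a0; exists (pickle a).+1 => /=; rewrite /c_ pickleK (negPf a0).
  exact: dvdp_mulIr.
- move=> n m /subnKC <-; elim: (m - n)%N => [|j [d [bE eE]]].
    by exists 1; rewrite addn0 mulr1; split=> // i; rewrite scale1r.
  exists (d * c_ (n + j)%N); rewrite addnS /= bE mulrA; split=> // i.
  rewrite -eE -scalerA; congr (_ *: _).
  by have [] := FP (E (n + j)%N, c_ (n + j)%N) (EP _).1 (c0 _) (EP _).2.
Qed.

(** The sum of the x_i e_(n,i) corresponds to the classes of the fractions x_i / b_n. Passing from n
    to m multiplies numerators and denominators by the same d, so the level n is immaterial. *)
Lemma iso_KmodA : lmod_iso V (dsum (fun _ : 'I_s => KmodA k)).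
Proof.
have [b [e [be bcof bmono]]] := torsion_basis_chain.
have b0 n : b n != 0 by case: (be n).
have fb0 n : tofrac (b n) != 0 by rewrite tofrac_eq0.
pose pi (f : ratfun k) : KmodA k := quotmod_pi (@ratfun_int k) f.
have piP f : pi f = 0 <-> exists a : A, f = tofrac a.
  rewrite /pi quotmod_pi_eq0 inE; split=> /asboolP //.
have piZ c f : c *: pi f = pi (tofrac c * f) by exact: quotmod_piZ.
have piD (f h : ratfun k) : pi f + pi h = pi (f + h) by rewrite /pi quotmod_piD.
have up n m (x : 'I_s -> A) : (n <= m)%N -> exists y, lcomb (e n) x =
  lcomb (e m) y /\
    forall i, tofrac (x i) / tofrac (b n) = tofrac (y i) / tofrac (b m).
  move=> /bmono [d [bE eE]]; exists (fun i => x i * d); split.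
    by rewrite -lcomb_scale; apply: eq_lcomb.
  move=> i; have d0 : tofrac d != 0.
    by rewrite tofrac_eq0; apply: contraNneq (b0 m) => h; rewrite bE h mulr0.
  by rewrite bE !rmorphM /= -mulf_div divff // mulr1.
apply: (@lmod_iso_rel A V (dsum (fun _ : 'I_s => KmodA k)) (fun z w => exists n x,
  z = lcomb (e n) x /\ forall i, w i = pi (tofrac (x i) / tofrac (b n)))).
- move=> c u u' v v' [n [x [-> vx]]] [n' [x' [-> vx']]].
  have [y [-> yE]] := up n (maxn n n') x (leq_maxl _ _).
  have [y' [-> yE']] := up n' (maxn n n') x' (leq_maxr _ _).
  exists (maxn n n'), (fun i => c * y i + y' i); split;
    first by rewrite lcombZ lcombD.
  move=> i; rewrite rmorphD rmorphM /= mulrDl -piD -mulrA -piZ -yE -yE'.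
  by rewrite -vx -vx'.
- move=> u; have [a a0 au] := Vtors u; have [n an] := bcof a a0.
  have [_ [_ gen _]] := be n; have [|x ux] := gen u.
    by have /dvdpP [d ->] := an; rewrite -scalerA au scaler0.
  by exists (fun i => pi (tofrac (x i) / tofrac (b n))), n, x.
- move=> w; have /choice [f fw] : forall i, exists f, pi f = w i.
    by move=> i; have [f <-] := quotmod_pi_surj (w i); exists f.
  have /choice [uv uvP] : forall i, exists uv : A * A, uv.2 != 0 /\ f i =
    tofrac uv.1 / tofrac uv.2.
    by move=> i; have [u [v [v0 fE]]] := ratfunP (f i); exists (u, v).
  have [|n an] := bcof (\prod_i (uv i).2).
    by apply/prodf_neq0 => i _; case: (uvP i).
  have dv i : exists d, b n = d * (uv i).2.
    by apply/dvdpP; apply: dvdp_trans an; rewrite (bigD1 i) //= dvdp_mulIl.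
  have /choice [d dE] := dv.
  exists (lcomb (e n) (fun i => (uv i).1 * d i)), n, (fun i => (uv i).1 * d i);
    split=> // i.
  rewrite -fw (uvP i).2 (dE i) !rmorphM /= [X in _ =
    pi (_ / X)]mulrC -mulf_div divff ?mulr1 //.
  by rewrite tofrac_eq0; apply: contraNneq (b0 n) => h; rewrite (dE i) h mul0r.
- move=> w [n [x [/esym x0 wx]]]; apply: functional_extensionality_dep => i.
  have [_ [_ _ /(_ _ x0 i) /dvdpP [q xq]]] := be n.
  by rewrite wx xq; apply/piP; exists q; rewrite rmorphM /= mulfK.
- move=> u [n [x [-> wx]]]; apply: lcomb0 => i.
  have /piP [a /(canRL (mulfVK (fb0 n))) aE]
    : pi (tofrac (x i) / tofrac (b n)) = 0 by rewrite -wx.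
  have -> : x i = a * b n.
    by apply/eqP; rewrite -tofrac_eq aE rmorphM.
  by have [_ [bei _ _]] := be n; rewrite -scalerA bei scaler0.
Qed.

End DivisibleTorsion.

(** * Ultrametric norms and Gauss norms *)

Lemma Bernoulli (R : realDomainType) (e : R) n : 0 <= e -> 1 + n%:R * e <=
  (1 + e) ^+ n.
Proof.
move=> e0; elim: n => [|n IH]; first by rewrite mul0r addr0 expr0.
rewrite exprS; apply: le_trans (ler_wpM2l (addr_ge0 ler01 e0) IH).
have : 0 <= n%:R * e * e by rewrite !mulr_ge0.
rewrite -natr1; nra.
Qed.

Lemma expr_unbounded (R : realType) (y b : R) : 1 < y -> exists n, b < y ^+ n.
Proof.
move=> y1; have e0 : 0 < y - 1 by rewrite subr_gt0.
have b0 : 0 <= `|b| / (y - 1) by rewrite divr_ge0 // ltW.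
have := archi_boundP b0; set n := Num.bound _ => h; exists n.
have := Bernoulli n (ltW e0); rewrite [1 + (y - 1)]addrC subrK => h2.
apply: lt_le_trans h2; rewrite ltr_pdivrMr // in h.
by have := ler_norm b; lra.
Qed.

Lemma expr_gt_linear (R : realType) (y : R) : 1 < y -> exists n, n.+1%:R < y ^+ n.
Proof.
move=> y1; have e0 : 0 < y - 1 by rewrite subr_gt0.
have b0 : 0 <= 2 / (y - 1) ^+ 2 by rewrite divr_ge0 // exprn_ge0 // ltW.
(* Bernoulli is linear in the exponent; an even exponent allows squaring it, and n^2 (y - 1)^2
   absorbs 2 n. *)
have := archi_boundP b0; set n := Num.bound _ => h; exists (n * 2)%N.
rewrite ltr_pdivrMr ?exprn_gt0 // in h.
have := Bernoulli n (ltW e0); rewrite [1 + (y - 1)]addrC subrK => h2.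
rewrite exprM -natr1 natrM.
have n0 : 0 <= n%:R :> R by [].
have nn : n%:R * 2 <= n%:R * (n%:R * (y - 1) ^+ 2) by rewrite ler_wpM2l // ltW.
have n1 : 0 < n%:R * (y - 1).
  by rewrite mulr_gt0 // lt_neqAle n0 andbT; apply: contraTneq h => <-.
have : (n%:R * (y - 1) + 1) ^+ 2 <= (y ^+ n) ^+ 2.
  have y0 : 0 <= y by rewrite ltW // (lt_trans ltr01).
  rewrite ler_pXn2r ?nnegrE ?exprn_ge0 ?addr_ge0 ?(ltW n1) //; lra.
rewrite !expr2 in nn *; nra.
Qed.

Section Ultrametric.
Variables (R : realType) (V : zmodType) (n : V -> R).
Hypothesis n0 : n 0 = 0.
Hypothesis nD : forall x y, n (x + y) <= Num.max (n x) (n y).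
Hypothesis nN : forall x, n (- x) = n x.

(** The section is stated on an additive group so as to serve absolute values and Berkovich
    seminorms alike. *)
Lemma ultra_sum_le (I : Type) (r : seq I) (P : pred I) (F : I -> V) b :
  0 <= b -> (forall i, P i -> n (F i) <= b) -> n (\sum_(i <- r | P i) F i) <= b.
Proof.
move=> b0 Fb; apply: (big_ind (fun x => n x <= b)) => //; first by rewrite n0.
by move=> x y xb yb; apply: le_trans (nD _ _) _; rewrite ge_max xb yb.
Qed.

Lemma ultra_sum_lt (I : Type) (r : seq I) (P : pred I) (F : I -> V) b :
  0 < b -> (forall i, P i -> n (F i) < b) -> n (\sum_(i <- r | P i) F i) < b.
Proof.
move=> b0 Fb; apply: (big_ind (fun x => n x < b)) => //; first by rewrite n0.
by move=> x y xb yb; apply: le_lt_trans (nD _ _) _; rewrite gt_max xb yb.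
Qed.

Lemma ultra_dominant x y : n y < n x -> n (x + y) = n x.
Proof.
move=> yx; apply/eqP; rewrite eq_le; apply/andP; split.
  by apply: le_trans (nD _ _) _; rewrite ge_max lexx ltW.
have := nD (x + y) (- y); rewrite addrK nN => h.
by move: h; rewrite le_max => /orP [//|]; rewrite leNgt yx.
Qed.

Lemma ultra_sub x y b : n x <= b -> n y <= b -> n (x - y) <= b.
Proof. by move=> xb yb; apply: le_trans (nD _ _) _; rewrite nN ge_max xb yb. Qed.

End Ultrametric.

Section AbsvalTheory.
Variables (R : realType) (F : fieldType) (N : absval R F).

Lemma absval0 : N 0 = 0. Proof. by apply/absval_eq0. Qed.

Lemma absval_neq0 x : (N x == 0) = (x == 0).
Proof. by apply/eqP/eqP => [/absval_eq0|->] //; exact: absval0. Qed.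

Lemma absval_gt0 x : (0 < N x) = (x != 0).
Proof. by rewrite lt_neqAle absval_ge0 andbT eq_sym absval_neq0. Qed.

Lemma absval1 : N 1 = 1.
Proof.
have := absvalM N 1 1; rewrite mulr1 => /eqP;
  rewrite eq_sym -subr_eq0 -{3}[N 1]mulr1.
rewrite -mulrBr mulf_eq0 absval_neq0 oner_eq0 /= subr_eq0 => /eqP //.
Qed.

Lemma absvalX x m : N (x ^+ m) = N x ^+ m.
Proof. by elim: m => [|m IH]; rewrite ?expr0 ?absval1 // !exprS absvalM IH. Qed.

Lemma absvalN x : N (- x) = N x.
Proof.
rewrite -mulN1r absvalM; suff -> : N (-1) = 1 by rewrite mul1r.
have : N (-1) ^+ 2 = 1 by rewrite -absvalX sqrrN expr1n absval1.
by move/eqP; rewrite sqrf_eq1 => /orP [/eqP //|/eqP h]; have := absval_ge0 N (-1);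
  rewrite h ler0N1.
Qed.

Lemma absvalV x : N x^-1 = (N x)^-1.
Proof.
have [->|x0] := eqVneq x 0; first by rewrite invr0 absval0 invr0.
have Nx0 : N x != 0 by rewrite absval_neq0.
by apply: (mulfI Nx0); rewrite -absvalM !divff // absval1.
Qed.

Lemma absval_sub x y b : N x <= b -> N y <= b -> N (x - y) <= b.
Proof. exact: ultra_sub (absvalD N) absvalN _ _ _. Qed.

Lemma absval_nat m : N m%:R <= 1.
Proof.
elim: m => [|m IH]; first by rewrite absval0.
by rewrite -natr1; apply: le_trans (absvalD _ _ _) _;
  rewrite ge_max IH absval1 lexx.
Qed.

End AbsvalTheory.

(** * Gauss norms and dominant monomials *)

Section GaussNorm.
Variables (R : realType) (F : fieldType) (N : absval R F).
Implicit Types (t : R) (f g : {poly F}).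

Definition gval t f i : R := N f`_i * t ^+ i.

Definition gauss t f : R := \big[Num.max/0]_(i < size f) gval t f i.

Lemma gval_ge0 t f i : 0 <= t -> 0 <= gval t f i.
Proof. by move=> t0; rewrite mulr_ge0 ?absval_ge0 ?exprn_ge0. Qed.

Lemma gval_size t f i : (size f <= i)%N -> gval t f i = 0.
Proof. by move=> fi; rewrite /gval nth_default // absval0 mul0r. Qed.

Lemma gauss_le t f b : 0 <= b -> (forall i, gval t f i <= b) -> gauss t f <= b.
Proof. by move=> b0 fb; apply: bigmax_le => // i _; exact: fb. Qed.

Lemma gauss_ge0 t f : 0 <= gauss t f.
Proof. exact: bigmax_ge_id. Qed.

Lemma gval_le_gauss t f i : gval t f i <= gauss t f.
Proof.
have [fi|fi] := leqP (size f) i; first by rewrite gval_size ?gauss_ge0.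
by rewrite /gauss (le_bigmax _ _ (Ordinal fi)).
Qed.

(** The right end of the Newton polygon segment seen from radius t. Over an algebraically closed
    field and for t > 0, this index is the number of roots in the closed disc of radius t, hence its
    additivity on products. *)
Definition last_dominant t f i :=
  [/\ 0 < gval t f i, forall j, gval t f j <= gval t f i &
    forall j, (i < j)%N -> gval t f j < gval t f i].

Lemma last_dominant_gauss t f i : last_dominant t f i -> gauss t f = gval t f i.
Proof.
move=> [i0 h _]; apply/eqP; rewrite eq_le gval_le_gauss andbT.
by apply: gauss_le => //; exact: ltW.
Qed.

Lemma last_dominant_uniq t f i j : last_dominant t f i -> last_dominant t f j ->
  i = j.
Proof.
move=> [_ hi hi'] [_ hj hj']; case: (ltngtP i j) => //.
  by move=> /hi'; rewrite ltNge hj.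
by move=> /hj'; rewrite ltNge hi.
Qed.

Lemma last_dominant_ex t f : 0 < t -> f != 0 -> exists i, last_dominant t f i.
Proof.
move=> t0 f0; have t0' := ltW t0.
have lead0 : 0 < gval t f (size f).-1.
  by rewrite mulr_gt0 ?exprn_gt0 // absval_gt0 -lead_coefE lead_coef_eq0.
have g0 : 0 < gauss t f by apply: lt_le_trans lead0 (gval_le_gauss _ _ _).
have [i0 gi0] : exists i, gval t f i == gauss t f.
  have : gauss t f = 0 \/ exists i, gval t f i == gauss t f.
    rewrite /gauss; apply: (big_ind (fun x => x = 0 \/ exists i, gval t f i == x)).
    + by left.
    + by move=> x y hx hy; rewrite maxEle; case: ifP.
    + by move=> i _; right; exists i.
  by case=> // h; rewrite h ltxx in g0.
have bnd i : gval t f i == gauss t f -> (i <= size f)%N.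
  move=> /eqP gi; rewrite leqNgt; apply/negP => /ltnW /(gval_size t) h.
  by rewrite -gi h ltxx in g0.
have [i /eqP gi imax] := ex_maxnP (ex_intro _ i0 gi0) bnd.
exists i; rewrite /last_dominant gi; split=> // j; first exact: gval_le_gauss.
move=> ij; rewrite lt_neqAle gval_le_gauss andbT; apply/negP => /imax.
by rewrite leqNgt ij.
Qed.

(** The argument of Gauss's lemma: in degree i + j every product other than f_i g_j uses an index
    beyond i or beyond j and is strictly smaller, and beyond degree i + j all products are. *)
Lemma last_dominantM t f g i j : 0 <= t -> last_dominant t f i ->
  last_dominant t g j ->
  last_dominant t (f * g) (i + j) /\ gval t (f * g) (i + j) =
    gval t f i * gval t g j.
Proof.
move=> t0 [fi0 fi fi'] [gj0 gj gj'].
have absS := ultra_sum_le (absval0 N) (absvalD N).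
have p0 : 0 < gval t f i * gval t g j by rewrite mulr_gt0.
have termE m (l : 'I_m.+1) : N (f`_l * g`_(m - l)) * t ^+ m =
  gval t f l * gval t g (m - l).
  have -> : t ^+ m = t ^+ l * t ^+ (m - l) by rewrite -exprD subnKC // -ltnS.
  by rewrite absvalM mulrACA.
have term_le m (l : 'I_m.+1) : N (f`_l * g`_(m - l)) * t ^+ m <=
  gval t f i * gval t g j.
  by rewrite termE ler_pM ?gval_ge0.
have term_lt m (l : 'I_m.+1) : (i < l)%N || (j < m - l)%N ->
    N (f`_l * g`_(m - l)) * t ^+ m < gval t f i * gval t g j.
  rewrite termE => /orP [/fi' h|/gj' h].
    apply: (le_lt_trans (y := gval t f l * gval t g j)).
      by rewrite ler_wpM2l ?gval_ge0.
    by rewrite ltr_pM2r.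
  apply: (le_lt_trans (y := gval t f i * gval t g (m - l))).
    by rewrite ler_wpM2r ?gval_ge0.
  by rewrite ltr_pM2l.
have tm0 m : 0 <= t ^+ m by exact: exprn_ge0.
(* Radius 0 is treated apart, as t^m cannot be divided out; there only constant terms count. *)
have [tz|tnz] := eqVneq t 0.
  have i0 : i = 0%N.
    by case: i fi0 {fi fi' p0 term_le term_lt} => // i;
      rewrite /gval tz exprS mul0r mulr0 ltxx.
  have j0 : j = 0%N.
    by case: j gj0 {gj gj' p0 term_le term_lt} => // j;
      rewrite /gval tz exprS mul0r mulr0 ltxx.
  have E : gval t (f * g) (i + j) = gval t f i * gval t g j.
    by rewrite i0 j0 /gval addn0 !expr0 !mulr1 coef0M absvalM.
  have z m : (0 < m)%N -> gval t (f * g) m = 0.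
    by case: m => // m _; rewrite /gval tz exprS mul0r mulr0.
  split=> //; split; rewrite E // => -[|m] //.
  - by rewrite -E i0 j0.
  - by rewrite z ?ltW.
  - by rewrite z.
have tp m : 0 < t ^+ m by rewrite exprn_gt0 // lt_neqAle eq_sym tnz.
have sum_le m b : 0 <= b ->
    (forall l : 'I_m.+1, N (f`_l * g`_(m - l)) * t ^+ m <= b) ->
      gval t (f * g) m <= b.
  move=> b0 h; rewrite /gval coefM -ler_pdivlMr //; apply: absS => [|l _].
    by rewrite divr_ge0 // ltW.
  by rewrite ler_pdivlMr.
have sum_lt m b : 0 < b ->
    (forall l : 'I_m.+1, N (f`_l * g`_(m - l)) * t ^+ m < b) ->
      gval t (f * g) m < b.
  move=> b0 h; rewrite /gval coefM -ltr_pdivlMr //.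
  apply: (ultra_sum_lt (absval0 N) (absvalD N)) => [|l _].
    by rewrite divr_gt0.
  by rewrite ltr_pdivlMr.
have E : gval t (f * g) (i + j) = gval t f i * gval t g j.
  have li : (i < (i + j).+1)%N by rewrite ltnS leq_addr.
  rewrite /gval coefM (bigD1 (Ordinal li)) //= addKn.
  rewrite (ultra_dominant (absvalD N) (absvalN N)).
    by rewrite absvalM exprD mulrACA.
  rewrite -(ltr_pM2r (tp (i + j)%N)).
  have -> : N (f`_i * g`_j) * t ^+ (i + j) = gval t f i * gval t g j.
    by rewrite absvalM exprD mulrACA.
  rewrite -ltr_pdivlMr //; apply: (ultra_sum_lt (absval0 N) (absvalD N)) => [|l].
    by rewrite divr_gt0.
  rewrite ltr_pdivlMr // => li'; apply: term_lt.
  have [//|/= il] := ltnP i l; rewrite ltn_subRL ltn_add2r.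
  rewrite ltn_neqAle il andbT; apply: contraNneq li' => e; apply/eqP.
  exact: val_inj.
split=> //; split; rewrite E // => m.
  by apply: sum_le => //; exact: ltW.
move=> ijm; apply: sum_lt => // l; apply: term_lt.
have [//|/= li] := ltnP i l; rewrite ltn_subRL.
by apply: leq_ltn_trans ijm; rewrite leq_add2r.
Qed.

Lemma gaussM t f g : 0 <= t -> gauss t (f * g) = gauss t f * gauss t g.
Proof.
move=> t0; have [->|f0] := eqVneq f 0.
  by rewrite mul0r /gauss size_poly0 big_ord0 mul0r.
have [->|g0] := eqVneq g 0.
  by rewrite mulr0 /gauss size_poly0 !big_ord0 mulr0.
have [tz|tnz] := eqVneq t 0.
  have gauss0 h : gauss t h = N h`_0.
    apply/eqP; rewrite eq_le; apply/andP; split.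
      apply: gauss_le; first exact: absval_ge0.
      move=> [|i]; first by rewrite /gval expr0 mulr1.
      by rewrite /gval tz exprS mul0r mulr0 absval_ge0.
    by have := gval_le_gauss t h 0; rewrite /gval expr0 mulr1.
  by rewrite !gauss0 coef0M absvalM.
have tp : 0 < t by rewrite lt_neqAle eq_sym tnz.
have [i fi] := last_dominant_ex tp f0; have [j gj] := last_dominant_ex tp g0.
have [fgij E] := last_dominantM t0 fi gj.
by rewrite (last_dominant_gauss fi) (last_dominant_gauss gj)
  (last_dominant_gauss fgij).
Qed.

Lemma gaussD t f g : 0 <= t -> gauss t (f + g) <= Num.max (gauss t f) (gauss t g).
Proof.
move=> t0; apply: gauss_le => [|i]; first by rewrite le_max gauss_ge0.
rewrite /gval coefD.
apply: (le_trans (ler_wpM2r (exprn_ge0 _ t0) (absvalD _ _ _))).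
rewrite maxr_pMl ?exprn_ge0 // ge_max !le_max !gval_le_gauss ?orbT //.
Qed.

Lemma gaussC t c : gauss t c%:P = N c.
Proof.
apply/eqP; rewrite eq_le; apply/andP; split.
  apply: gauss_le; first exact: absval_ge0.
  move=> i; rewrite /gval coefC; case: eqP => [->|_]; first by rewrite expr0 mulr1.
  by rewrite absval0 mul0r absval_ge0.
by have := gval_le_gauss t c%:P 0; rewrite /gval expr0 mulr1 coefC.
Qed.

Section GaussPoint.
Variable t : R.
Hypothesis t0 : 0 <= t.

Fact gaussD_le f g : gauss t (f + g) <= gauss t f + gauss t g.
Proof.
by apply: le_trans (gaussD _ _ t0) _; rewrite ge_max lerDl lerDr !gauss_ge0.
Qed.
Fact gaussM_morph : {morph gauss t : f g / f * g}.
Proof. by move=> f g; exact: gaussM. Qed.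

Definition gauss_point : berk N :=
  Berk (gauss_ge0 t) gaussD_le gaussM_morph (gaussC t).

End GaussPoint.

End GaussNorm.

Section BerkTheory.
Variables (R : realType) (C : fieldType) (N : absval R C) (zeta : berk N).
Implicit Types f g : {poly C}.

Lemma berk0 : zeta 0 = 0. Proof. by rewrite -polyC0 berkC absval0. Qed.

Lemma berkX f n : zeta (f ^+ n) = zeta f ^+ n.
Proof.
by elim: n => [|n IH]; rewrite ?expr0 -?polyC1 ?berkC ?absval1 // !exprS berkM IH.
Qed.

Lemma berkN f : zeta (- f) = zeta f.
Proof. by rewrite -mulN1r -polyC1 -polyCN berkM berkC absvalN absval1 mul1r. Qed.

(* The triangle inequality improves to the ultrametric one by taking n-th
   powers and letting n go to infinity. *)
Lemma berkD_max f g : zeta (f + g) <= Num.max (zeta f) (zeta g).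
Proof.
set M := Num.max _ _; rewrite leNgt; apply/negP => Mlt.
have M0 : 0 <= M by rewrite le_max berk_ge0.
have fM : zeta f <= M by rewrite le_max lexx.
have gM : zeta g <= M by rewrite le_max lexx orbT.
have pow n : zeta (f + g) ^+ n <= n.+1%:R * M ^+ n.
  rewrite -berkX exprDn.
  have : zeta (\sum_(i < n.+1) (f ^+ (n - i) * g ^+ i) *+ 'C(n, i)) <=
      \sum_(i < n.+1) M ^+ n.
    apply: (big_ind2 (fun x y => zeta x <= y)) => [|x x' y y' hx hy|i _].
    - by rewrite berk0.
    - by apply: le_trans (berkD _ _ _) _; exact: lerD.
    - rewrite -mulr_natl -polyC_natr !berkM berkC !berkX.
      rewrite -[M ^+ n]mul1r; apply: ler_pM;
        rewrite ?absval_ge0 ?mulr_ge0 ?exprn_ge0 ?berk_ge0 //.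
        exact: absval_nat.
      have -> : M ^+ n = M ^+ (n - i) * M ^+ i by rewrite -exprD subnK // -ltnS.
      by rewrite ler_pM ?exprn_ge0 ?berk_ge0 // lerXn2r // nnegrE berk_ge0.
  by move=> /le_trans; apply; rewrite sumr_const card_ord -[X in X <= _]mulr_natl.
have [Mz|Mnz] := eqVneq M 0.
  by have := pow 1; rewrite Mz !expr1 mulr0 leNgt -{1}Mz Mlt.
have Mp : 0 < M by rewrite lt_neqAle eq_sym Mnz.
have y1 : 1 < zeta (f + g) / M by rewrite ltr_pdivlMr // mul1r.
have [n] := expr_gt_linear y1; rewrite expr_div_n ltr_pdivlMr ?exprn_gt0 //.
by rewrite ltNge pow.
Qed.

Lemma berk_monomial c i : zeta (c *: 'X^i) = N c * zeta 'X ^+ i.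
Proof. by rewrite -mul_polyC berkM berkC berkX. Qed.

(** In the absence of ties the ultrametric inequality is an equality, so the seminorm of f at [zeta]
    depends only on the radius [zeta 'X]. *)
Lemma berk_dominant f i :
  (forall j, j != i -> gval N (zeta 'X) f j < gval N (zeta 'X) f i) ->
  zeta f = gval N (zeta 'X) f i.
Proof.
move=> dom; have X0 := berk_ge0 zeta 'X.
have gi0 : 0 < gval N (zeta 'X) f i.
  apply: le_lt_trans (dom i.+1 _); first exact: gval_ge0.
  by rewrite -[X in _ == X]addn0 -addn1 eqn_add2l.
have ilt : (i < size f)%N.
  rewrite ltnNge; apply/negP => /(gval_size N (zeta 'X)) h.
  by rewrite h ltxx in gi0.
have gE j : gval N (zeta 'X) f j = zeta (f`_j *: 'X^j) by rewrite berk_monomial.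
rewrite gE -{1}[f]coefK poly_def (bigD1 (Ordinal ilt)) //=.
apply: (ultra_dominant berkD_max berkN); rewrite -gE.
by apply: (ultra_sum_lt berk0 berkD_max) => // j ji; rewrite -gE; exact: dom.
Qed.

End BerkTheory.

(** * Coefficients of additive polynomials, and escape from the filled Julia set *)

Lemma card_finField_pchar (k : finFieldType) :
  exists p f, [/\ prime p, p \in [pchar k], (0 < f)%N & #|k| = (p ^ f)%N].
Proof.
have [p pp pk] := finPcharP k; exists p.
have E : #|k| = (p ^ logn p #|k|)%N by exact: (card_pprimeChar pk).
exists (logn p #|k|); split=> //; rewrite lt0n.
by apply: contraTneq (finNzRing_gt1 k) => h; rewrite E h.
Qed.

Lemma rmorph_pchar_in (k F : fieldType) (j : {rmorphism k -> F}) p :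
  p \in [pchar k] -> p \in [pchar F].
Proof.
rewrite !inE => /andP [-> /eqP p0] /=.
by rewrite -(rmorph_nat j) p0 rmorph0.
Qed.

Section AdditivePolynomials.
Variables (F : fieldType) (p : nat) (P : {poly F}).
Hypothesis pF : p \in [pchar F].
Hypothesis Padd : additive_poly P.

(** This is the coefficient of Y^j X^(i - j) in P(Y + X) = P(Y) + P(X). *)
Lemma additive_poly_bin i j : (0 < j < i)%N -> P`_i *+ 'C(i, j) = 0.
Proof.
move=> /andP [j0 ji]; have := Padd; rewrite /additive_poly.
move=> /(congr1 (fun Q : {poly {poly F}} => Q`_j`_(i - j))).
rewrite comp_polyE coef_sum !coefD !coefC coef_map /= !coefC.
rewrite (gtn_eqF j0) subn_eq0 leqNgt ji /= coef0 addr0.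
rewrite coef_sum => E.
have [Pi|Pi] := leqP (size P) i; first by rewrite nth_default // mul0rn.
have li : (i < size (map_poly polyC P))%N by rewrite size_map_polyC.
have term (l : 'I_(size (map_poly polyC P))) :
    ((map_poly polyC P)`_l *: ('X + 'X%:P) ^+ l)`_j`_(i - j) =
    if l == i :> nat then P`_i *+ 'C(i, j) else 0.
  rewrite coefZ coef_map /= coefCM addrC exprDn coef_sum.
  have [jl|lj] := leqP j l.
    have ljl : (j < l.+1)%N by [].
    rewrite (bigD1 (Ordinal ljl)) //= big1 => [|m mj].
      rewrite addr0 coefMn -polyC_exp coefCM coefXn eqxx mulr1 coefMn coefXn.
      rewrite -(eqn_add2r j) subnK ?(ltnW ji) // subnK //.
      by rewrite eq_sym; case: eqP => [->|_];
        rewrite ?mulr_natr ?mul0rn ?mulr0 // -mulrnAr.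
    rewrite coefMn -polyC_exp coefCM coefXn.
    have /negPf -> : j != m by apply: contraNneq mj => e; apply/eqP/val_inj.
    by rewrite mulr0 mul0rn.
  have /negPf -> : l != i :> nat by rewrite neq_ltn (ltn_trans lj ji).
  rewrite big1 ?coef0 ?mulr0 // => m _.
  rewrite coefMn -polyC_exp coefCM coefXn.
  have /negPf -> : j != m.
    by rewrite neq_ltn; apply/orP; right; apply: leq_ltn_trans lj; rewrite -ltnS.
  by rewrite mulr0 mul0rn.
move: E.
rewrite (eq_bigr _ (fun l _ =>
  term l)) (bigD1 (Ordinal li)) //= eqxx big1 ?addr0 //.
by move=> l li'; rewrite ifN.
Qed.

(** Write i = m p^e with m prime to p. Comparing coefficients of degree p^e in (X + 1)^i = (X^(p^e)
    + 1)^m shows that C(i, p^e) equals m in F, hence is nonzero, whereas additivity makes it vanish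
    if m > 1. *)
Lemma additive_poly_coef i : (0 < i)%N -> P`_i != 0 -> exists e, i = (p ^ e)%N.
Proof.
move=> i0 Pi; have pp : prime p by case/andP: pF.
have [m pm iE] := pfactor_coprime pp i0; set e := logn p i in iE.
exists e; rewrite iE; have m0 : (0 < m)%N by case: m iE pm i0 => // -> _;
  rewrite mul0n.
have [m1|m1] := leqP m 1; first by rewrite (_ : m = 1)%N ?mul1n //; apply/eqP;
  rewrite eqn_leq m1.
have bin0 j : (0 < j < i)%N -> 'C(i, j)%:R = 0 :> F.
  move=> /additive_poly_bin; rewrite -[P`_i *+ _]mulr_natr => /eqP.
  by rewrite mulf_eq0 (negPf Pi) => /eqP.
have pe0 : (0 < p ^ e)%N by rewrite expn_gt0 prime_gt0.
have pei : (0 < p ^ e < i)%N by rewrite pe0 iE ltn_Pmull.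
have pchF : p \in [pchar {poly F}].
  by move: pF; rewrite !inE => /andP [-> /eqP h] /=; rewrite -polyC_natr h.
have E : ('X + 1) ^+ i = ('X^(p ^ e) + 1) ^+ m :> {poly F}.
  rewrite iE mulnC exprM (exprDn_pchar _ _ (n := (p ^ e)%N)) ?expr1n //.
  by rewrite pnatX (pnatE _ pp) pchF.
have := congr1 (fun Q : {poly F} => Q`_(p ^ e)) E.
rewrite /= !exprD1n !coef_sum.
have pei1 : (p ^ e < i.+1)%N by rewrite ltnS ltnW //; case/andP: pei.
rewrite (bigD1 (Ordinal pei1)) //= coefMn coefXn eqxx bin0 // big1 => [|j jpe];
  last first.
  rewrite coefMn coefXn; case: eqP => [h|_]; last by rewrite mul0rn.
  by case/eqP: jpe; apply: val_inj.
have m1' : (1 < m.+1)%N by [].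
rewrite addr0 (bigD1 (Ordinal m1')) //= expr1 coefMn coefXn eqxx bin1 big1 =>
  [|j jpe]; last first.
  rewrite coefMn -exprM coefXn -{1}[(p ^ e)%N]muln1 eqn_pmul2l //.
  case: eqP => [h|_]; last by rewrite mul0rn.
  by case/eqP: jpe; apply: val_inj.
rewrite addr0 => /esym /eqP; rewrite -(dvdn_pcharf pF) => pm'.
by move: pm; rewrite prime_coprime // pm'.
Qed.

End AdditivePolynomials.

Section BerkAction.
Variables (R : realType) (k : finFieldType) (C : fieldType) (N : absval R C).
Variables (gam : {poly k} -> C) (phi : drinfeld gam).

Lemma drinfeld0 : phi 0 = 0.
Proof. by apply: (addrI (phi 0)); rewrite -drinfeldD !addr0. Qed.

Lemma berk_actM a b (zeta : berk N) :
  berk_act phi a (berk_act phi b zeta) = berk_act phi (a * b) zeta.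
Proof.
apply: berk_eq; apply/funext => f.
by rewrite /= /pullback_fun /= /pullback_fun drinfeldM comp_polyA.
Qed.

Lemma berk_actX a (zeta : berk N) : berk_act phi a zeta 'X = zeta (phi a).
Proof. by rewrite /= /pullback_fun comp_polyX. Qed.

Lemma berk_act1 (zeta : berk N) : berk_act phi 1 zeta = zeta.
Proof.
by apply: berk_eq; apply/funext => f;
  rewrite /= /pullback_fun drinfeld1 comp_polyXr.
Qed.

(* The Newton polygons of all phi_a seen from the radius rho: after rescaling
   by an element of absolute value rho, phi has stable reduction of rank d. *)
Definition newton (rho : R) (d : nat) : Prop :=
  0 < rho /\ forall a, a != 0 ->
    last_dominant N rho (phi a) (#|k| ^ (d * (size a).-1)) /\
    gval N rho (phi a) (#|k| ^ (d * (size a).-1)) = rho.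

End BerkAction.

(** * Growth of orbits far from 0 *)

Section Escape.
Variables (R : realType) (k : finFieldType) (C : fieldType) (N : absval R C).
Variables (gam : {poly k} -> C) (phi : drinfeld gam) (rho : R) (d r p : nat).
Hypotheses (pk : p \in [pchar k]) (pC : p \in [pchar C]).
Hypotheses (phiN : newton N phi rho d) (d0 : (0 < d)%N) (phir : drinfeld_rank
  phi r).
Local Notation q := #|k|.
Local Notation n := (q ^ r)%N.

Let rho0 : 0 < rho. Proof. by case: phiN. Qed.

Lemma newton_le a i : gval N rho (phi a) i <= rho.
Proof.
have [->|a0] := eqVneq a 0.
  by rewrite drinfeld0 gval_size ?size_poly0 // ltW.
by have [[_ h _] E] := phiN.2 a a0; rewrite -{2}E.
Qed.

Let q1 : (1 < q)%N. Proof. exact: finNzRing_gt1. Qed.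

Lemma size_phiX : size (phi 'X) = n.+1.
Proof. by rewrite phir ?polyX_eq0 // size_polyX muln1. Qed.

Lemma newton_rank_le : (d <= r)%N.
Proof.
have X0 : 'X != 0 :> {poly k} by rewrite polyX_eq0.
have [[g0 _ _] _] := phiN.2 'X X0.
have : (q ^ d < size (phi 'X))%N.
  rewrite ltnNge; apply/negP => /(gval_size N rho) h.
  by rewrite size_polyX muln1 h ltxx in g0.
by rewrite size_phiX ltnS leq_exp2l.
Qed.

Lemma rank_card_ge2 : (2 <= n)%N.
Proof.
apply: (leq_trans q1); rewrite -{1}[q]expn1 leq_exp2l //.
exact: leq_trans newton_rank_le.
Qed.

(** The exponents of an additive polynomial are powers of p, and so is n; the next lower one is at
    most n / p. The resulting factor 2 is the source of the square in the escape condition. *)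
Lemma phiX_coef_gap i : (i < n)%N -> (phi 'X)`_i != 0 -> (2 * i <= n)%N.
Proof.
case: (posnP i) => [->|i0] // lin ci.
have [e iE] := additive_poly_coef pC (drinfeld_additive phi 'X) i0 ci.
have [p' [f [pp' pk' f0 qE]]] := card_finField_pchar k.
have pp : prime p by case/andP: pC.
have e' : p' = p by move: pk; rewrite (pcharf_eq pk') => /eqP.
move: lin; rewrite iE qE e' -expnM ltn_exp2l ?prime_gt1 // => h.
apply: (@leq_trans (p ^ e.+1)); last by rewrite leq_exp2l ?prime_gt1.
by rewrite expnS leq_mul2r prime_gt1 // orbT.
Qed.

Definition udisc : R := gval N rho (phi 'X) n / rho.

Lemma udisc_gt0 : 0 < udisc.
Proof.
rewrite divr_gt0 // mulr_gt0 ?exprn_gt0 // absval_gt0.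
by rewrite -[n]/(n.+1.-1) -size_phiX -lead_coefE lead_coef_eq0 -size_poly_gt0
  size_phiX.
Qed.

Lemma udisc_le1 : udisc <= 1.
Proof. by rewrite ler_pdivrMr // mul1r newton_le. Qed.

Definition tau (zeta : berk N) : R := zeta 'X / rho.

Lemma gval_tau (zeta : berk N) f i :
  gval N (zeta 'X) f i = gval N rho f i * tau zeta ^+ i.
Proof. by rewrite /gval -mulrA -exprMn mulrCA divff ?mulr1 // gt_eqF. Qed.

(** Relative to rho, the lower monomials of phi_T are at most tau^(n / 2) when tau >= 1, and the
    leading one is udisc tau^n; it dominates when its square exceeds tau^n, that is when [kap]
    exceeds 1. *)
Let kap (zeta : berk N) : R := udisc ^+ 2 * tau zeta ^+ n.

Lemma tau_ge0 zeta : 0 <= tau zeta.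
Proof. by rewrite divr_ge0 ?berk_ge0 // ltW. Qed.

Lemma kap_tau zeta : 1 < kap zeta -> 1 < tau zeta.
Proof.
move=> h; have : 1 < tau zeta ^+ n.
  apply: lt_le_trans h _; rewrite -[X in _ <=
    X]mul1r ler_wpM2r ?exprn_ge0 ?tau_ge0 //.
  by rewrite exprn_ile1 ?udisc_le1 // ltW // udisc_gt0.
rewrite ltNge => h1; rewrite ltNge; apply: contra h1 => t1.
by rewrite exprn_ile1 // tau_ge0.
Qed.

Lemma tau_act (zeta : berk N) : 1 < kap zeta ->
  tau (berk_act phi 'X zeta) = udisc * tau zeta ^+ n.
Proof.
move=> h; have t1 := kap_tau h; have t0 := lt_trans ltr01 t1.
have u0 := udisc_gt0.
rewrite /tau berk_actX -/(tau zeta) (@berk_dominant _ _ _ _ _ n).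
  by rewrite gval_tau /udisc mulrAC.
move=> j; rewrite !gval_tau neq_ltn => /orP [jn|nj]; last first.
  rewrite gval_size ?size_phiX // mul0r mulr_gt0 ?exprn_gt0 //.
  by have := udisc_gt0; rewrite /udisc pmulr_lgt0 // invr_gt0.
have -> : gval N rho (phi 'X) n =
  rho * udisc by rewrite /udisc mulrC divfK // gt_eqF.
have [z|nz] := eqVneq (phi 'X)`_j 0.
  by rewrite {1}/gval z absval0 !mul0r (mulr_gt0 (mulr_gt0 rho0 u0) (exprn_gt0 _
    t0)).
apply: (@le_lt_trans _ _ (rho * tau zeta ^+ j)).
  by rewrite ler_wpM2r ?newton_le // exprn_ge0 // ltW.
rewrite -mulrA ltr_pM2l //.
have w0 : 0 < udisc * tau zeta ^+ n by rewrite mulr_gt0 ?exprn_gt0.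
rewrite -(ltr_pXn2r (n := 2)) ?nnegrE ?exprn_ge0 ?(ltW t0) ?(ltW w0) //.
rewrite -exprM mulnC; apply: (@le_lt_trans _ _ (tau zeta ^+ n)).
  by rewrite ler_weXn2l ?(ltW t1) // phiX_coef_gap.
have -> : (udisc * tau zeta ^+ n) ^+ 2 = kap zeta * tau zeta ^+ n.
  by rewrite /kap exprMn [(tau zeta ^+ n) ^+ 2]expr2 mulrA.
by rewrite ltr_pMl // exprn_gt0.
Qed.

(** The constant K is a lower bound for [kap] that persists along the orbit, so that tau^2 grows by
    a fixed factor at each step. *)
Lemma tau_act_ge (zeta : berk N) K : 1 < K -> K <= kap zeta ->
  K * tau zeta ^+ 2 <= tau (berk_act phi 'X zeta) ^+ 2 /\ K <=
    kap (berk_act phi 'X zeta).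
Proof.
move=> K1 h; have h1 := lt_le_trans K1 h; have t1 := kap_tau h1.
have t0 := lt_trans ltr01 t1.
have E : tau (berk_act phi 'X zeta) ^+ 2 =
  kap zeta * tau zeta ^+ (n - 2) * tau zeta ^+ 2.
  rewrite tau_act // -mulrA -exprD subnK ?rank_card_ge2 //.
  by rewrite /kap exprMn [(tau zeta ^+ n) ^+ 2]expr2 mulrA.
have c1 : K <= kap zeta * tau zeta ^+ (n - 2).
  apply: (le_trans h); rewrite ler_peMr ?exprn_ege1 ?(ltW t1) //.
  exact: le_trans (le_trans ler01 (ltW K1)) h.
have g : K * tau zeta ^+ 2 <= tau (berk_act phi 'X zeta) ^+ 2.
  by rewrite E ler_wpM2r // exprn_ge0 // ltW.
split=> //; apply: (le_trans h);
  rewrite /kap ler_wpM2l ?exprn_ge0 ?(ltW udisc_gt0) //.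
rewrite lerXn2r // ?nnegrE ?tau_ge0 //.
rewrite -(ler_pXn2r (n := 2)) ?nnegrE ?tau_ge0 //; apply: le_trans g.
by rewrite ler_peMl ?exprn_ge0 ?tau_ge0 // ltW.
Qed.

(** Otherwise tau grows geometrically along the orbit under the powers of T. The explicit form
    matters later, when the height above rho is compared with -v(j_phi). *)
Lemma FJ_bound (zeta : berk N) : FJ_berk phi zeta ->
  udisc ^+ 2 * tau zeta ^+ n <= 1.
Proof.
move=> [B hB]; rewrite leNgt; apply/negP => K1.
have t1 := kap_tau K1; have t0 := lt_trans ltr01 t1.
have iter m : forall xi, kap zeta <= kap xi ->
    kap zeta ^+ m * tau xi ^+ 2 <= tau (berk_act phi ('X^m) xi) ^+ 2.
  elim: m => [|m IH] xi hxi; first by rewrite expr0 mul1r expr0 berk_act1.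
  have [h1 h2] := tau_act_ge K1 hxi.
  rewrite [kap zeta ^+ _]exprSr ['X^_]exprSr -mulrA -berk_actM;
    apply: le_trans (IH _ h2).
  by rewrite ler_wpM2l // exprn_ge0 // ltW // (lt_trans ltr01).
have [m] := expr_unbounded ((B / rho) ^+ 2 / tau zeta ^+ 2) K1.
rewrite ltr_pdivrMr ?exprn_gt0 // => hm.
have := lt_le_trans hm (iter m zeta (lexx _)).
rewrite ltNge => /negP; apply; rewrite lerXn2r ?nnegrE ?tau_ge0 //.
  by rewrite divr_ge0 ?(ltW rho0) //; apply: le_trans (hB 0); exact: berk_ge0.
by rewrite ler_pM2r ?invr_gt0 // hB.
Qed.

End Escape.

(** * The connected component of 0 *)

Local Open Scope classical_set_scope.
Local Open Scope ring_scope.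

Lemma berk_initial_continuous (R : realType) (C : fieldType) (N : absval R C)
    (T : topologicalType) (g : T -> berk N) :
  (forall f, continuous (fun t => g t f)) -> continuous g.
Proof.
move=> gf; apply: (@continuous_comp_initial _ _ _ (@berk_eval R C N)) => t.
have FF : Filter ((@berk_eval R C N \o g) @ t).
  exact: (@fmap_filter _ _ _ _ (nbhs_filter t)).
apply/cvg_sup => f.
have : continuous ((@berk_eval R C N) \o g
    : T -> initial_topology (fun h : {poly C} -> R => h f)).
  by apply: continuous_comp_initial; exact: gf.
exact.
Qed.

Lemma open_interval_avoid (R : realType) (L : seq R) (a b : R) : a < b ->
  exists t, [/\ a < t, t < b & t \notin L].
Proof.
move=> ab; suff [a' [b' [aa' b'b a'b' h]]] : exists a' b', [/\ a <= a', b' <= b,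
  a' < b' &
    forall x, x \in L -> ~ (a' < x < b')].
  exists ((a' + b') / 2); split; [lra|lra|].
  by apply/negP => /h; apply; apply/andP; split; lra.
elim: L => [|x L [a' [b' [aa' b'b a'b' h]]]]; first by exists a, b.
have [xa|xa] := leP x a'.
  exists a', b'; split=> // y; rewrite inE => /orP [/eqP ->|/h //].
  by rewrite ltNge xa.
have [xb|xb] := leP b' x.
  exists a', b'; split=> // y; rewrite inE => /orP [/eqP ->|/h //].
  by rewrite andbC ltNge xb.
exists x, b'; split=> //; first lra.
move=> y; rewrite inE => /orP [/eqP ->|/h yL]; first by rewrite ltxx.
by move=> /andP [h1 h2]; apply: yL; rewrite h2 andbT; lra.
Qed.

Section GaussPath.
Variables (R : realType) (C : fieldType) (N : absval R C).

Lemma gauss_continuous (f : {poly C}) : continuous (fun t : R => gauss N `|t| f).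
Proof.
have pow i : continuous (fun x : R => `|x| ^+ i).
  elim: i => [|i IH] t.
    rewrite (_ : (fun=> _) = fun=> 1); first exact: cst_continuous.
    by apply/funext => x; rewrite expr0.
  rewrite (_ : (fun=> _) = fun x => `|x| * `|x| ^+ i); last first.
    by apply/funext => x; rewrite exprS.
  by apply: continuousM; [exact: norm_continuous|exact: IH].
rewrite /gauss; elim: (index_enum _) => [|i s IH] t.
  rewrite (_ : (fun=> _) = fun=> 0); first exact: cst_continuous.
  by apply/funext => x; rewrite big_nil.
pose g (x : R) := gval N `|x| f i; pose h (x : R) :=
  \big[Num.max/0]_(j <- s) gval N `|x| f j.
(* The maximum in this form is visibly continuous. *)
rewrite (_ : (fun=> _) = fun x => (g x + h x + `|g x - h x|) / 2); last first.
  by apply/funext => x; rewrite big_cons maxr_absE.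
have gc : {for t, continuous g}.
  by apply: continuousM; [exact: cst_continuous|exact: pow].
have hc : {for t, continuous h} by exact: IH.
apply: (@continuousM R R (fun x => g x + h x + `|g x - h x|) (fun=> 2^-1));
  last exact: cst_continuous.
apply: (@continuousD _ _ _ (fun x => g x + h x) (fun x => `|g x - h x|));
  first exact: continuousD.
apply: (@continuous_comp _ _ _ (fun x => g x - h x) Num.norm);
  last exact: norm_continuous.
exact: continuousB.
Qed.

(** The absolute value makes the path total on the real line. *)
Definition gauss_path (t : R) : berk N := gauss_point N (normr_ge0 t).

Lemma gauss_path_continuous : continuous gauss_path.
Proof. by apply: berk_initial_continuous => f; exact: gauss_continuous. Qed.

Lemma gauss_path0 : gauss_path 0 = typeI N 0.
Proof.
apply: berk_eq; apply/funext => f; rewrite /= /typeI_fun horner_coef0 normr0.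
apply/eqP; rewrite eq_le; apply/andP; split.
  apply: gauss_le; first exact: absval_ge0.
  move=> [|i]; first by rewrite /gval expr0 mulr1.
  by rewrite /gval exprS mul0r mulr0 absval_ge0.
by have := gval_le_gauss N 0 f 0; rewrite /gval expr0 mulr1.
Qed.

Lemma berk_le_gauss (zeta : berk N) t f : zeta 'X <= t -> zeta f <= gauss N t f.
Proof.
move=> Xt; have X0 := berk_ge0 zeta 'X.
rewrite -{1}[f]coefK poly_def.
apply: (ultra_sum_le (berk0 zeta) (@berkD_max _ _ _ zeta)); first exact: gauss_ge0.
move=> i _; rewrite berk_monomial; apply: le_trans (gval_le_gauss N t f i).
by rewrite /gval ler_wpM2l ?absval_ge0 // lerXn2r // nnegrE // (le_trans X0).
Qed.

(** A disc is centred at each of its points. Translation does not increase the Gauss norm, and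
    applying this to x and to -x gives equality. *)
Lemma gauss_shift t x : 0 <= t -> N x <= t ->
  pullback ('X + x%:P) (gauss_path t) = gauss_path t.
Proof.
move=> t0 xt.
have shift_le y f : N y <= t -> gauss N t (f \Po ('X + y%:P)) <= gauss N t f.
  move=> yt; have := @berk_le_gauss (pullback ('X + y%:P) (gauss_path t)) t f.
  rewrite /= /pullback_fun /= ger0_norm //; apply.
  rewrite comp_polyX; apply: le_trans (gaussD _ _ _ t0) _.
  rewrite gaussC ge_max yt andbT; apply: gauss_le => // i.
  by rewrite /gval coefX; case: eqP => [->|_];
    rewrite ?absval1 ?absval0 ?mul0r // expr1 mul1r.
apply: berk_eq; apply/funext => f; rewrite /= /pullback_fun /= ger0_norm //.
apply/eqP; rewrite eq_le shift_le //=.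
have := @shift_le (- x) (f \Po ('X + x%:P)); rewrite absvalN => /(_ xt).
rewrite -comp_polyA comp_polyD comp_polyX comp_polyC polyCN.
by rewrite -addrA addNr addr0 comp_polyXr.
Qed.

End GaussPath.

Section FilledJuliaComponent.
Variables (R : realType) (k : finFieldType) (C : fieldType) (N : absval R C).
Variables (gam : {poly k} -> C) (phi : drinfeld gam) (rho : R) (d r p : nat).
Hypotheses (pk : p \in [pchar k]) (pC : p \in [pchar C]).
Hypotheses (phiN : newton N phi rho d) (d0 : (0 < d)%N) (phir : drinfeld_rank
  phi r).
Local Notation q := #|k|.

Let rho0 : 0 < rho. Proof. by case: phiN. Qed.

Lemma newton_gauss_le a t : 0 <= t <= rho -> gauss N t (phi a) <= rho.
Proof.
move=> /andP [t0 trho]; apply: gauss_le => [|i]; first exact: ltW.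
apply: le_trans (newton_le phiN a i).
by rewrite /gval ler_wpM2l ?absval_ge0 // lerXn2r // nnegrE // ltW.
Qed.

Lemma FJ_of_le (zeta : berk N) : zeta 'X <= rho -> FJ_berk phi zeta.
Proof.
move=> h; exists rho => a; rewrite berk_actX.
apply: le_trans (berk_le_gauss _ h) _; apply: newton_gauss_le.
by rewrite lexx ltW.
Qed.

Lemma gauss_path_X (t : R) : 0 <= t -> gauss_path N t 'X <= t.
Proof.
move=> t0; rewrite /= ger0_norm //; apply: gauss_le => // i.
by rewrite /gval coefX; case: eqP => [->|_];
  rewrite ?absval1 ?absval0 ?mul0r // expr1 mul1r.
Qed.

(** The Gauss points of radius at most rho join 0 to the Gauss point of radius rho; translation by x
    fixes that end and moves 0 to x. *)
Lemma FJ0_of_le x : N x <= rho -> FJ0_berk phi (typeI N x).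
Proof.
move=> xrho; have rge0 := ltW rho0.
have h1 : connected_component (FJ_berk phi) (typeI N 0) (gauss_path N rho).
  exists (gauss_path N @` `[0, rho]).
    split.
    - exists 0; last exact: gauss_path0.
      by rewrite /= in_itv /= lexx.
    - move=> _ [t /= + <-]; rewrite in_itv /= => /andP [t0 tr].
      by apply: FJ_of_le; apply: le_trans (gauss_path_X t0) tr.
    - apply: connected_continuous_connected; first exact: segment_connected.
      apply: continuous_subspaceT; exact: gauss_path_continuous.
  by exists rho => //=; rewrite in_itv /= lexx rge0.
have FJx : FJ_berk phi (typeI N x) by apply: FJ_of_le;
  rewrite /= /typeI_fun hornerX.
have := pullback_component (fun z => @FJ_berk_shift _ _ _ _ _ phi x z FJx) h1.
rewrite pullback_typeI !hornerE gauss_shift // => h2.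
by apply: connected_component_trans h1 (connected_component_sym h2).
Qed.

Lemma FJ_X_bounded : exists M, forall zeta : berk N, FJ_berk phi zeta ->
  zeta 'X <= M.
Proof.
have u0 := udisc_gt0 phiN phir; set u := udisc _ _ _ _ in u0.
exists (rho * Num.max 1 (u ^+ 2)^-1) => zeta /(FJ_bound pk pC phiN d0 phir).
rewrite -/u => h; rewrite mulrC -ler_pdivrMr // -/(tau rho zeta) le_max.
have [//|t1] := leP (tau rho zeta) 1; apply/orP; right.
apply: (@le_trans _ _ (tau rho zeta ^+ (q ^ r))).
  rewrite -{1}[tau rho zeta]expr1 ler_weXn2l ?(ltW t1) //.
  by rewrite expn_gt0 (ltnW (finNzRing_gt1 k)).
by rewrite -[_^-1]mul1r ler_pdivlMr ?exprn_gt0 // mulrC.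
Qed.

(** Take f = phi_(T^m) with m so large that, at all radii from t0 > rho on, its monomial of degree
    q^(d m) exceeds the bound M for the filled Julia set. At a radius t without ties the seminorm of
    f is the largest monomial value, so f moves the point out of the set. *)
Lemma FJ_type1_gap x : rho < N x -> exists t, [/\ rho < t, t < N x &
  forall zeta : berk N, FJ_berk phi zeta -> zeta 'X != t].
Proof.
move=> rx; have [M hM] := FJ_X_bounded.
pose t0 := (rho + N x) / 2; have rt0 : rho < t0 by rewrite /t0; lra.
have t0x : t0 < N x by rewrite /t0; lra.
have y1 : 1 < t0 / rho by rewrite ltr_pdivlMr // mul1r.
have [m hm] := expr_unbounded (M / rho) y1.
pose f := phi 'X^m; pose i1 := (q ^ (d * m))%N.
have Xm0 : 'X^m != 0 :> {poly k} by rewrite -size_poly_gt0 size_polyXn.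
have [_ gi1] := phiN.2 _ Xm0; rewrite size_polyXn /= -/i1 -/f in gi1.
have big t : t0 <= t -> M < gval N t f i1.
  move=> tt0; have -> : gval N t f i1 = rho * (t / rho) ^+ i1.
    by rewrite -{1}gi1 /gval -mulrA -exprMn mulrCA divff ?mulr1 // gt_eqF.
  rewrite mulrC -ltr_pdivrMr //; apply: (lt_le_trans hm).
  apply: (@le_trans _ _ ((t0 / rho) ^+ i1)).
    rewrite ler_weXn2l ?(ltW y1) //; apply: (@leq_trans (q ^ m)).
      by apply: ltnW; apply: ltn_expl; exact: finNzRing_gt1.
    by rewrite leq_exp2l ?finNzRing_gt1 // leq_pmull.
  have rge0 := ltW rho0; have t0ge := ltW (lt_trans rho0 rt0).
  by rewrite lerXn2r // ?nnegrE ?ler_pM2r ?invr_gt0 // divr_ge0 // (le_trans t0ge).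
(* Two monomials with a common positive value determine t, since t^(j - i) is a quotient of absolute
   values of coefficients; so only finitely many radii are to be avoided. *)
pose tie (ij : 'I_(size f) * 'I_(size f)) t := [/\ 0 < t, (ij.1 < ij.2)%N,
  0 < gval N t f ij.2 & gval N t f ij.1 = gval N t f ij.2].
have tie_uniq ij t t' : tie ij t -> tie ij t' -> t = t'.
  move=> [tp ij1 g0 gE] [tp' _ g0' gE'].
  have E s : 0 < s -> 0 < gval N s f ij.2 -> gval N s f ij.1 = gval N s f ij.2 ->
      s ^+ (ij.2 - ij.1) = N f`_ij.1 / N f`_ij.2.
    move=> sp gs; rewrite /gval => e; have c0 : 0 < N f`_ij.2.
      by move: gs; rewrite /gval pmulr_lgt0 // exprn_gt0.
    apply: (mulIf (x := s ^+ ij.1)); first by rewrite expf_neq0 // gt_eqF.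
    rewrite -exprD subnK ?(ltnW ij1) // mulrAC e mulrAC divff ?mul1r // gt_eqF //.
  apply/eqP; rewrite -(@eqrXn2 _ (ij.2 - ij.1)) ?subn_gt0 ?(ltW tp) ?(ltW tp') //.
  by rewrite !E.
have /choice [tb tbP] : forall ij, exists t, forall t', tie ij t' -> t' = t.
  move=> ij; have [[t ht]|nt] := pselect (exists t, tie ij t).
    by exists t => t' ht'; exact: tie_uniq ht' ht.
  by exists 0 => t' ht'; case: nt; exists t'.
have [t [t0t tx tL]] := open_interval_avoid (codom tb) t0x.
have tp : 0 < t by apply: lt_trans rho0 (lt_trans rt0 t0t).
have f0 : f != 0.
  apply/eqP => h; move: gi1; rewrite h gval_size ?size_poly0 // => e.
  by move: rho0; rewrite -e ltxx.
exists t; split=> //; first exact: lt_trans rt0 t0t.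
move=> zeta FJz; apply/eqP => zt.
have [i2 [g0 gle glt]] := last_dominant_ex N tp f0.
have isz : (i2 < size f)%N.
  by rewrite ltnNge; apply/negP => /(gval_size N t) h; rewrite h ltxx in g0.
have zf : zeta f = gval N t f i2.
  rewrite (@berk_dominant _ _ _ _ _ i2) zt // => j;
    rewrite neq_ltn => /orP [ji|/glt //].
  rewrite lt_neqAle gle andbT; apply: contraNneq tL => e.
  have jsz := ltn_trans ji isz.
  rewrite (tbP (Ordinal jsz, Ordinal isz) t) ?codom_f //.
have := hM _ (FJ_berk_act 'X^m FJz); rewrite berk_actX -/f zf leNgt => /negP; apply.
exact: lt_le_trans (big _ (ltW t0t)) (gle _).
Qed.

Lemma FJ0_typeI x : FJ0_berk phi (typeI N x) <-> N x <= rho.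
Proof.
split; last exact: FJ0_of_le.
move=> [B [B0 BFJ cB] Bx]; rewrite leNgt; apply/negP =>
  /FJ_type1_gap [t [rt tx gap]].
have : connected ((fun zeta : berk N => zeta 'X) @` B).
  apply: connected_continuous_connected => //.
  by apply: continuous_subspaceT; exact: berk_eval_continuous.
move=> /connected_intervalP int.
have x0im : ((fun zeta : berk N => zeta 'X) @` B) 0.
  by exists (typeI N 0) => //=; rewrite /typeI_fun hornerX absval0.
have xim : ((fun zeta : berk N => zeta 'X) @` B) (N x).
  by exists (typeI N x) => //=; rewrite /typeI_fun hornerX.
have t_in : 0 <= t <= N x by rewrite (ltW tx) (ltW (lt_trans rho0 rt)).
have [z Bz zt] := int _ _ x0im xim t t_in.
by have := gap z (BFJ z Bz); rewrite zt eqxx.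
Qed.

End FilledJuliaComponent.

(** * Drinfeld modules over an algebraically closed field *)

Lemma closed_field_factor (F : fieldType) (f : {poly F}) :
  GRing.closed_field_axiom F ->
  exists rs, f = lead_coef f *: \prod_(z <- rs) ('X - z%:P).
Proof.
move=> clF; elim: {f}(size f) {-2}f (erefl (size f)) => [|n IH] f fn.
  by move/eqP: fn; rewrite size_poly_eq0 => /eqP ->; exists [::];
    rewrite lead_coef0 scale0r.
case: n IH fn => [|n] IH fn.
  have /size_poly1P [c c0 ->] : size f == 1%N by rewrite fn.
  by exists [::]; rewrite big_nil lead_coefC alg_polyC.
have f0 : f != 0 by rewrite -size_poly_gt0 fn.
have lc0 : lead_coef f != 0 by rewrite lead_coef_eq0.
have [x xE] := clF n.+1 (fun i => - f`_i / lead_coef f) isT.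
have fx : root f x.
  rewrite rootE horner_coef fn big_ord_recr /= xE mulr_sumr -big_split /=.
  rewrite big1 // => i _; rewrite -[f`_n.+1]/(f`_n.+2.-1) -fn -lead_coefE.
  by rewrite mulrA mulrCA divff // mulr1 mulNr subrr.
have /factor_theorem [g gE] := fx.
have g0 : g != 0 by apply: contraNneq f0 => h; rewrite gE h mul0r.
have gn : size g = n.+1.
  by move: fn; rewrite gE size_Mmonic ?monicXsubC // size_XsubC addn2 /= => -[].
have [rs rsE] := IH g gn; exists (x :: rs).
rewrite big_cons {1}gE {1}rsE gE lead_coef_Mmonic ?monicXsubC // mulrC.
by rewrite -scalerAr.
Qed.

Section RootsByRadius.
Variables (R : realType) (F : fieldType) (N : absval R F).
Hypothesis clF : GRing.closed_field_axiom F.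

Lemma absval_prod (I : Type) (r : seq I) (G : I -> F) :
  N (\prod_(i <- r) G i) = \prod_(i <- r) N (G i).
Proof. exact: (big_morph _ (absvalM N) (absval1 N)). Qed.

Lemma gauss_prod t (I : Type) (r : seq I) (G : I -> {poly F}) : 0 <= t ->
  gauss N t (\prod_(i <- r) G i) = \prod_(i <- r) gauss N t (G i).
Proof.
move=> t0; apply: (big_morph _ (fun f g => gaussM N f g t0)).
by rewrite -polyC1 gaussC absval1.
Qed.

Lemma gauss_XsubC t z : 0 <= t -> gauss N t ('X - z%:P) = Num.max (N z) t.
Proof.
move=> t0; apply/eqP; rewrite eq_le; apply/andP; split.
  apply: gauss_le => [|i]; first by rewrite le_max t0 orbT.
  rewrite /gval coefB coefX coefC; case: i => [|[|i]] /=.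
  - by rewrite sub0r absvalN expr0 mulr1 le_max lexx.
  - by rewrite subr0 absval1 mul1r expr1 le_max lexx orbT.
  - by rewrite subr0 absval0 mul0r le_max t0 orbT.
rewrite ge_max; apply/andP; split.
  have := gval_le_gauss N t ('X - z%:P) 0.
  by rewrite /gval coefB coefX coefC /= sub0r absvalN expr0 mulr1.
have := gval_le_gauss N t ('X - z%:P) 1.
by rewrite /gval coefB coefX coefC /= subr0 absval1 mul1r expr1.
Qed.

(** Take a root x of least absolute value. The Gauss norm at radius |x| is the product of the
    max(|z|, |x|) = |z| over the roots z, times the leading coefficient, that is |g(0)|. *)
Lemma min_root (g : {poly F}) : (1 < size g)%N ->
  exists x, g.[x] = 0 /\ forall i, N g`_i * N x ^+ i <= N g`_0.
Proof.
move=> g1; have [rs gE] := closed_field_factor g clF.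
have g0 : g != 0 by rewrite -size_poly_gt0 ltnW.
have rs0 : (0 < size rs)%N.
  move: g1; rewrite gE size_scale ?lead_coef_eq0 // size_prod_XsubC //.
have [x xrs xmin] : exists2 x, x \in rs & forall z, z \in rs -> N x <= N z.
  elim: rs rs0 {gE} => // z rs IH _; case: rs IH => [|z' rs] IH.
    by exists z; [rewrite inE|move=> w; rewrite inE => /eqP ->].
  have [//|x xrs xmin] := IH.
  have [zx|xz] := leP (N z) (N x).
    exists z; first by rewrite inE eqxx.
    move=> w; rewrite inE => /orP [/eqP -> //|/xmin]; exact: le_trans.
  exists x; first by rewrite inE xrs orbT.
  by move=> w; rewrite inE => /orP [/eqP ->|/xmin //]; exact: ltW.
exists x; split.
  by rewrite gE hornerZ; have /eqP -> : root (\prod_(z <- rs) ('X - z%:P)) x;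
    rewrite ?root_prod_XsubC // mulr0.
move=> i; have x0 := absval_ge0 N x.
have -> : N g`_0 = gauss N (N x) g; last exact: gval_le_gauss.
rewrite {2}gE -mul_polyC gaussM // gaussC gauss_prod //.
rewrite -horner_coef0 gE hornerZ absvalM; congr (_ * _).
  by rewrite lead_coefZ lead_coef_prod big1 ?mulr1 // => z _;
    rewrite lead_coefXsubC.
rewrite horner_prod absval_prod big_seq [RHS]big_seq; apply: eq_bigr => z zrs.
by rewrite hornerXsubC sub0r absvalN gauss_XsubC //; apply/esym/max_l/xmin.
Qed.

Lemma last_dominantC t c : c != 0 -> last_dominant N t c%:P 0.
Proof.
move=> c0; have E : gval N t c%:P 0 = N c by rewrite /gval coefC expr0 mulr1.
have z j : (0 < j)%N -> gval N t c%:P j = 0.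
  by case: j => // j _; rewrite /gval coefC absval0 mul0r.
split; rewrite E ?absval_gt0 // => -[|j] //;
  rewrite ?E ?z ?absval_gt0 ?absval_ge0 //.
Qed.

Lemma last_dominant_XsubC t z : 0 < t ->
  last_dominant N t ('X - z%:P) (N z <= t)%R.
Proof.
move=> t0.
have E0 : gval N t ('X - z%:P) 0 = N z.
  by rewrite /gval coefB coefX coefC /= sub0r absvalN expr0 mulr1.
have E1 : gval N t ('X - z%:P) 1 = t.
  by rewrite /gval coefB coefX coefC /= subr0 absval1 mul1r expr1.
have E2 j : gval N t ('X - z%:P) j.+2 = 0.
  by rewrite /gval coefB coefX coefC /= subr0 absval0 mul0r.
have [zt|tz] := leP (N z) t; split; rewrite /= ?E0 ?E1 //.
- by move=> [|[|j]]; rewrite ?E0 ?E1 ?E2 // ltW.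
- by move=> [|[|j]]; rewrite ?E0 ?E1 ?E2 // ltW.
- exact: lt_trans t0 tz.
- by move=> [|[|j]]; rewrite ?E0 ?E1 ?E2 // ?absval_ge0 // ltW.
- by move=> [|[|j]]; rewrite ?E0 ?E1 ?E2 // (lt_trans t0).
Qed.

Lemma last_dominant_prod t (rs : seq F) : 0 < t ->
  last_dominant N t (\prod_(z <- rs) ('X - z%:P)) (count (fun z => N z <= t) rs).
Proof.
move=> t0; elim: rs => [|z rs IH].
  by rewrite big_nil -polyC1; apply: last_dominantC; exact: oner_neq0.
rewrite big_cons /=.
by have [] := last_dominantM (ltW t0) (last_dominant_XsubC z t0) IH.
Qed.

End RootsByRadius.

(** * Divisibility and torsion counts over an algebraically closed field *)

Section ClosedDrinfeld.
Variables (R : realType) (k : finFieldType) (L : fieldType) (N : absval R L).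
Variables (gam : {poly k} -> L) (phi : drinfeld gam) (rho : R) (d s : nat).
Hypothesis clL : GRing.closed_field_axiom L.
Hypotheses (phiN : newton N phi rho d) (phir : drinfeld_rank phi (d + s)).
Hypothesis gam0 : forall a, a != 0 -> gam a != 0.
Local Notation q := #|k|.
Local Notation bounded x := (FJ_berk phi (typeI N x)).

Let rho0 : 0 < rho. Proof. by case: phiN. Qed.

Lemma drinfeld_coef0 a : (phi a)`_0 = 0.
Proof. by rewrite drinfeld_lin // (ltn_trans _ (finNzRing_gt1 k)). Qed.

(** The smallest root of phi_a(X) - y, compared with y in degree q^(d deg a), where the monomial has
    size exactly rho. The estimate keeps the disc of radius rho inside its own image, and for large
    deg a it brings preimages close to that radius. *)
Lemma drinfeld_small_preim a y : a != 0 -> exists x,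
  (phi a).[x] = y /\
  (N x / rho) ^+ (q ^ (d * (size a).-1)) <= N y / rho.
Proof.
move=> a0; set i := (q ^ _)%N; have [[gi0 _ _] gi] := phiN.2 a a0.
rewrite -/i in gi gi0.
have i0 : (0 < i)%N by rewrite expn_gt0 (ltnW (finNzRing_gt1 k)).
pose g := phi a - y%:P.
have gE j : (0 < j)%N -> g`_j = (phi a)`_j.
  by move=> j0; rewrite coefB coefC gtn_eqF // subr0.
have [|x [gx xle]] := @min_root R L N clL g.
  apply: (@leq_ltn_trans i) => //; rewrite ltnNge; apply/negP => h.
  by move: gi0; rewrite /gval -gE // nth_default // absval0 mul0r ltxx.
exists x; split.
  by move/eqP: gx; rewrite hornerD hornerN hornerC subr_eq0 => /eqP.
have := xle i; rewrite gE // coefB drinfeld_coef0 coefC sub0r absvalN => h.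
rewrite expr_div_n ler_pdivrMr ?exprn_gt0 // mulrAC ler_pdivlMr //.
by rewrite -{1}gi /gval mulrCA mulrA ler_pM2r ?exprn_gt0.
Qed.

Lemma drinfeld_roots a : a != 0 -> exists rs : seq L,
  [/\ uniq rs, forall x, (x \in rs) = ((phi a).[x] == 0),
      size rs = (q ^ ((d + s) * (size a).-1))%N &
      count (fun z => N z <= rho) rs = (q ^ (d * (size a).-1))%N].
Proof.
move=> a0; have [rs E] := closed_field_factor (phi a) clL; exists rs.
have sz := phir a0.
have phi0 : phi a != 0 by rewrite -size_poly_gt0 sz.
have lc0 : lead_coef (phi a) != 0 by rewrite lead_coef_eq0.
(* Additivity with j = 1 kills i P_i for i > 1; the derivative is thus a nonzero constant and the
   roots are simple. *)
have deriv_c : (phi a)^`() = (gam a)%:P.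
  apply/polyP => i; rewrite coef_deriv coefC; case: i => [|i] /=.
    by rewrite mulr1n drinfeld_lin // finNzRing_gt1.
  have /additive_poly_bin h := drinfeld_additive phi a.
  by have := h i.+2 1%N isT; rewrite bin1.
split.
- rewrite -separable_prod_XsubC.
  have : separable_poly (phi a).
    rewrite unlock deriv_c; apply/Bezout_eq1_coprimepP.
    exists (0, (gam a)^-1%:P); rewrite mul0r add0r -polyCM mulVf ?gam0 //.
  by rewrite {1}E -mul_polyC separable_mul => /and3P [].
- move=> x; rewrite -root_prod_XsubC rootE {1}E hornerZ mulf_eq0 (negPf lc0) //.
- by move: sz; rewrite {1}E size_scale // size_prod_XsubC => -[].
- have [h _] := phiN.2 a a0.
  have h1 := last_dominant_prod N rs rho0.
  have [h2 _] := last_dominantM (ltW rho0) (last_dominantC N rho lc0) h1.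
  by rewrite add0n mul_polyC -E in h2; exact: last_dominant_uniq h2 h.
Qed.

(** Division by a splits phi_b(x) into a point of the orbit of phi_a(x) and one of finitely many
    values phi_c(x) with deg c < deg a. *)
Lemma bounded_preim a x : a != 0 -> bounded (phi a).[x] -> bounded x.
Proof.
move=> a0 [B hB].
pose S := \sum_(v : 'rV[k]_(size a)) N (phi (rVpoly v)).[x].
have S0 : 0 <= S by apply: sumr_ge0 => v _; exact: absval_ge0.
exists (Num.max B S) => b; rewrite berk_actX /= /typeI_fun.
rewrite (divp_eq b a) drinfeldD hornerD; apply: le_trans (absvalD _ _ _) _.
rewrite ge_max !le_max; apply/andP; split.
  apply/orP; left; have := hB (b %/ a)%R.
  by rewrite berk_actX /= /typeI_fun drinfeldM horner_comp.
apply/orP; right.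
have <- : rVpoly (poly_rV (b %% a) : 'rV[k]_(size a)) = b %% a.
  by rewrite poly_rV_K // ltnW // ltn_modp.
rewrite /S (bigD1 (poly_rV (b %% a))) //= lerDl; apply: sumr_ge0 => v _.
exact: absval_ge0.
Qed.

Variables (M : lmodType {poly k}) (cl : L -> M).
Hypothesis clP : forall a x y, bounded x -> bounded y ->
  cl ((phi a).[x] + y) = a *: cl x + cl y.
Hypothesis cl0 : forall x, bounded x -> (cl x = 0 <-> N x <= rho).
Hypothesis cl_surj : forall z, exists x, bounded x /\ cl x = z.

Let bounded0 : bounded 0. Proof. exact: FJ_typeI0. Qed.

Lemma cl_0 : cl 0 = 0.
Proof. by apply/cl0 => //; rewrite absval0 ltW. Qed.

Lemma clZ a x : bounded x -> cl (phi a).[x] = a *: cl x.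
Proof. by move=> bx; rewrite -[LHS]/(cl _) -[(phi a).[x]]addr0 clP // cl_0
  addr0. Qed.

Lemma boundedZ a x : bounded x -> bounded (phi a).[x].
Proof. by move=> bx; rewrite -[(phi a).[x]]addr0; exact: FJ_closed. Qed.

Lemma boundedB x y : bounded x -> bounded y -> bounded (x - y).
Proof.
move=> bx by_; rewrite addrC; have -> : - y = (phi (-1)).[y].
  apply: (addrI (phi 1).[y]); rewrite -hornerD -drinfeldD subrr drinfeld0 horner0.
  by rewrite drinfeld1 hornerX subrr.
exact: FJ_closed.
Qed.

Lemma clB x y : bounded x -> bounded y -> cl (x - y) = cl x - cl y.
Proof.
move=> bx by_; rewrite addrC; have -> : - y = (phi (-1)).[y].
  apply: (addrI (phi 1).[y]); rewrite -hornerD -drinfeldD subrr drinfeld0 horner0.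
  by rewrite drinfeld1 hornerX subrr.
by rewrite clP // scaleN1r addrC.
Qed.

Lemma cl_divisible (a : {poly k}) (z : M) : a != 0 -> exists w : M, a *: w = z.
Proof.
move=> a0; have [y [byy <-]] := cl_surj z.
have [x [xy _]] := drinfeld_small_preim y a0.
have bx : bounded x by apply: (bounded_preim a0); rewrite xy.
by exists (cl x); rewrite -clZ // xy.
Qed.

Lemma cl_torsion_card (a : {poly k}) : a != 0 -> torsion_card s M a.
Proof.
move=> a0; have [rs [urs mrs srs crs]] := drinfeld_roots a0.
have q0 m : (0 < q ^ m)%N by rewrite expn_gt0 (ltnW (finNzRing_gt1 k)).
have brs x : x \in rs -> bounded x.
  by rewrite mrs => /eqP h; apply: (bounded_preim a0); rewrite h.
pose l := undup (map cl rs); exists l.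
have rsB x y : x \in rs -> y \in rs -> x - y \in rs.
  move=> xr yr; rewrite mrs; have := mrs x; have := mrs y; rewrite xr yr.
  move=> /esym /eqP hy /esym /eqP hx.
  have : (phi a).[x - y + y] = 0 by rewrite subrK.
  by rewrite additive_polyD ?hy ?addr0; [move=> ->|exact: drinfeld_additive].
(* Translation by -x1 permutes the roots and carries the fibre through x1 onto the roots in the
   disc, so all fibres have the same size. *)
have fib z : z \in l -> count (fun x => cl x == z) rs = (q ^ (d * (size a).-1))%N.
  rewrite mem_undup => /mapP [x1 x1r ->]; rewrite -crs.
  have pm : perm_eq (map (fun x => x - x1) rs) rs.
    apply: uniq_perm => //.
      by rewrite map_inj_uniq // => x y; exact: addIr.
    move=> x; apply/mapP/idP => [[y yr ->]|xr]; first exact: rsB.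
    exists (x + x1); last by rewrite addrK.
    rewrite -[x1]opprK; apply: (rsB) => //; rewrite -sub0r; apply: (rsB) => //.
    by rewrite mrs drinfeld_horner0.
  rewrite -(permP pm (fun z => N z <= rho)) count_map.
  apply: eq_in_count => x xr /=; apply/eqP/idP => h.
    have bxx : bounded (x - x1) by apply: boundedB; exact: brs.
    by apply: (cl0 bxx).1; rewrite clB ?h ?subrr //; exact: brs.
  apply/eqP; rewrite -subr_eq0 -clB; try exact: brs.
  have bxx : bounded (x - x1) by apply: boundedB; exact: brs.
  by apply/eqP; exact: (cl0 bxx).2.
split; first exact: undup_uniq.
- move=> z; rewrite mem_undup; apply/mapP/eqP => [[x xr ->]|].
    have bx := brs x xr; move: xr; rewrite mrs => /eqP ax.
    by rewrite -clZ // ax cl_0.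
  (* If a kills the class of x, then phi_a(x) has a preimage x0 in the disc, and x - x0 is a root in
     the class of x. *)
  have [x [bx <-]] := cl_surj z; rewrite -clZ // => /cl0 h.
  have yrho : N (phi a).[x] <= rho by apply: h; exact: boundedZ.
  have [x0 [x0y x0le]] := drinfeld_small_preim (phi a).[x] a0.
  have x0rho : N x0 <= rho.
    rewrite -[rho]mul1r -ler_pdivrMr //.
    rewrite -(@expr_le1 _ (q ^ (d * (size a).-1))) ?q0 //; last first.
      by rewrite divr_ge0 ?absval_ge0 // ltW.
    by apply: le_trans x0le _; rewrite ler_pdivrMr // mul1r.
  have bx0 : bounded x0 by apply: (FJ_of_le phiN); rewrite /= /typeI_fun hornerX.
  exists (x - x0).
    have : (phi a).[x - x0 + x0] = (phi a).[x] by rewrite subrK.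
    rewrite additive_polyD; last exact: drinfeld_additive.
    by rewrite x0y mrs => /eqP; rewrite -subr_eq0 addrK.
  rewrite clB //; have -> : cl x0 = 0 by apply/cl0.
  by rewrite subr0.
- apply/eqP; rewrite -(eqn_pmul2r (q0 (d * (size a).-1)%N)) -expnD -mulnDl.
  rewrite [(s + d)%N]addnC -srs; apply/eqP.
  have -> : size rs = (\sum_(x <- rs) \sum_(z <- l) (cl x == z))%N.
    rewrite -sum1_size big_seq [RHS]big_seq; apply: eq_bigr => x xr.
    have xl : cl x \in l by rewrite mem_undup map_f.
    rewrite (bigD1_seq (cl x)) ?undup_uniq //= eqxx big1 // => z /negPf.
    by rewrite eq_sym => ->.
  rewrite exchange_big /= big_seq (eq_bigr (fun=> (q ^ (d * (size a).-1))%N)).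
    by rewrite -big_seq big_const_seq count_predT iter_addn_0 mulnC.
  by move=> z zl; rewrite -(fib z zl) -sum1_count [RHS]big_mkcond /=;
    apply: eq_bigr => x _; case: eqP.
Qed.

End ClosedDrinfeld.

(** * Total boundedness *)

(* N is discrete with uniformizer pi, and its residue field is finite. *)
Definition finite_residue (R : realType) (F : fieldType) (N : absval R F) : Prop :=
  exists (pi : F) (S : seq F), [/\ 0 < N pi, N pi < 1,
    forall x, N x < 1 -> N x <= N pi &
    forall x, N x <= 1 -> exists2 y, y \in S & N (x - y) <= N pi].

Section FinitePlace.
Variables (R : realType) (k : finFieldType) (N : absval R {fraction {poly k}}).
Hypothesis finN : is_finite_place N.
Local Notation n a := (N (tofrac a)).
Implicit Types a b f g : {poly k}.

Lemma place_poly_le1 a : n a <= 1.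
Proof.
rewrite -[a]coefK poly_def rmorph_sum /=.
apply: (ultra_sum_le (absval0 N) (absvalD N)) => // i _.
rewrite -mul_polyC rmorphM rmorphXn /= absvalM absvalX.
apply: mulr_ile1; rewrite ?absval_ge0 ?exprn_ge0 ?absval_ge0 //; last first.
  by apply: exprn_ile1; [exact: absval_ge0|case: finN].
(* A constant c satisfies c^q = c, which excludes |c| > 1. *)
have E : n (a`_i)%:P ^+ #|k| = n (a`_i)%:P.
  by rewrite -absvalX -rmorphXn /= -polyC_exp expf_card.
rewrite leNgt; apply/negP => h.
have : n (a`_i)%:P ^+ 1 < n (a`_i)%:P ^+ #|k|.
  by rewrite ltr_eXn2l // finNzRing_gt1.
by rewrite expr1 E ltxx.
Qed.

(** A polynomial P of least degree among the nonzero ones with |P| < 1 divides all polynomials of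
    absolute value below 1. It is a uniformizer, and remainders modulo P represent the residue
    field. *)
Lemma finite_place_residue : finite_residue N.
Proof.
have le1 := place_poly_le1.
have [f [f0 nf]] : exists f, f != 0 /\ n f < 1.
  apply: contrapT => H; have n1 a : a != 0 -> n a = 1.
    move=> a0; apply/eqP; rewrite eq_le le1 /= leNgt; apply/negP => h.
    by apply: H; exists a.
  have [[x [x0 /eqP nx1]] _] := finN; apply: nx1.
  have [u [v [v0 xE]]] := ratfunP x.
  have u0 : u != 0 by apply: contraNneq x0 => h; rewrite xE h rmorph0 mul0r.
  by rewrite xE absvalM absvalV !n1 // divr1.
have [P [P0 [nP Pmin]]] : exists P, P != 0 /\ n P < 1 /\
    forall f, f != 0 -> n f < 1 -> (size P <= size f)%N.
  have ex : exists m, `[< exists f, [/\ size f = m, f != 0 & n f < 1] >].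
    by exists (size f); apply/asboolP; exists f.
  have [m /asboolP [P [Pm P0 nP]] mmin] := ex_minnP ex.
  exists P; split=> //; split=> // g g0 ng; rewrite Pm; apply: mmin.
  by apply/asboolP; exists g.
have Pgt0 : 0 < n P by rewrite absval_gt0 tofrac_eq0.
have Psz : (1 < size P)%N.
  rewrite ltnNge; apply/negP => h.
  have /size_poly1P [c c0 PE] : size P == 1%N by rewrite eqn_leq h size_poly_gt0.
  have : n (P * c^-1%:P) = 1 by rewrite PE -polyCM mulfV // rmorph1 absval1.
  rewrite rmorphM absvalM => e; move: nP; rewrite ltNge -e => /negP; apply.
  by rewrite ler_piMr ?absval_ge0 ?le1.
have Pdvd g : n g < 1 -> P %| g.
  move=> ng; have E : g %% P =
    g - g %/ P * P by rewrite {2}(divp_eq g P) addrC addKr.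
  have nr : n (g %% P) < 1.
    rewrite E rmorphB rmorphM /=; apply: le_lt_trans (absvalD _ _ _) _.
    rewrite absvalN absvalM gt_max ng /=; apply: le_lt_trans nP.
    by rewrite ler_piMl ?absval_ge0 ?le1.
  rewrite /dvdp; apply: contraT => r0; have := Pmin _ r0 nr.
  by rewrite leqNgt ltn_modp P0.
have fact g : g != 0 -> exists i g', [/\ g = P ^+ i * g', g' != 0 & n g' = 1].
  elim/ltn_ind: (size g) {-2}g (erefl (size g)) => m IH {}g gm g0.
  have [ng|ng] := ltP (n g) 1; last first.
    by exists 0, g; rewrite expr0 mul1r; split=> //; apply/eqP; rewrite eq_le le1.
  have /dvdpP [g1 gE] := Pdvd g ng.
  have g10 : g1 != 0 by apply: contraNneq g0 => h; rewrite gE h mul0r.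
  have lt1 : (size g1 < m)%N.
    rewrite -gm gE size_mul // -subn1 -addnBA ?size_poly_gt0 // -[X in (X <
      _)%N]addn0.
    by rewrite ltn_add2l subn_gt0.
  have [i [g' [g1E g'0 ng']]] := IH _ lt1 g1 (erefl _) g10.
  by exists i.+1, g'; split=> //; rewrite gE g1E exprSr mulrAC.
have decomp x : x != 0 -> exists i j u v, [/\ x =
  tofrac P ^+ i * tofrac u / (tofrac P ^+ j * tofrac v),
    v != 0, n u = 1 & n v = 1] /\ N x = n P ^+ i / n P ^+ j.
  move=> x0; have [u [v [v0 xE]]] := ratfunP x.
  have u0 : u != 0 by apply: contraNneq x0 => h; rewrite xE h rmorph0 mul0r.
  have [i [u' [uE u'0 nu']]] := fact u u0; have [j [v' [vE v'0 nv']]] := fact v v0.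
  exists i, j, u', v'; split.
    by split=> //; rewrite xE uE vE !rmorphM !rmorphXn.
  by rewrite xE uE vE !rmorphM !rmorphXn /= absvalM absvalV !absvalM nu' nv'
    !mulr1 !absvalX.
pose pi := tofrac P.
exists pi, [seq tofrac (rVpoly v) | v : 'rV[k]_(size P)]; split=> //.
- move=> x nx; have [->|x0] := eqVneq x 0; first by rewrite absval0 ltW.
  have [i [j [u [v [_ E]]]]] := decomp x x0.
  move: nx; rewrite E => h.
  have ij : (j < i)%N.
    rewrite ltnNge; apply/negP => ij; move: h; rewrite ltNge => /negP; apply.
    by rewrite ler_pdivlMr ?exprn_gt0 // mul1r ler_wiXn2l // ltW.
  rewrite ler_pdivrMr ?exprn_gt0 // -exprS; apply: ler_wiXn2l => //; exact: ltW.
- move=> x nx; have memS g : exists2 y,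
    y \in [seq tofrac (rVpoly v) | v : 'rV[k]_(size P)] & N (tofrac g - y) <= N pi.
    exists (tofrac (g %% P)).
      apply/mapP; exists (poly_rV (g %% P)); first by rewrite mem_enum.
      by rewrite poly_rV_K // ltnW // ltn_modp.
    rewrite -rmorphB {1}(divp_eq g P) addrK rmorphM absvalM.
    by rewrite ler_piMl ?absval_ge0 ?le1.
  have [->|x0] := eqVneq x 0.
    by have := memS 0; rewrite rmorph0.
  have [i [j [u [v [[xE v0 nu nv] E]]]]] := decomp x x0.
  have ij : (j <= i)%N.
    rewrite leqNgt; apply/negP => ij; move: nx; rewrite E leNgt => /negP; apply.
    rewrite ltr_pdivlMr ?exprn_gt0 // mul1r ltr_iXn2l //.
  pose h := P ^+ (i - j) * u.
  have xE' : x = tofrac h / tofrac v.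
    rewrite xE /h -[in LHS](subnK ij) exprD.
    have p0 : tofrac P ^+ j != 0 by apply: expf_neq0; rewrite tofrac_eq0.
    by rewrite mulrAC [X in _ / X]mulrC -mulf_div divff // mulr1 rmorphM
      rmorphXn mulrAC.
  (* A common divisor D has |D| = 1 because |v| = 1, so the cofactor of D in P is again small, and
     minimality of P makes D constant. Then w1 inverts v modulo P. *)
  have /Bezout_eq1_coprimepP [[w1 w2] /= bez] : coprimep v P.
    rewrite /coprimep; set D := gcdp v P.
    have /dvdpP [v' vE] : D %| v by exact: dvdp_gcdl.
    have /dvdpP [P' PE] : D %| P by exact: dvdp_gcdr.
    have D0 : D != 0 by apply: contraNneq P0 => e; rewrite PE e mulr0.
    have nD : n D = 1.
      apply/eqP; rewrite eq_le le1 /= -nv vE rmorphM absvalM.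
      by rewrite ler_piMl ?absval_ge0 ?le1.
    have P'0 : P' != 0 by apply: contraNneq P0 => e; rewrite PE e mul0r.
    have nP' : n P' < 1 by move: nP; rewrite PE rmorphM absvalM nD mulr1.
    have := Pmin P' P'0 nP'.
    rewrite PE size_mul // => hh.
    rewrite eqn_leq size_poly_gt0 D0 andbT -(leq_add2l (size P')) addn1.
    by rewrite -[(_ + _)%N]prednK ?addn_gt0 ?size_poly_gt0 ?P'0 // ltnS.
  have [y yS hy] := memS (w1 * h).
  exists y => //; have -> : x - y = (x - tofrac (w1 * h)) + (tofrac (w1 * h) - y).
    by rewrite addrA subrK.
  apply: le_trans (absvalD _ _ _) _; rewrite ge_max hy andbT.
  have v1 : tofrac v != 0 by rewrite tofrac_eq0.
  have -> : x - tofrac (w1 * h) = tofrac (h * w2) * pi / tofrac v.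
    apply: (mulIf v1); rewrite mulrBl xE' !divfK // -!rmorphM -rmorphB;
      congr tofrac.
    by transitivity (h * (w1 * v + w2 * P) - w1 * h * v); [rewrite bez mulr1|ring].
  by rewrite absvalM absvalV nv invr1 mulr1 absvalM ler_piMl ?absval_ge0 ?le1.
Qed.

End FinitePlace.

Lemma completion_residue (R : realType) (F E : fieldType) (j : {rmorphism F -> E})
    (NF : absval R F) (NE : absval R E) :
  is_completion j NF NE -> finite_residue NF -> finite_residue NE.
Proof.
move=> [ext _ dense] [pi [S [pi0 pi1 disc res]]].
exists (j pi), (map j S); rewrite !ext; split=> //.
- move=> x nx; have [y hy] := dense x (NF pi) pi0.
  have -> : x = (x - j y) + j y by rewrite subrK.
  apply: le_trans (absvalD _ _ _) _; rewrite ge_max (ltW hy) /= ext disc //.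
  rewrite -ext; have -> : j y = x - (x - j y) by rewrite opprB addrC subrK.
  apply: le_lt_trans (absvalD _ _ _) _; rewrite absvalN gt_max nx /=.
  exact: lt_trans hy pi1.
- move=> x nx; have [y hy] := dense x (NF pi) pi0.
  have ny : NF y <= 1.
    rewrite -ext; have -> : j y = x - (x - j y) by rewrite opprB addrC subrK.
    apply: le_trans (absvalD _ _ _) _; rewrite absvalN ge_max nx /=.
    exact: ltW (lt_trans hy pi1).
  have [z zS hz] := res y ny; exists (j z); first exact: map_f.
  have -> : x - j z = (x - j y) + j (y - z) by rewrite rmorphB addrA subrK.
  by apply: le_trans (absvalD _ _ _) _; rewrite ge_max (ltW hy) ext.
Qed.

(** * Finite nets in bounded parts of finite-dimensional spaces *)

Section SpanNet.
Variables (R : realType) (F E : fieldType) (j : {rmorphism F -> E}).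
Variables (NF : absval R F) (NE : absval R E).
Hypothesis ext : absval_extends j NF NE.
Variables (I : finType) (W : I -> E).
Implicit Types (xs : seq E) (a : nat -> F).

Definition in_span (y : E) := exists c : I -> F, y = \sum_i j (c i) * W i.

Lemma in_spanB x y : in_span x -> in_span y -> in_span (x - y).
Proof.
move=> [c ->] [c' ->]; exists (fun i => c i - c' i).
by rewrite -sumrB; apply: eq_bigr => i _; rewrite rmorphB mulrBl.
Qed.

Lemma in_spanD x y : in_span x -> in_span y -> in_span (x + y).
Proof.
move=> [c ->] [c' ->]; exists (fun i => c i + c' i).
by rewrite -big_split; apply: eq_bigr => i _; rewrite rmorphD mulrDl.
Qed.

Lemma in_spanZ (a : F) x : in_span x -> in_span (j a * x).
Proof.
move=> [c ->]; exists (fun i => a * c i).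
by rewrite mulr_sumr; apply: eq_bigr => i _; rewrite rmorphM mulrA.
Qed.

Lemma in_span0 : in_span 0.
Proof. by exists (fun=> 0); rewrite big1 // => i _; rewrite rmorph0 mul0r. Qed.

(** Coefficients are indexed by all natural numbers, so that the same [a] serves a family and its
    extension by one vector. *)
Definition seqcomb xs a : E := \sum_(i < size xs) j (a i) * xs`_i.

Lemma in_span_seqcomb xs a : (forall x, x \in xs -> in_span x) ->
  in_span (seqcomb xs a).
Proof.
move=> h; apply: (big_ind in_span); [exact: in_span0|exact: in_spanD|].
by move=> i _; apply: in_spanZ; apply: h; exact: mem_nth.
Qed.

Lemma span_dependent xs : (forall x, x \in xs -> in_span x) -> (#|I| < size xs)%N ->
  exists a, seqcomb xs a = 0 /\ exists2 i, (i < size xs)%N & a i != 0.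
Proof.
move=> xsW ltI; have /choice [c cE] : forall i : 'I_(size xs), exists c : I -> F,
    xs`_i = \sum_w j (c w) * W w by move=> i; apply: xsW; exact: mem_nth.
pose C := \matrix_(i < size xs, w < #|I|) c i (enum_val w).
have : kermx C != 0.
  rewrite -mxrank_eq0 mxrank_ker -lt0n subn_gt0.
  exact: leq_ltn_trans (rank_leq_col C) ltI.
move=> /rowV0Pn [u /sub_kermxP uC u0].
exists (fun i => if insub i is Some i' then u 0 i' else 0).
have aE (i : 'I_(size xs)) : (if insub (i : nat) is Some i' then u 0 i' else 0)
  = u 0 i.
  by rewrite valK.
split; last first.
  have /rV0Pn [i ui] := u0; exists i => //; by rewrite aE.
rewrite /seqcomb (eq_bigr (fun i => \sum_w j (u 0 i * c i w) * W w)); last first.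
  move=> i _; rewrite aE cE mulr_sumr; apply: eq_bigr => w _.
  by rewrite rmorphM mulrA.
rewrite exchange_big big1 // => w _; rewrite -mulr_suml -rmorph_sum.
have -> : \sum_i u 0 i * c i w = (u *m C) 0 (enum_rank w).
  by rewrite mxE; apply: eq_bigr => i _; rewrite mxE enum_rankK.
by rewrite uC mxE rmorph0 mul0r.
Qed.

Variables (pi : F) (S : seq F).
Hypotheses (pi0 : 0 < NF pi) (pi1 : NF pi < 1).
Hypothesis disc : forall x, NF x < 1 -> NF x <= NF pi.
Hypothesis res : forall x, NF x <= 1 -> exists2 y, y \in S & NF (x - y) <= NF pi.

Let sumE := ultra_sum_le (absval0 NE) (absvalD NE).

(* The ball B of radius r in a space of dimension n: a family in B which is
   linearly independent modulo pi B over the residue field has size at most n,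
   and a maximal one generates B / pi B, which is therefore finite. *)
Lemma span_net_step r : 0 < r -> exists Net : seq E, forall y, in_span y ->
  NE y <= r ->
  exists l, [/\ l \in Net, in_span l & NE (y - l) <= NF pi * r].
Proof.
move=> r0; pose good xs := (forall x, x \in xs -> in_span x /\ NE x <= r) /\
  forall a, (forall i, NF (a i) <= 1) -> NE (seqcomb xs a) <= NF pi * r ->
    forall i, (i < size xs)%N -> NF (a i) < 1.
have good_le xs : good xs -> (size xs <= #|I|)%N.
  move=> [xsW free]; rewrite leqNgt; apply/negP.
  move=> /(span_dependent (fun x xx => (xsW x xx).1)) [a [a0 [i1 i1s ai1]]].
  have [i0 _ i0max] := @arg_maxP _ _ _ (Ordinal i1s) predT (fun i : 'I_(size xs)
    => NF (a i)) isT.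
  have ai0 : 0 < NF (a i0).
    by apply: lt_le_trans (i0max (Ordinal i1s) isT); rewrite absval_gt0.
  (* Dividing a linear relation by its largest coefficient gives an integral one with a coefficient
     1, against independence modulo pi. *)
  pose b i := if (i < size xs)%N then a i / a i0 else 0.
  have b1 i : NF (b i) <= 1.
    rewrite /b; case: ifP => ilt; last by rewrite absval0.
    rewrite absvalM absvalV ler_pdivrMr // mul1r.
    exact: (i0max (Ordinal ilt)).
  have : NE (seqcomb xs b) <= NF pi * r.
    have -> : seqcomb xs b = j (a i0)^-1 * seqcomb xs a.
      rewrite mulr_sumr; apply: eq_bigr => i _; rewrite /b ltn_ord rmorphM /=.
      by rewrite mulrA [j (a i0)^-1 * _]mulrC.
    by rewrite a0 mulr0 absval0 mulr_ge0 // ltW.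
  move=> /(free b b1) /(_ i0 (ltn_ord i0)).
  by rewrite /b ltn_ord divff ?absval1 ?ltxx // -(absval_gt0 NF).
have ex0 : exists m, `[< exists xs, size xs = m /\ good xs >].
  exists 0%N; apply/asboolP; exists [::]; split=> //; split=> //.
have bnd m : `[< exists xs, size xs = m /\ good xs >] -> (m <= #|I|)%N.
  by move=> /asboolP [xs [<- /good_le]].
have [m /asboolP [xs [xsm gxs]] mmax] := ex_maxnP ex0 bnd.
have [xsW free] := gxs.
exists [seq seqcomb xs (fun i => if insub i is Some i' then S`_(f i') else 0) |
   f : {ffun 'I_(size xs) -> 'I_(size S)}] => y yW yr.
have : ~ good (rcons xs y).
  move=> g; have : (m.+1 <= m)%N.
    by apply: mmax; apply/asboolP; exists (rcons xs y); rewrite size_rcons xsm.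
  by rewrite ltnn.
have rconsE a : seqcomb (rcons xs y) a = seqcomb xs a + j (a (size xs)) * y.
  rewrite /seqcomb size_rcons big_ord_recr /= nth_rcons ltnn eqxx; congr (_ + _).
  by apply: eq_bigr => i _; rewrite nth_rcons ltn_ord.
move=> /not_andP [|].
  move=> H; case: H => x; rewrite mem_rcons inE => /orP [/eqP ->|/xsW //]; by split.
move=> /existsNP [a /not_implyP [a1 /not_implyP [alt /existsNP [i /not_implyP
  [ilt /negP]]]]].
rewrite -leNgt => ai; rewrite rconsE in alt.
(* The coefficient of y is a unit, since otherwise its term is within the allowed error and the
   relation already violates the independence of xs. One can thus solve for y and then round the
   coefficients to S. *)
have NS : NF (a (size xs)) = 1.
  apply/eqP; rewrite eq_le a1 leNgt; apply/negP => h.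
  have aS : NE (seqcomb xs a) <= NF pi * r.
    have -> : seqcomb xs a = seqcomb xs a + j (a (size xs)) * y - j (a (size
      xs)) * y by rewrite addrK.
    apply: absval_sub => //; rewrite absvalM ext.
    by rewrite ler_pM ?absval_ge0 // disc.
  move: ilt; rewrite size_rcons ltnS leq_eqVlt => /orP [/eqP iE|ilt].
    by move: h; rewrite -iE ltNge ai.
  by have := free a a1 aS i ilt; rewrite ltNge ai.
have b0 : a (size xs) != 0 by rewrite -(absval_gt0 NF) NS.
pose c l := - a l / a (size xs).
have c1 l : NF (c l) <= 1 by rewrite /c absvalM absvalN absvalV NS invr1 mulr1.
have cy : NE (y - seqcomb xs c) <= NF pi * r.
  have -> : y - seqcomb xs c =
    j (a (size xs))^-1 * (seqcomb xs a + j (a (size xs)) * y).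
    rewrite mulrDr mulrA -rmorphM mulVf // rmorph1 mul1r [in RHS]addrC;
      congr (_ + _).
    rewrite mulr_sumr -sumrN; apply: eq_bigr => l _.
    by rewrite /c mulNr rmorphN mulNr opprK rmorphM mulrA; congr (_ * _);
      exact: mulrC.
  by rewrite absvalM ext absvalV NS invr1 mul1r.
have /choice [f fP] : forall i, exists f : 'I_(size S), NF (c i - S`_f) <= NF pi.
  move=> l; have [z zS hz] := res (c1 l).
  have zlt : (index z S < size S)%N by rewrite index_mem.
  by exists (Ordinal zlt); rewrite /= nth_index.
pose ff := [ffun i : 'I_(size xs) => f i].
pose g i := if insub i is Some i' then S`_(ff i') else 0.
exists (seqcomb xs g); split.
- by apply/mapP; exists ff; rewrite ?mem_enum.
- by apply: in_span_seqcomb => x /xsW [].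
have -> : y - seqcomb xs g = (y - seqcomb xs c) + (seqcomb xs c - seqcomb xs g).
  by rewrite addrA subrK.
apply: le_trans (absvalD _ _ _) _; rewrite ge_max cy /=.
rewrite -sumrB; apply: sumE; first by rewrite mulr_ge0 // ltW.
move=> l _; rewrite -mulrBl -rmorphB absvalM ext /g valK ffunE.
apply: ler_pM; rewrite ?absval_ge0 // ?fP //.
by have [] := xsW xs`_l (mem_nth _ (ltn_ord l)).
Qed.

Lemma span_net m r : 0 < r -> exists Net : seq E, forall y, in_span y -> NE y <=
  r ->
  exists2 l, l \in Net & NE (y - l) <= NF pi ^+ m * r.
Proof.
elim: m r => [|m IH] r r0.
  exists [:: 0] => y _ yr; exists 0; first by rewrite inE.
  by rewrite subr0 expr0 mul1r.
have [Net hNet] := span_net_step r0.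
have [Net' hNet'] := IH _ (mulr_gt0 pi0 r0).
exists [seq l + l' | l <- Net, l' <- Net'] => y yW yr.
have [l [lN lW hl]] := hNet y yW yr.
have [l' l'N hl'] := hNet' _ (in_spanB yW lW) hl.
exists (l + l'); first exact: allpairs_f.
by rewrite opprD addrA exprSr -mulrA.
Qed.

End SpanNet.

Lemma bounded_sequence_close (R : realType) (F E : fieldType) (j : {rmorphism F
  -> E})
    (NF : absval R F) (NE : absval R E) (I : finType) (W : I -> E) (u : nat ->
      E) (r e : R) :
  absval_extends j NF NE -> finite_residue NF -> 0 < e ->
  (forall n, in_span j W (u n)) -> (forall n, NE (u n) <= r) ->
  exists n m, (n < m)%N /\ NE (u m - u n) <= e.
Proof.
move=> ext [pi [S [pi0 pi1 disc res]]] e0 uW ur.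
have r1 : 0 < Num.max r 1 by rewrite lt_max ltr01 orbT.
have piV : 1 < (NF pi)^-1 by rewrite invf_gt1.
have [m hm] := expr_unbounded (Num.max r 1 / e) piV.
have [Net hNet] := span_net ext W pi0 disc res m r1.
have /choice [f fP] : forall n, exists f : 'I_(size Net), NE (u n - Net`_f) <= e.
  move=> n; have [|l lN hl] := hNet (u n) (uW n); first by rewrite le_max ur.
  have llt : (index l Net < size Net)%N by rewrite index_mem.
  exists (Ordinal llt); rewrite /= nth_index //; apply: le_trans hl _.
  move: hm; rewrite ltr_pdivrMr // exprVn mulrC ltr_pdivlMr ?exprn_gt0 //.
  by rewrite mulrC => /ltW.
have /injectivePn [i1 [i2 i12 fE]] :
    ~~ injectiveb (fun i : 'I_(size Net).+1 => f i).
  by apply/injectiveP => /leq_card; rewrite !card_ord ltnn.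
have close n n' : f n = f n' -> NE (u n - u n') <= e.
  move=> fnn; have -> : u n - u n' = (u n - Net`_(f n)) - (u n' - Net`_(f n')).
    by rewrite fnn opprB addrA subrK.
  by apply: absval_sub; exact: fP.
case: (ltngtP i1 i2) => [h|h|h].
- by exists i1, i2; split=> //; apply: close; rewrite fE.
- by exists i2, i1; split=> //; apply: close.
- by case/eqP: i12; apply: val_inj.
Qed.

(** Finitely many powers of x, times a basis of L_v over K_v, span all values g(x). A whole orbit of
    x thus stays in one finite-dimensional K_v-space. *)
Lemma algebraic_in_span (Kv : fieldType) (Lv : fieldExtType Kv)
    (E : fieldType) (iL : {rmorphism Lv -> E}) (x : E) :
  algebraicOver iL x -> exists (I : finType) (W : I -> E),
    forall g : {poly Lv}, in_span (iL \o in_alg Lv) W (map_poly iL g).[x].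
Proof.
move=> [p p0 px]; pose D := \dim {: Lv}%VS.
exists ('I_(size p) * 'I_D)%type, (fun ij : 'I_(size p) * 'I_D =>
  iL (vbasis {: Lv}%VS)`_(ij.2) * x ^+ ij.1) => g.
exists (fun ij : 'I_(size p) * 'I_D =>
  coord (vbasis {: Lv}%VS) ij.2 (g %% p)`_(ij.1)).
have -> : (map_poly iL g).[x] = (map_poly iL (g %% p)).[x].
  rewrite {1}(divp_eq g p) rmorphD rmorphM hornerD hornerM.
  by move/eqP: px => ->; rewrite mulr0 add0r.
rewrite -(pair_big predT predT (fun (i : 'I_(size p)) (l : 'I_D) =>
  iL (in_alg Lv (coord (vbasis {: Lv}%VS) l (g %% p)`_i)) * (iL (vbasis {:
    Lv}%VS)`_l * x ^+ i))) /=.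
rewrite (@horner_coef_wide _ (size p));
  last by rewrite size_map_poly ltnW // ltn_modp.
apply: eq_bigr => i _; rewrite coef_map /= {1}(coord_vbasis (memvf (g %% p)`_i)).
rewrite rmorph_sum mulr_suml; apply: eq_bigr => l _.
by rewrite mulrA -rmorphM mulr_algl.
Qed.

(** * Stable reduction and the quotient modules *)

Lemma coef_comp_scaleX (F : fieldType) (P : {poly F}) c i :
  (P \Po (c *: 'X))`_i = P`_i * c ^+ i.
Proof.
rewrite comp_polyE coef_sum.
have term (l : 'I_(size P)) : (P`_l *: (c *: 'X) ^+ l)`_i =
  if l == i :> nat then P`_i * c ^+ i else 0.
  rewrite coefZ exprZn coefZ coefXn eq_sym; case: eqP => [->|_];
    first by rewrite mulr1.
  by rewrite !mulr0.
rewrite (eq_bigr _ (fun l _ => term l)).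
have [Pi|iP] := leqP (size P) i.
  rewrite nth_default // mul0r big1 // => l _.
  by rewrite ltn_eqF // (leq_trans (ltn_ord l)).
by rewrite (bigD1 (Ordinal iP)) //= eqxx big1 ?addr0 // => l li; rewrite ifN.
Qed.

Section StableReduction.
Variables (R : realType) (k : finFieldType).

Lemma drinfeld_rank_gt0 (F : fieldType) (gam : {poly k} ->
  F) (phi : drinfeld gam) r :
  drinfeld_rank phi r -> (0 < r)%N.
Proof.
move=> rk; rewrite lt0n; apply/eqP => r0.
have [a] := drinfeld_nontrivial phi; apply.
have q1 := finNzRing_gt1 k.
apply/polyP => i; rewrite coefZ coefX.
have [i2|i2] := ltnP i 2.
  rewrite drinfeld_lin ?(leq_trans i2) //.
  by case: eqP; rewrite ?mulr1 ?mulr0.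
rewrite gtn_eqF // mulr0; have [->|a0] := eqVneq a 0;
  first by rewrite drinfeld0 coef0.
by apply: nth_default; rewrite rk // r0 mul0n expn0.
Qed.

(** With phi(alpha X) = alpha psi(X) and rho = |alpha|, the monomial of degree i of phi_a has size
    rho |psi_(a,i)| at radius rho. The rank of the reduction locates the last coefficient of psi_a
    that is a unit. *)
Lemma newton_of_stable (F : fieldType) (N : absval R F) (gam : {poly k} -> F)
    (phi : drinfeld gam) d :
  potentially_stable_reduction N phi d ->
  (0 < d)%N /\ exists rho, newton N phi rho d.
Proof.
move=> [F' [N' [ext [psi [[alpha alpha0 iso]
  [int [kappa [red [[red1 redDM red0 redS] [phibar [phibarE rk]]]]]]]]]]].
split; first exact: drinfeld_rank_gt0 rk.
have rho0 : 0 < N' alpha by rewrite absval_gt0.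
have red_0 : red 0 = 0.
  by apply/red0; rewrite ?absval0 ?ler01 ?ltr01.
have E a i : gval N (N' alpha) (phi a) i = N' alpha * N' (psi a)`_i.
  rewrite /gval -ext -absvalX -!absvalM -coefZ -iso coef_comp_scaleX /=.
  by rewrite /base_change_fun coef_map.
exists (N' alpha); split=> // a a0; set i0 := (_ ^ _)%N.
have sz : size (map_poly red (psi a)) = i0.+1 by rewrite -phibarE rk.
have coefE i : (map_poly red (psi a))`_i = red (psi a)`_i by rewrite coef_map_id0.
have lt1 i : (i0 < i)%N -> N' (psi a)`_i < 1.
  by move=> h; apply/red0 => //; rewrite -coefE nth_default // sz.
have eq1 : N' (psi a)`_i0 = 1.
  apply/eqP; rewrite eq_le int leNgt; apply/negP => /red0 h.
  have : lead_coef (map_poly red (psi a)) != 0 by rewrite lead_coef_eq0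
    -size_poly_eq0 sz.
  by rewrite lead_coefE sz coefE h ?int ?eqxx.
split; last by rewrite E eq1 mulr1.
split; rewrite E eq1 mulr1 // => i; rewrite E.
  by rewrite ler_piMr // ltW.
by move=> h; rewrite gtr_pMr // lt1.
Qed.

End StableReduction.

Section Transfer.
Variables (R : realType) (k : finFieldType) (F E : fieldType) (j : {rmorphism F
  -> E}).
Variables (NF : absval R F) (NE : absval R E).
Hypothesis ext : absval_extends j NF NE.
Variables (gF : {poly k} -> F) (gE : {poly k} -> E).
Variables (phi : drinfeld gF) (psi : drinfeld gE).
Hypothesis phipsi : forall a, psi a = map_poly j (phi a).

Lemma newton_transfer rho d : newton NF phi rho d -> newton NE psi rho d.
Proof.
move=> [rho0 h]; split=> // a /h {h}.
have G t i : gval NE t (psi a) i = gval NF t (phi a) i.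
  by rewrite /gval phipsi coef_map ext.
move=> [[h1 h2 h3] h4]; rewrite G; split=> //; split; rewrite ?G //.
  by move=> i; rewrite !G; exact: h2.
by move=> i; rewrite !G; exact: h3.
Qed.

Lemma rank_transfer r : drinfeld_rank phi r -> drinfeld_rank psi r.
Proof. by move=> h a a0; rewrite phipsi size_map_poly h. Qed.

Lemma horner_transfer a x : (psi a).[j x] = j (phi a).[x].
Proof. by rewrite phipsi horner_map. Qed.

Lemma FJ_transfer x : FJ_berk psi (typeI NE (j x)) <-> FJ_berk phi (typeI NF x).
Proof.
by split=> -[B hB]; exists B => a; have := hB a;
   rewrite !berk_actX /= /typeI_fun horner_transfer ext.
Qed.

End Transfer.

Section Presentation.
Variables (R : realType) (k : finFieldType) (F C : fieldType).
Variables (N : absval R C) (j : {rmorphism F -> C}).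
Variables (gam : {poly k} -> F) (phi : drinfeld gam).
Local Notation psi := (base_change j phi).
Local Notation B x := (FJ_berk psi (typeI N (j x))).

(** The quotient is handled through a class map on the field itself, meaningful on bounded points
    only. The same interface can then be realized on the algebraic closure of L_v. *)
Lemma FJquot_presentation : exists cl : F -> FJquot N j phi,
  [/\ forall a x y, B x -> B y -> cl ((phi a).[x] + y) = a *: cl x + cl y,
    forall x, B x -> (cl x = 0 <-> FJ0_berk psi (typeI N (j x))) &
    forall z, exists x, B x /\ cl x = z].
Proof.
pose M := @FJ R k F C N j gam phi; pose V := submod M.
have memE x : B x <-> x \in M by split=> [h|/asboolP //]; exact/asboolP.
pose sub (x : F) : V := if pselect (x \in M) is left h then Submod h else 0.
have subE x : B x -> submod_val (sub x) = x.
  by move=> /memE h; rewrite /sub; case: pselect.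
pose cl x : FJquot N j phi :=
  quotmod_pi (@submod_in {poly k} (dmod phi) M (@FJ0 R k F C N j gam phi)) (sub x).
exists cl; split.
- move=> a x y bx by_; have bz : B ((phi a).[x] + y).
    apply/memE; apply: (@FJ_submod R k F C N j gam phi).2; exact/memE.
  rewrite -[RHS]/(quotmod_scale a (quotmod_pi _ _) + quotmod_pi _ _).
  rewrite quotmod_piZ -quotmod_piD; congr quotmod_pi.
  apply: val_inj; rewrite [LHS]subE //.
  transitivity (a *: (submod_val (sub x)) + submod_val (sub y)); last by [].
  by rewrite !subE.
- by move=> x bx; rewrite /cl quotmod_pi_eq0 inE /= subE //.
- move=> z; have [v <-] := quotmod_pi_surj z; exists (submod_val v).
  have bv : B (submod_val v) by apply/memE; case: v.
  split=> //; rewrite /cl; congr quotmod_pi; apply: val_inj => /=; exact: subE.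
Qed.

End Presentation.

(** * The valuation bound *)

Section ValuationBound.
Variables (R : realType) (k : finFieldType) (F : fieldType) (N : absval R F).
Variables (v : F -> int) (gam : {poly k} -> F) (phi : drinfeld gam).
Variables (rho : R) (d r : nat).
Hypotheses (vN : is_normalized_valuation N v) (phiN : newton N phi rho d).
Hypotheses (d0 : (0 < d)%N) (phir : drinfeld_rank phi r).
Local Notation q := #|k|.
Local Notation b j := (drinfeld_coef phi j).
Local Notation e := (q ^ d).-1.
Local Notation f := (q ^ r).-1.
Local Notation w j := (- v (b j)).

Let rho0 : 0 < rho. Proof. by case: phiN. Qed.
Let q1 : (1 < q)%N. Proof. exact: finNzRing_gt1. Qed.
Let q0 m : (0 < q ^ m)%N. Proof. by rewrite expn_gt0 (ltnW q1). Qed.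

Lemma normalized_base : exists2 c : R, 1 < c & forall x, x != 0 -> N x =
  c ^ (- v x).
Proof.
have [[c [c0 c1 cE]] _] := vN; exists c^-1; first by rewrite invf_gt1.
by move=> x x0; rewrite cE // exprz_inv opprK.
Qed.

Let X0 : 'X != 0 :> {poly k}. Proof. by rewrite polyX_eq0. Qed.

Lemma newton_coef_d : b d != 0 /\ N (b d) * rho ^+ e = 1.
Proof.
have [[g0 _ _] g] := phiN.2 _ X0; rewrite size_polyX /= muln1 in g0 g.
have E : N (b d) * rho ^+ e * rho = rho.
  by rewrite -mulrA -exprSr prednK.
split.
  by apply/eqP => h; move: g0; rewrite /gval -/(b d) h absval0 mul0r ltxx.
by apply: (mulIf (x := rho)); rewrite ?mul1r // gt_eqF.
Qed.

Lemma newton_coef_le j : N (b j) * rho ^+ (q ^ j).-1 <= 1.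
Proof.
rewrite -(ler_pM2r rho0) mul1r -mulrA -exprSr prednK //.
exact: (newton_le phiN 'X (q ^ j)).
Qed.

Lemma coef_r_neq0 : b r != 0.
Proof.
rewrite /drinfeld_coef -[(q ^ r)%N]/((q ^ r)%N.+1.-1) -(size_phiX phir) -lead_coefE.
by rewrite lead_coef_eq0 -size_poly_gt0 (size_phiX phir).
Qed.

Lemma d_le_r : (d <= r)%N. Proof. exact: newton_rank_le phiN phir. Qed.

(** Eliminating rho by rho^e = 1 / |b_d| turns |b_j| rho^(q^j - 1) <= 1 into a comparison of slopes,
    here cleared of denominators. The maximum in -v(j_phi) is therefore attained at j = d. *)
Lemma coef_slope j : b j != 0 -> e%:Z * w j <= (q ^ j).-1%:Z * w d.
Proof.
move=> bj; have [c c1 cE] := normalized_base; have [bd rhoe] := newton_coef_d.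
rewrite -(ler_eXz2l c1) ![_%:Z * _]mulrC -!exprz_exp -!cE // -!exprnP.
have := newton_coef_le j => h.
have h2 : (N (b j) * rho ^+ (q ^ j).-1) ^+ e <= 1.
  by rewrite exprn_ile1 // mulr_ge0 ?absval_ge0 ?exprn_ge0 // ltW.
move: h2; rewrite exprMn -exprM mulnC exprM => h2.
have Nd0 : 0 < N (b d) by rewrite absval_gt0.
have rE : rho ^+ e = (N (b d))^-1.
  by apply: (mulfI (lt0r_neq0 Nd0)); rewrite rhoe divff // gt_eqF.
by move: h2; rewrite rE exprVn ler_pdivrMr ?exprn_gt0 // mul1r.
Qed.

Let e0 : (0 < e)%N.
Proof. by rewrite -subn1 subn_gt0 -{1}(expn0 q) ltn_exp2l. Qed.

Let f0 : (0 < f)%N.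
Proof. by rewrite -subn1 subn_gt0 -{1}(expn0 q) ltn_exp2l // (leq_trans d0
  d_le_r). Qed.

Lemma minus_vj_eq :
  minus_vj v phi r * (e%:Z * f%:Z)%:~R = (f%:Z * w d - e%:Z * w r)%:~R.
Proof.
have den j : ((q ^ j)%:R - 1 : rat) = (q ^ j).-1%:R.
  by rewrite -[in LHS](prednK (q0 j)) -natr1 addrK.
have natE m : m%:R = m%:Z%:~R :> rat by rewrite pmulrn.
have maxE : \big[Num.max/vj_term v phi r]_(1 <=
  j < r.+1 | b j != 0) vj_term v phi j =
   vj_term v phi d.
  have termE j : (0 < j)%N -> b j != 0 -> vj_term v phi j <= vj_term v phi d.
    move=> j0 bj; rewrite /vj_term !den.
    have fj0 : (0 < (q ^ j).-1)%N by rewrite -subn1 subn_gt0 -{1}(expn0 q)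
      ltn_exp2l.
    rewrite ler_pdivrMr ?ltr0n // mulrAC ler_pdivlMr ?ltr0n //.
    by rewrite !natE -!intrM ler_int ![_ * _%:Z]mulrC; exact: coef_slope.
  apply/eqP; rewrite eq_le; apply/andP; split.
    rewrite big_nat_cond; apply: bigmax_le.
      by apply: termE; [exact: leq_trans d_le_r|exact: coef_r_neq0].
    by move=> j /andP [/andP [j0 _] bj]; exact: termE.
  apply: le_bigmax_seq; last by case: newton_coef_d.
  by rewrite mem_index_iota d0 ltnS d_le_r.
rewrite /minus_vj maxE /vj_term !den mulrDl !intrM rmorphB /= !intrM.
have eR : (e%:R : rat) != 0 by rewrite pnatr_eq0 -lt0n.
have fR : (f%:R : rat) != 0 by rewrite pnatr_eq0 -lt0n.
rewrite -!natE.
have -> : (- v (b d))%:~R / e%:R * (e%:R * f%:R) = f%:R * (- v (b d))%:~R :> rat.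
  by rewrite mulrA divfK // mulrC.
have -> : (v (b r))%:~R / f%:R * (e%:R * f%:R) = e%:R * (v (b r))%:~R :> rat.
  by rewrite [e%:R * _]mulrC mulrA divfK // mulrC.
by congr (_ + _); rewrite rmorphN mulrN opprK.
Qed.

(** The numerator is an integer bound for -v(j_phi) depending on nothing else. The factor 2 answers
    the square in the escape condition, and the successor provides a factor q^d against q^d - 1. *)
Definition lift_depth : nat := (2 * `|numq (minus_vj v phi r)|).+1.

Lemma slope_lt_depth :
  (2%:Z * (f%:Z * w d - e%:Z * w r) < (q ^ (d * lift_depth) * q ^ r)%N%:Z).
Proof.
set M := `|numq (minus_vj v phi r)|%N; set E := f%:Z * w d - _.
have JM : minus_vj v phi r <= M%:R.
  set J := minus_vj v phi r in M *.
  have [J0|J0] := leP J 0; first exact: le_trans J0 (ler0n _ _).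
  have -> : M%:R = (numq J)%:~R :> rat.
    by rewrite /M pmulrn gez0_abs // numq_ge0 ltW.
  by rewrite numqE ler_peMr ?(ltW J0) // -[1]/(1%:~R) ler_int; have := denq_gt0 J.
have EM : E <= M%:Z * (e%:Z * f%:Z).
  rewrite -(ler_int rat) -minus_vj_eq [in leRHS]intrM ler_wpM2r //.
have big : (2 * M * e < q ^ (d * lift_depth))%N.
  rewrite expnM /lift_depth -/M expnS mulnC.
  apply: (@leq_trans ((q ^ d) * (2 * M).+1)).
    rewrite mulnS -[in X in (_ < _ + X)%N](prednK (q0 d)) mulSn.
    by have := e0; lia.
  rewrite leq_mul2l; apply/orP; right.
  by apply: ltn_expl; rewrite -{1}(expn0 q) ltn_exp2l.
have qr : (q ^ r)%N = f.+1 by rewrite prednK.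
rewrite qr; apply: le_lt_trans (ler_wpM2l _ EM) _ => //.
have : (2 * M * e * f < q ^ (d * lift_depth) * f.+1)%N.
  apply: (@leq_ltn_trans (q ^ (d * lift_depth) * f));
    first by rewrite leq_mul2r ltnW ?orbT.
  by rewrite ltn_pmul2l.
lia.
Qed.

(** Here y is the size of a T^m-preimage of a bounded point of relative radius t. If y reached |x|,
    then t would be at least (|x| / rho)^(q^(d m)), and the escape bound raised to the power e would
    contradict [slope_lt_depth]. *)
Lemma small_lift_lt (y t : R) (x : F) : 0 <= y -> 
  (y / rho) ^+ (q ^ (d * lift_depth)) <= t ->
  udisc N phi rho r ^+ 2 * t ^+ (q ^ r) <= 1 -> rho < N x -> y < N x.
Proof.
move=> y0 yt ut rx; rewrite ltNge; apply/negP => xy.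
have [c c1 cE] := normalized_base; have [bd rhoe] := newton_coef_d.
have br := coef_r_neq0; have c0 := lt_trans ltr01 c1.
have cn0 : c != 0 by rewrite gt_eqF.
have x0 : x != 0 by rewrite -(absval_gt0 N) (lt_trans rho0).
set i := (q ^ (d * lift_depth))%N in yt; set n := (q ^ r)%N in ut.
have Nd0 : 0 < N (b d) by rewrite absval_gt0.
have rE : rho ^+ e = (N (b d))^-1.
  by apply: (mulfI (lt0r_neq0 Nd0)); rewrite rhoe divff // gt_eqF.
(* Although rho may lie outside the value group, rho^e = 1 / |b_d| is in it; so (|x| / rho)^e is an
   integral power of c, and being above 1 it is at least c. *)
have xe : c <= (N x / rho) ^+ e.
  have gt1 : 1 < (N x / rho) ^+ e.
    by rewrite exprn_egt1 -?lt0n // ltr_pdivlMr // mul1r.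
  have EE : (N x / rho) ^+ e = c ^ (- v x * e%:Z + w d).
    by rewrite expr_div_n rE invrK expfzDr // -exprz_exp -!cE.
  rewrite EE in gt1 *; rewrite -[c in c <=
    _]expr1z ler_eXz2l // -(expr0z c) ltr_eXz2l // in gt1 *.
set E := f%:Z * w d - e%:Z * w r.
have uE : udisc N phi rho r ^+ e = c ^ (- E).
  have -> : udisc N phi rho r = N (b r) * rho ^+ f.
    by rewrite /udisc /gval -[X in rho ^+ X](prednK (q0 r)) exprSr mulrA mulfK
      // gt_eqF.
  rewrite exprMn -exprM mulnC exprM rE exprVn.
  rewrite !cE // !exprnP !exprz_exp invr_expz -expfzDr //; congr (c ^ _).
  rewrite /E; ring.
have t0 : 0 <= t by apply: le_trans yt; rewrite exprn_ge0 // divr_ge0 // ltW.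
have h1 : c ^+ (i * n) <= (t ^+ n) ^+ e.
  apply: (@le_trans _ _ (((N x / rho) ^+ e) ^+ (i * n))).
    by rewrite lerXn2r // ?nnegrE ?exprn_ge0 ?divr_ge0 ?absval_ge0 // ltW.
  rewrite -exprM mulnC exprM exprM lerXn2r // ?nnegrE ?exprn_ge0 ?divr_ge0
    ?absval_ge0 // ?(ltW rho0) //.
  rewrite lerXn2r // ?nnegrE ?exprn_ge0 ?divr_ge0 ?absval_ge0 // ?(ltW rho0) //.
  apply: le_trans yt; rewrite lerXn2r // ?nnegrE ?divr_ge0 ?absval_ge0 // ?(ltW
    rho0) //.
  by rewrite ler_pM2r // invr_gt0.
have u0 := udisc_gt0 phiN phir.
have h2 : (udisc N phi rho r ^+ e) ^+ 2 * (t ^+ n) ^+ e <= 1.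
  rewrite -exprM mulnC exprM -exprMn exprn_ile1 //.
  by rewrite mulr_ge0 ?exprn_ge0 // ltW.
have : c ^ ((i * n)%N%:Z - 2%:Z * E) <= 1.
  apply: le_trans h2; rewrite uE addrC expfzDr // -exprnP.
  have -> : c ^ (- (2%:Z * E)) = (c ^ (- E)) ^+ 2 by rewrite exprnP exprz_exp;
    congr (c ^ _); ring.
  by rewrite ler_wpM2l // exprn_ge0 // exprz_ge0 // ltW.
rewrite -(expr0z c) ler_eXz2l // subr_le0 leNgt => /negP; apply.
exact: slope_lt_depth.
Qed.

End ValuationBound.

(** * The degree bound *)

Section DegreeBound.
Variables (k : finFieldType) (s m : nat).
Local Notation A := {poly k}.
Local Notation q := #|k|.
Variables (V M : lmodType A) (iota : V -> M) (small : M -> Prop).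
Hypothesis iotaP : forall a u v, iota (a *: u + v) = a *: iota u + iota v.
Hypothesis iota_inj : forall u, iota u = 0 -> u = 0.
Hypothesis Mtors : forall z : M, exists2 a : A, a != 0 & a *: z = 0.
Hypothesis Mcard : forall a : A, a != 0 -> torsion_card s M a.
Hypothesis small_lift : forall z : M, exists w, small w /\ 'X^m *: w = z.
Hypothesis small_iota : forall w w' u, small w -> small w' -> iota u = w - w' ->
  u = 0.

Let iota0 : iota 0 = 0.
Proof. by have := iotaP (-1) 0 0; rewrite scaler0 addr0 scaleN1r addNr. Qed.

Let iotaZ a u : iota (a *: u) = a *: iota u.
Proof. by have := iotaP a u 0; rewrite !addr0 iota0 addr0. Qed.

(* With M[b] lifted to small elements through 'X^m, the elements a u + w with
   deg a <= s m and w a lift are too many for M[b X^m] to hold distinctly. *)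
Lemma small_annihilator (u : V) :
  exists c : A, [/\ c != 0, (size c <= (s * m).+1)%N & c *: u = 0].
Proof.
have [b b0 bu] := Mtors (iota u).
have Xm0 : 'X^m != 0 :> A by rewrite -size_poly_gt0 size_polyXn.
have [l [ul lb sl]] := Mcard b0.
have [l' [ul' lb' sl']] := Mcard (mulf_neq0 b0 Xm0).
have /choice [w wP] := small_lift.
pose g (vi : 'rV[k]_((s * m).+1) * 'I_(size l)) : M :=
  rVpoly vi.1 *: iota u + w l`_vi.2.
have gl' vi : g vi \in l'.
  rewrite lb' /g scalerDr -!scalerA; apply/eqP.
  have [_ ->] := wP l`_vi.2.
  have -> : b *: l`_vi.2 = 0 by apply/eqP; rewrite -lb mem_nth.
  rewrite addr0 !scalerA -mulrA mulrC -scalerA bu; exact: scaler0.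
have gidx vi : (index (g vi) l' < size l')%N by rewrite index_mem.
(* With D = deg b, there are q^(s m + 1 + s D) pairs against q^(s (D + m)) elements of torsion. *)
have /injectivePn [[v i] [[v' i'] ne /(congr1 val) /= gE]] :
    ~~ injectiveb (fun vi => Ordinal (gidx vi)).
  apply/injectiveP => /leq_card.
  rewrite card_prod card_mx !card_ord sl sl' mul1n size_mul // size_polyXn.
  have sb : (0 < size b)%N by rewrite size_poly_gt0.
  rewrite -expnD leq_exp2l ?finNzRing_gt1 // => h.
  have E : (((size b + m.+1).-1).-1 = (size b).-1 + m)%N by lia.
  by move: h; rewrite E mulnDr addSn addnC ltnn.
have gg : g (v, i) = g (v', i').
  by rewrite -(nth_index 0 (gl' (v, i))) gE nth_index.
have [vv'|vv'] := eqVneq v v'.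
  case/eqP: ne; rewrite vv'; congr (_, _).
  move: gg; rewrite /g vv' => /addrI /(congr1 (fun z => 'X^m *: z)).
  rewrite (wP _).2 (wP _).2 => /eqP; rewrite nth_uniq // => /eqP h.
  exact: val_inj.
exists (rVpoly v - rVpoly v'); split.
- by rewrite subr_eq0 (inj_eq (can_inj (@rVpolyK _ _))).
- by rewrite -raddfB size_poly.
- apply: (@small_iota (w l`_i') (w l`_i)); try exact: (wP _).1.
  rewrite iotaZ scalerBl; apply/eqP; rewrite subr_eq.
  apply/eqP/(addIr (w l`_i)); rewrite [RHS]addrAC subrK [RHS]addrC; exact: gg.
Qed.

Lemma torsion_rank_le_sub pi : irreducible_poly pi -> torsion_rank_le s V pi.
Proof.
move=> irr f fpi free z piz.
have iota_lcomb x : iota (lcomb f x) = lcomb (fun i => iota (f i)) x.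
  rewrite /lcomb; apply: (big_ind2 (fun u v => iota u = v)) => //.
  by move=> u1 u2 v1 v2 <- <-; rewrite -{1}[u1]scale1r iotaP scale1r.
have fpi' i : pi *: iota (f i) = 0 by rewrite -iotaZ fpi.
have free' : free_on [set: 'I_s]%SET pi (fun i => iota (f i)).
  by move=> x fx; apply: free; apply: iota_inj; rewrite iota_lcomb.
have piz' : pi *: iota z = 0 by rewrite -iotaZ piz.
have [x zx] := torsion_rank_le_card Mcard irr fpi' free' piz'.
exists x; apply/eqP; rewrite -subr_eq0; apply/eqP/iota_inj.
by rewrite addrC -scaleN1r iotaP zx iota_lcomb scaleN1r addNr.
Qed.

Lemma iso_bounded_degree : exists a : 'I_s -> A,
  (forall i, a i != 0 /\ ((size (a i)).-1 <= s * m)%N) /\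
  lmod_iso V (dsum (fun i => polymod (a i))).
Proof.
(* A common multiple of all candidate annihilators of degree at most s m, hence a single polynomial
   killing V. *)
pose b : A := \prod_(v : 'rV[k]_((s * m).+1) | rVpoly v != 0) rVpoly v.
have b0 : b != 0 by apply/prodf_neq0.
have bV (z : V) : b *: z = 0.
  have [c [c0 cs cz]] := small_annihilator z.
  have cE : rVpoly (poly_rV c : 'rV[k]_((s * m).+1)) = c by rewrite poly_rV_K.
  rewrite /b (bigD1 (poly_rV c)) ?cE //= mulrC -scalerA cz.
  exact: scaler0.
have [||g [a [_ gen ag rel]]]
  := @torsion_structure k s V b (fun=> True) torsion_rank_le_sub b0.
- by split.
- by move=> z _; exact: bV.
exists a; split.
  move=> i; split; first by case: (ag i).
  have [c [c0 cs cz]] := small_annihilator (g i).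
  have := rel (fun j => c * unitv k i j).
  rewrite -lcombZ lcomb_unitv => /(_ cz i); rewrite /unitv eqxx mulr1 =>
    /(dvdp_leq c0) h.
  by rewrite -ltnS prednK ?size_poly_gt0 ?(ag i).1 // (leq_trans h).
apply: (iso_dsum_polymod (g := g)) => //; first by move=> z; exact: gen.
by move=> i; case: (ag i).
Qed.

End DegreeBound.

(** * The two quotients *)

Section Assembly.
Variables (R : realType) (k : finFieldType).
Variables (NK : absval R {fraction {poly k}}).
Variables (Kv : fieldType) (NKv : absval R Kv) (iK : {rmorphism {fraction {poly
  k}} -> Kv}).
Variables (Lv : fieldExtType Kv) (NL : absval R Lv) (v : Lv -> int).
Variables (Lbar : fieldType) (Nbar : absval R Lbar) (iL : {rmorphism Lv -> Lbar}).
Variables (Cv : fieldType) (NC : absval R Cv) (iC : {rmorphism Lbar -> Cv}).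
Variables (phi : drinfeld (in_alg Lv \o iK \o @tofrac {poly k})) (d s : nat)
  (rho : R).
Hypothesis NKfin : is_finite_place NK.
Hypothesis Kv_compl : is_completion iK NK NKv.
Hypothesis extL : absval_extends (in_alg Lv) NKv NL.
Hypothesis vN : is_normalized_valuation NL v.
Hypothesis iL_clos : is_algebraic_closure iL.
Hypothesis extLbar : absval_extends iL NL Nbar.
Hypothesis Cv_compl : is_completion iC Nbar NC.
Hypothesis phir : drinfeld_rank phi (d + s).
Hypothesis d0 : (0 < d)%N.
Hypothesis phiN : newton NL phi rho d.

Local Notation phiB := (base_change iL phi).
Local Notation psiL := (base_change (iC \o iL) phi).
Local Notation psiM := (base_change idfun psiL).
Local Notation V := (FJquot NC (iC \o iL) phi).
Local Notation M := (FJquot NC idfun psiL).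
Local Notation bL x := (FJ_berk phi (typeI NL x)).
Local Notation bB x := (FJ_berk phiB (typeI Nbar x)).
Local Notation bC x := (FJ_berk psiM (typeI NC x)).

Let rho0 : 0 < rho. Proof. by case: phiN. Qed.

Let extC : absval_extends iC Nbar NC. Proof. by case: Cv_compl. Qed.

Let extLC : absval_extends (iC \o iL) NL NC.
Proof. by move=> x; rewrite /= extC extLbar. Qed.

Let phiBE a : phiB a = map_poly iL (phi a). Proof. by []. Qed.

Let psiLE a : psiL a = map_poly (iC \o iL) (phi a). Proof. by []. Qed.

Let psiME a : psiM a = map_poly iC (phiB a).
Proof. by apply/polyP => i; rewrite !coef_map. Qed.

Let pchar_facts : exists p, [/\ p \in [pchar k], p \in [pchar Lbar]
  & p \in [pchar Cv]].
Proof.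
have [p [f [_ pk _ _]]] := card_finField_pchar k.
have pKv : p \in [pchar Kv].
  exact: (@rmorph_pchar_in k Kv (iK \o @tofrac {poly k} \o polyC) p pk).
have pB : p \in [pchar Lbar]
  := rmorph_pchar_in iL (rmorph_pchar_in (in_alg Lv) pKv).
have pCv : p \in [pchar Cv] := rmorph_pchar_in iC pB.
by exists p.
Qed.

Let phiBN : newton Nbar phiB rho d. Proof. exact: (newton_transfer extLbar phiBE
  phiN). Qed.
Let psiMN : newton NC psiM rho d. Proof. exact: (newton_transfer extC psiME
  phiBN). Qed.
Let psiLN : newton NC psiL rho d. Proof. exact: (newton_transfer extLC psiLE
  phiN). Qed.
Let phiBr : drinfeld_rank phiB (d + s). Proof. exact: (rank_transfer phiBE
  phir). Qed.
Let psiMr : drinfeld_rank psiM (d + s). Proof. exact: (rank_transfer psiME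
  phiBr). Qed.
Let psiLr : drinfeld_rank psiL (d + s). Proof. exact: (rank_transfer psiLE
  phir). Qed.

Let bBC y : bC (iC y) <-> bB y. Proof. exact: (FJ_transfer extC psiME y). Qed.
Let bLB x : bB (iL x) <-> bL x. Proof. exact: (FJ_transfer extLbar phiBE x). Qed.
Let bLC x : FJ_berk psiL (typeI NC ((iC \o iL) x)) <-> bL x.
Proof. exact: (FJ_transfer extLC psiLE x). Qed.

Let gamB0 a : a != 0 -> (iL \o (in_alg Lv \o iK \o @tofrac {poly k})) a != 0.
Proof.
move=> a0; rewrite -[X in X != 0]/(iL (in_alg Lv (iK (tofrac a)))).
by rewrite fmorph_eq0 (fmorph_eq0 (in_alg Lv)) fmorph_eq0 tofrac_eq0.
Qed.

Let clLbar : GRing.closed_field_axiom Lbar. Proof. by case: iL_clos. Qed.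

Lemma classes_Lbar : exists cl : Lbar -> M,
  [/\ forall a x y, bB x -> bB y -> cl ((phiB a).[x] + y) = a *: cl x + cl y,
    forall x, bB x -> (cl x = 0 <-> Nbar x <= rho) &
    forall z, exists x, bB x /\ cl x = z].
Proof.
have [p [pk _ pC]] := pchar_facts.
have [clM [clMP clM0 clMsurj]] := FJquot_presentation NC idfun psiL.
exists (clM \o iC); split.
- move=> a x y /bBC bx /bBC by_; rewrite /= -clMP //; congr clM.
  have psiLB : psiL a = map_poly iC (phiB a).
    by apply/polyP => i; rewrite !coef_map.
  by rewrite psiLB horner_map rmorphD.
- move=> x /bBC bx; rewrite /= clM0 // (FJ0_typeI pk pC psiMN d0 psiMr) /=.
  by rewrite extC.
- move=> z; have [x [bx <-]] := clMsurj z.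
  have [_ _ dense] := Cv_compl; have [y hy] := dense x rho rho0.
  have bxy : bC (iC y - x).
    by apply: (FJ_of_le psiMN); rewrite /= /typeI_fun hornerX -absvalN opprB ltW.
  have by_ : bC (iC y).
    have := @FJ_closed _ _ _ NC _ psiM 1 (iC y - x) x bxy bx.
    by rewrite drinfeld1 hornerX subrK.
  exists y; split; first exact/bBC.
  have := clMP 1 (iC y - x) x bxy bx; rewrite drinfeld1 hornerX subrK /= => ->.
  rewrite scale1r; suff -> : clM (iC y - x) = 0 by rewrite add0r.
  apply/clM0 => //; apply/(FJ0_typeI pk pC psiMN d0 psiMr) => /=.
  by rewrite -absvalN opprB ltW.
Qed.

(** Two of the points phi_(T^n)(x) are within rho of each other, and the difference of the two
    powers of T sends x into the disc. *)
Lemma bounded_torsion x : bB x -> exists2 a, a != 0 & Nbar (phiB a).[x] <= rho.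
Proof.
move=> [B hB]; have [I [W hW]] := algebraic_in_span (iL_clos.2 x).
have ext : absval_extends (iL \o in_alg Lv) NKv Nbar by move=> y;
  rewrite /= extLbar extL.
have resKv := completion_residue Kv_compl (finite_place_residue NKfin).
have [||n [m [nm close]]]
  := @bounded_sequence_close R Kv Lbar (iL \o in_alg Lv) NKv Nbar I W
    (fun n => (phiB 'X^n).[x]) B rho ext resKv rho0.
- by move=> n; rewrite phiBE; exact: hW.
- by move=> n; have := hB 'X^n; rewrite berk_actX.
exists ('X^m - 'X^n).
  by rewrite subr_eq0; apply/eqP => /(congr1 (fun P : {poly k} => size P));
    rewrite !size_polyXn; lia.
have -> : phiB ('X^m - 'X^n) = phiB 'X^m - phiB 'X^n.
  apply/eqP; rewrite eq_sym subr_eq -drinfeldD subrK //.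
by rewrite hornerD hornerN.
Qed.

Lemma iso_Cv : lmod_iso M (dsum (fun _ : 'I_s => KmodA k)).
Proof.
have [cl [clP cl0 clS]] := classes_Lbar.
apply: iso_KmodA.
- move=> z; have [x [bx <-]] := clS z; have [a a0 ax] := bounded_torsion bx.
  exists a => //; rewrite -(clZ phiBN clP cl0) //; apply/cl0 => //.
  exact: boundedZ.
- by move=> a z; exact: (cl_divisible clLbar phiBN clP cl0 clS).
- by move=> a; exact: (cl_torsion_card clLbar phiBN phiBr gamB0 clP cl0 clS).
Qed.

Lemma iso_Lv : exists a : 'I_s -> {poly k},
  (forall i, a i != 0 /\
     ((size (a i)).-1 <= s * (2 * `|numq (minus_vj v phi (d + s))|).+1)%N) /\
  lmod_iso V (dsum (fun i => polymod (a i))).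
Proof.
have [p [pk pB pC]] := pchar_facts.
have [cl [clP cl0 clS]] := classes_Lbar.
have [clL [clLP clL0 clLS]] := FJquot_presentation NC (iC \o iL) phi.
have {}clLP a x y : bL x -> bL y -> clL ((phi a).[x] + y) = a *: clL x + clL y.
  by move=> /bLC bx /bLC by_; exact: clLP.
have {}clL0 x : bL x -> (clL x = 0 <-> NL x <= rho).
  move=> /bLC bx; rewrite clL0 // (FJ0_typeI pk pC psiLN d0 psiLr).
  by rewrite extLC.
have {}clLS z : exists x, bL x /\ clL x = z.
  by have [x [/bLC bx <-]] := clLS z; exists x.
have clLB x y : bL x -> bL y -> clL (x - y) = clL x - clL y.
  exact: (clB clLP).
have bLB' x y : bL x -> bL y -> bL (x - y) by exact: boundedB.
have clL_iL x y : bL x -> bL y -> clL x = clL y -> cl (iL x) = cl (iL y).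
  move=> bx by_ e; have le : NL (x - y) <= rho.
    by apply: (clL0 _ (bLB' _ _ bx by_)).1; rewrite clLB // e subrr.
  have bx' := (bLB x).2 bx; have by' := (bLB y).2 by_.
  apply/eqP; rewrite -subr_eq0 -(clB clP) //; apply/eqP.
  apply: (cl0 _ (boundedB bx' by')).2.
  by rewrite -[iL x - iL y]rmorphB extLbar.
have /choice [rep repP] := clLS.
(* Representatives are chosen arbitrarily; [clL_iL] makes the class in M independent of them. *)
pose iota (z : V) : M := cl (iL (rep z)).
have brep z : bL (rep z) by case: (repP z).
have clrep z : clL (rep z) = z by case: (repP z).
have bZD a x y : bL x -> bL y -> bL ((phi a).[x] + y) by move=> bx by_;
  exact: FJ_closed.
pose n := (#|k| ^ (d + s))%N.
pose mm := (2 * `|numq (minus_vj v phi (d + s))|).+1.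
pose small (w : M) := exists y, [/\ bB y, cl y = w & forall x, rho < NL x ->
  Nbar y < NL x].
apply: (@iso_bounded_degree k s mm V M iota small).
- move=> a z z'; have bz := (bLB _).2 (brep z); have bz' := (bLB _).2 (brep z').
  rewrite /iota -clP // (horner_transfer phiBE) -rmorphD.
  by apply: clL_iL => //; [exact: bZD|rewrite clLP // !clrep].
- move=> z h; rewrite -[z]clrep; apply/clL0 => //; rewrite -extLbar;
    apply/cl0 => //.
  exact/bLB.
- move=> z; have [x [bx <-]] := clS z; have [a a0 ax] := bounded_torsion bx.
  exists a => //; rewrite -(clZ phiBN clP cl0) //; apply/cl0 => //.
  exact: boundedZ.
- by move=> a; exact: (cl_torsion_card clLbar phiBN phiBr gamB0 clP cl0 clS).
- move=> z; have [y [by_ yz]] := clS z.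
  have Xm0 : 'X^mm != 0 :> {poly k} by rewrite -size_poly_gt0 size_polyXn.
  have [w [wy wle]] := drinfeld_small_preim clLbar phiBN y Xm0.
  have bw : bB w by apply: (bounded_preim Xm0); rewrite wy.
  exists (cl w); split; last by rewrite -(clZ phiBN clP cl0) // wy.
  exists w; split=> // x rx.
  have := FJ_bound pk pB phiBN d0 phiBr by_.
  rewrite /tau /= /typeI_fun hornerX => bound.
  apply: (small_lift_lt vN phiN d0 phir (absval_ge0 _ _) (t := Nbar y / rho)) => //.
    by move: wle; rewrite size_polyXn.
  move: bound; rewrite /udisc /gval phiBE coef_map extLbar //.
(* A representative of z outside the disc would dominate y - y', so its difference with y - y' would
   stay outside the disc, although its class is 0. *)
- move=> _ _ z [y [by_ <- ysm]] [y' [by' <- ysm']] e.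
  rewrite -[z]clrep; apply/clL0 => //; rewrite leNgt; apply/negP => rx.
  have bz : bB (iL (rep z)) by exact/bLB.
  have : Nbar (iL (rep z) - (y - y')) <= rho.
    have byy : bB (y - y') by exact: boundedB.
    apply/cl0; first exact: boundedB.
    by rewrite (clB clP) // (clB clP) // -e subrr.
  apply/negP; rewrite -ltNge.
  have -> : Nbar (iL (rep z) - (y - y')) = NL (rep z).
    rewrite -extLbar; apply: (ultra_dominant (absvalD Nbar) (absvalN Nbar)).
    rewrite absvalN extLbar; apply: le_lt_trans (absvalD _ _ _) _.
    by rewrite absvalN gt_max ysm // ysm'.
  exact: rx.
Qed.

End Assembly.

Theorem theorem1p5 (R : realType) :
  exists B : nat -> rat -> nat,
  forall (k : finFieldType)
    (NK : absval R {fraction {poly k}})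
    (Kv : fieldType) (NKv : absval R Kv)
    (iK : {rmorphism {fraction {poly k}} -> Kv})
    (Lv : fieldExtType Kv) (NL : absval R Lv) (v : Lv -> int)
    (Lbar : fieldType) (Nbar : absval R Lbar) (iL : {rmorphism Lv -> Lbar})
    (Cv : fieldType) (NC : absval R Cv) (iC : {rmorphism Lbar -> Cv})
    (phi : drinfeld (in_alg Lv \o iK \o @tofrac {poly k})) (r s : nat),
  is_finite_place NK ->
  is_completion iK NK NKv ->
  absval_extends (in_alg Lv) NKv NL ->
  is_normalized_valuation NL v ->
  is_algebraic_closure iL ->
  absval_extends iL NL Nbar ->
  is_completion iC Nbar NC ->
  drinfeld_rank phi r ->
  potentially_stable_reduction NL phi (r - s) ->
  [/\ exists a : 'I_s -> {poly k},
        (forall i, a i != 0 /\ ((size (a i)).-1 <= B s (minus_vj v phi r))%N) /\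
        lmod_iso (FJquot NC (iC \o iL) phi) (dsum (fun i => polymod (a i))),
      lmod_iso (FJquot NC idfun (base_change (iC \o iL) phi))
               (dsum (fun _ : 'I_s => KmodA k))
    & potentially_good_reduction NL phi ->
        (forall x : FJquot NC (iC \o iL) phi, x = 0) /\
        (forall x : FJquot NC idfun (base_change (iC \o iL) phi), x = 0)].
Proof.
(* This is s m with m the lift depth; it is chosen before [k], so only s and J may occur. *)
exists (fun s J => (s * (2 * `|numq J|).+1)%N).
move=> k NK Kv NKv iK Lv NL v Lbar Nbar iL Cv NC iC phi r s.
move=> NKfin Kv_compl extL vN iL_clos extLbar Cv_compl phir stab.
have [d0 [rho phiN]] := newton_of_stable stab.
(* The reduced rank is positive, so the truncated difference is a true one. *)
have rE : r = (r - s + s)%N by rewrite subnK // ltnW // -subn_gt0.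
have phir' : drinfeld_rank phi (r - s + s) by rewrite -rE.
split.
- by have := iso_Lv NKfin Kv_compl extL vN iL_clos extLbar Cv_compl phir' d0
    phiN; rewrite -rE.
- exact: (iso_Cv NKfin Kv_compl extL iL_clos extLbar Cv_compl phir' d0 phiN).
(* Both isomorphisms are used again with 0 in place of s, where the direct sums are empty. *)
move=> [r' [phir1 good]]; have [d0' [rho' phiN']] := newton_of_stable good.
have phir1' : drinfeld_rank phi (r' + 0) by rewrite addn0.
have triv (U : lmodType {poly k}) (W : 'I_0 -> lmodType {poly k}) :
    lmod_iso U (dsum W) -> forall x : U, x = 0.
  move=> [f bf] x; apply: (bij_inj bf); apply: functional_extensionality_dep =>
    -[] //.
split.
- have [a [_ iso]] := iso_Lv NKfin Kv_compl extL vN iL_clos extLbar Cv_compl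
    phir1' d0' phiN'.
  exact: triv iso.
- exact: triv (iso_Cv NKfin Kv_compl extL iL_clos extLbar Cv_compl phir1' d0'
    phiN').
Qed.
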